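(* There is a constant $C_{B,\mathbf M}$, depending only on $B$, on $\mathbf M=(\overline M_1,\dots,\overline M_K)$ and on the rate of convergence of $M_i/\sum_{l=1}^n D_l$ to $\overline M_i$, such that the following holds. Consider a sequence (indexed by $n$) of degree-corrected stochastic block models on $V=\{1,\dots,n\}$ with parameters $B$, $\boldsymbol\alpha$ (fixed), labels $\{\sigma_u\}_{u=1}^n$ and weights $0<D_1\le D_2\le\dots\le D_n$ (depending on $n$), such that: (i) $\frac{D_uD_v}{n\overline D}B_{\sigma_u\sigma_v}\le 1$ for all $u,v$; (ii) for every $i\in\{1,\dots,K\}$, $\overline D_i/\overline D\to d_i$ as $n\to\infty$ for some non-zero constant $d_i$; (iii) for all $i\ne l$ there exists $j$ such that $\frac{B_{ij}}{\overline M_i}\neq\frac{B_{lj}}{\overline M_l}$; (iv) $D_1^2/\overline D=\Omega(\log n)$; (v) either $\lim_{n\to\infty}D_1/\log n=\infty$, or both $D_1\ge C_{B,\mathbf M}\log n$ and, for some constant $c<1/2$, $\lim_{n\to\infty}D_n^2/n^c=0$. Then, with high probability, Algorithm 1 (described in the context) applied to the observed graph retrieves the community of all but a vanishing fraction of nodes; that is, with probability tending to $1$, its output agrees with the partition of $V$ into the true communities $\{u:\sigma_u=k\}$, $k=1,\dots,K$ (up to a relabelling of the communities), except on $o(n)$ vertices.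
   Context: Degree-corrected stochastic block model (DC-SBM). $K$ is a fixed number of communities, $S=\{1,\dots,K\}$; $B$ is a fixed symmetric $K\times K$ matrix with nonnegative real entries, independent of $n$; $\boldsymbol\alpha=(\alpha_1,\dots,\alpha_K)$ is a fixed vector of positive numbers summing to $1$. Each vertex $u\in V=\{1,\dots,n\}$ has a label $\sigma_u\in S$, with exactly $\alpha_kn$ vertices of label $k$, and a weight $D_u>0$. Labels and weights may depend on $n$. Write $\overline D=\frac1n\sum_{l=1}^nD_l$ and $\overline D_i=\frac1{\alpha_in}\sum_{u:\sigma_u=i}D_u$. The random graph has, independently for each unordered pair $u\ne v$, an edge with probability $\frac{D_uD_v}{n\overline D}B_{\sigma_u\sigma_v}$; there are no loops. $A$ is its adjacency matrix and $\widehat D_u=\sum_vA_{uv}$ is the observed degree of $u$. Put $M_i=\sum_{l=1}^nD_lB_{i\sigma_l}$ and $\overline M_i=\lim_{n\to\infty}M_i/\sum_{l}D_l=\sum_{k=1}^KB_{ik}\alpha_kd_k$, where $d_i=\lim\overline D_i/\overline D$; it is understood that $\overline M_i>0$. ''With high probability'' means with probability tending to $1$ as $n\to\infty$. Normalized adjacency matrix: $\widehat H_{uv}=\frac{1}{\widehat D_u\widehat D_v}$ if $A_{uv}=1$ and $\widehat H_{uv}=0$ otherwise. Choice of $f$ and $\tau$. If $D_1/\log n\to\infty$, $f$ is any function tending to $0$ with $f(n)\gg\frac1{\widehat D_1}+\frac1{\sqrt{\log n}}+\sqrt{\frac{\log n}{\widehat D_1}}$. In the other regime of (v), $f$ is any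 function tending to $0$ with $f(n)\gg\frac1{\widehat D_1}+\frac1{\sqrt{\log n}}+\frac1{\log^{1/3}n}$. Here $a(n)\gg b(n)$ means $a(n)/b(n)\to\infty$ (in probability, since $\widehat D_1$ is random). Further $\tau(n)=1/f(n)^{1/3}$ (rounded to an integer). Algorithm 1. 1. Compute the average degree $\widehat D_{\mathrm{average}}$ of the graph. Let $\widehat L$ be the number of eigenvalues of $\widehat H$ that in absolute value are larger than $f(n)/\widehat D_{\mathrm{average}}$. 2. Compute orthonormal eigenvectors $\widehat x_1,\dots,\widehat x_{\widehat L}$ of $\widehat H$ corresponding to its $\widehat L$ eigenvalues largest in absolute value. 3. To each $u\in V$ associate the vector $\widehat z_u=(\widehat x_1(u),\dots,\widehat x_{\widehat L}(u))$. Pick $\tau(n)$ pairs of vertices (uniformly at random) $(u(1),u'(1)),\dots,(u(\tau(n)),u'(\tau(n)))$. Compute $\delta(t)=\sqrt n\,\|\widehat z_{u(t)}-\widehat z_{u'(t)}\|$ and $\epsilon=\min_{t:\delta(t)>f^{2/3}(n)}\delta(t)$. Find a vertex $m$ such that $\{u':\sqrt n\|\widehat z_m-\widehat z_{u'}\|\le\epsilon/8\}$ has cardinality larger than $f^{1/3}(n)\,n$. Form a community consisting of all nodes in $\{u':\sqrt n\|\widehat z_m-\widehat z_{u'}\|\le\epsilon/4\}$. Remove those nodes and iterate (the search for $m$ and forming of a community) on the remaining nodes, until no such $m$ exists. *)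

(* Defs.v *)
From HB Require Import structures.
From mathcomp Require Import all_boot all_order all_algebra.
From mathcomp Require Import all_classical all_reals all_analysis.

Set Implicit Arguments.
Unset Strict Implicit.
Unset Printing Implicit Defensive.

Import Order.TTheory GRing.Theory Num.Theory.
Import numFieldNormedType.Exports.

Local Open Scope classical_set_scope.
Local Open Scope ring_scope.

(* The vertices 1, ..., n are 'I_n with n = nvert_pred.+1, so that the vertex of
   smallest (resp. largest) weight is [ord0] (resp. [ord_max]). *)
Record dcsbm (R : realType) (K : nat) := DCSBM {
  nvert_pred : nat;
  label : 'I_nvert_pred.+1 -> 'I_K;
  weight : 'I_nvert_pred.+1 -> R }.

Definition nvert (R : realType) (K : nat) (G : dcsbm R K) : nat :=
  (nvert_pred G).+1.

Notation vertex G := 'I_(nvert G).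

Definition logn_vert (R : realType) (K : nat) (G : dcsbm R K) : R :=
  ln (nvert G)%:R.

Definition total_weight (R : realType) (K : nat) (G : dcsbm R K) : R :=
  \sum_(u : vertex G) weight u.

Definition mean_weight (R : realType) (K : nat) (G : dcsbm R K) : R :=
  total_weight G / (nvert G)%:R.

Definition class_mean_weight (R : realType) (K : nat) (alpha : 'I_K -> R)
    (G : dcsbm R K) (i : 'I_K) : R :=
  (\sum_(u : vertex G | label u == i) weight u) / (alpha i * (nvert G)%:R).

Definition block_weight (R : realType) (K : nat) (B : 'M[R]_K)
    (G : dcsbm R K) (i : 'I_K) : R :=
  \sum_(u : vertex G) weight u * B i (label u).

Definition edge_prob (R : realType) (K : nat) (B : 'M[R]_K)
    (G : dcsbm R K) (u v : vertex G) : R :=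
  weight u * weight v / ((nvert G)%:R * mean_weight G)
    * B (label u) (label v).

(* Unordered pairs of distinct vertices, represented by (u, v) with u < v. *)
Definition upair (n : nat) : finType :=
  {e : 'I_n * 'I_n | (e.1 < e.2)%N}.

Definition graph (n : nat) : finType := {ffun upair n -> bool}.

Definition adj (n : nat) (g : graph n) (u v : 'I_n) : bool :=
  [exists e : upair n,
     g e && ((\val e == (u, v)) || (\val e == (v, u)))].

Definition graph_law (R : realType) (K : nat) (B : 'M[R]_K)
    (G : dcsbm R K) (g : graph (nvert G)) : R :=
  \prod_(e : upair (nvert G))
    (let p := edge_prob B (\val e).1 (\val e).2 in
     if g e then p else 1 - p).

Definition graph_Pr (R : realType) (K : nat) (B : 'M[R]_K)
    (G : dcsbm R K) (E : graph (nvert G) -> Prop) : R :=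
  \sum_(g : graph (nvert G) | `[< E g >]) graph_law B g.

(* t independent uniform pairs of vertices (repetitions allowed) *)
Definition pair_sample (n t : nat) : finType :=
  {ffun 'I_t -> 'I_n * 'I_n}.

(* Joint law of the graph and of an independent uniform pair sample. *)
Definition run_Pr (R : realType) (K : nat) (B : 'M[R]_K)
    (G : dcsbm R K) (t : nat)
    (E : graph (nvert G) -> pair_sample (nvert G) t -> Prop) : R :=
  \sum_(g : graph (nvert G))
    \sum_(w : pair_sample (nvert G) t | `[< E g w >])
      graph_law B g / #|pair_sample (nvert G) t|%:R.

Definition degree (n : nat) (g : graph n) (u : 'I_n) : nat :=
  #|[pred v | adj g u v]|.

Definition mean_degree (R : realType) (n : nat) (g : graph n) : R :=
  (\sum_(u < n) (degree g u)%:R) / n%:R.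

Definition normalized_adj (R : realType) (n : nat) (g : graph n) : 'M[R]_n :=
  \matrix_(u, v)
    if adj g u v then 1 / ((degree g u)%:R * (degree g v)%:R) else 0.

(* The eigenvalues of H, with multiplicity, by decreasing absolute value. *)
Definition is_spectrum (R : realType) (n : nat) (H : 'M[R]_n) (s : seq R) :
    Prop :=
  char_poly H = \prod_(a <- s) ('X - a%:P)
  /\ sorted (fun a b : R => `|b| <= `|a|) s.

(* L is the number of eigenvalues larger than thr in absolute value, and the
   rows of X are orthonormal eigenvectors for the L largest ones. *)
Definition spectral_embedding (R : realType) (n : nat) (H : 'M[R]_n) (thr : R)
    (L : nat) (X : 'M[R]_(L, n)) : Prop :=
  exists s : seq R,
    [/\ is_spectrum H s,
        L = count (fun a => thr < `|a|) s,
        X *m X^T = 1%:M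
      & forall i : 'I_L, row i X *m H = s`_i *: row i X].

(* sqrt n times the Euclidean distance between columns u and v of X *)
Definition scaled_dist (R : realType) (n L : nat) (X : 'M[R]_(L, n))
    (u v : 'I_n) : R :=
  Num.sqrt n%:R * Num.sqrt (\sum_(i < L) (X i u - X i v) ^+ 2).

(* The minimum of an empty family is +oo. *)
Definition gap (R : realType) (n L t : nat) (X : 'M[R]_(L, n)) (phi : R)
    (w : pair_sample n t) : \bar R :=
  \big[Order.min/+oo%E]_(j < t | phi `^ (2 / 3)
                                   < scaled_dist X (w j).1 (w j).2)
    (scaled_dist X (w j).1 (w j).2)%:E.

Definition near_in (R : realType) (n L : nat) (X : 'M[R]_(L, n))
    (rem : {set 'I_n}) (m : 'I_n) (rho : \bar R) : {set 'I_n} :=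
  [set u in rem | ((scaled_dist X m u)%:E <= rho)%E]%SET.

Definition dense_center (R : realType) (n L : nat) (X : 'M[R]_(L, n))
    (phi : R) (eps : \bar R) (rem : {set 'I_n}) (m : 'I_n) : bool :=
  (m \in rem)
  && (phi `^ (1 / 3) * n%:R < #|near_in X rem m (eps * (8^-1)%:E)%E|%:R).

(* [out] is a possible list of communities formed, in this order, starting
   from the set [rem] of remaining vertices. *)
Fixpoint clustering (R : realType) (n L : nat) (X : 'M[R]_(L, n))
    (phi : R) (eps : \bar R) (rem : {set 'I_n}) (out : seq {set 'I_n}) :
    Prop :=
  match out with
  | [::] => forall m, ~~ dense_center X phi eps rem m
  | C :: out' =>
      (exists2 m, dense_center X phi eps rem m
                & C = near_in X rem m (eps * (4^-1)%:E)%E)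
      /\ clustering X phi eps (rem :\: C) out'
  end.

(* The algorithm is nondeterministic (choice of the eigenvectors and of the
   centers): [out] is one of its possible outputs on the graph g with sampled
   pairs w, where phi stands for f(n). *)
Definition algorithm_output (R : realType) (n t : nat) (phi : R)
    (g : graph n) (w : pair_sample n t) (out : seq {set 'I_n}) : Prop :=
  exists (L : nat) (X : 'M[R]_(L, n)),
    spectral_embedding (normalized_adj R g) (phi / mean_degree R g) X
    /\ clustering X phi (gap X phi w) [set: 'I_n]%SET out.

(* Up to a bijective relabelling pi, all but at most a fraction e of the
   vertices are put in their community. *)
Definition recovers (R : realType) (K : nat) (G : dcsbm R K) (e : R)
    (out : seq {set vertex G}) : Prop :=
  exists2 pi : 'I_K -> 'I_(size out), bijective pi
    & #|[pred u : vertex G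
           | u \notin nth finset.set0 out (pi (label u))]|%:R
      <= e * (nvert G)%:R.

(* f >> 1/\hat D_1 + 1/sqrt(log n) + rest in probability; the quotient is 0
   when \hat D_1 = 0, whence the conjunct on the degree. *)
Definition dominates_in_Pr (R : realType) (K : nat) (B : 'M[R]_K)
    (G : nat -> dcsbm R K) (f : nat -> R)
    (rest : forall m, graph (nvert (G m)) -> R) : Prop :=
  forall k : R,
    (fun m => graph_Pr B (fun g : graph (nvert (G m)) =>
       (0 < degree g ord0)%N
       /\ k * (1 / (degree g ord0)%:R + 1 / Num.sqrt (logn_vert (G m))
               + rest m g)
          < f (nvert (G m)))) @ \oo --> (1 : R).

(* Main.v *)
(* Let a_u be the expected degree of u and P the block-constant matrix with
   entries B_ij / (n m_i m_j), m_i = M_i / sum_l D_l.  With probability close to 1,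
   the matrix (mean weight) * Hhat is within O(1/sqrt(log n)) of P in operator
   norm: the degrees are within constant factors of the a_u and close to them in
   quadratic mean, and the centred adjacency noise, rescaled by 1/(a_u a_v), has
   norm O(1/sqrt(log n)).  For the latter, split the noise into its two triangular
   parts, whose entries are independent.  The moments E Tr (V V^T)^k, k ~ log n,
   are dominated by those of a matrix with i.i.d. skew entries in {2, -1} whose
   rows and columns are kept independently with probability rho, since the edges
   of a closed walk form a connected graph; and the trace moment of that matrix is
   bounded by testing it against random vectors with roughly Gaussian moments,
   which reduces everything to exponential moments of scalars.
   Since f >> 1/sqrt(log n), the eigenvectors above the threshold are those of
   nonzero eigenvalues of P up to a small error, hence nearly constant on
   communities; hypothesis (iii) keeps the limiting centers apart.  All but a
   fraction f^(2/3) of the vertices are then close to their center, the sampled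
   pairs avoid the others and meet all pairs of communities, and the greedy
   clustering separates the communities. *)

(* The weights may be only of order log n, so the degrees need not concentrate uniformly around
   [a_u] with vanishing relative error. Two weaker facts suffice because they act in different
   places: the constant-factor bounds multiply the noise, which is small already, while the
   quadratic mean multiplies P, whose entries are O(1/n), so that a Frobenius norm is enough.
   Hypothesis (iv) makes the rescaled noise entries at most theta = O(1/log n), with variance at
   most theta/n = theta^2 rho, where rho = 1/(theta n). About rho n = O(log n) rows are kept, so
   their exponential cost e^(4 rho n) has the form C^k once k is at least log n. The polynomial
   prefactor theta n is beaten by raising the norm threshold by a constant factor, and the squared
   norm theta^2 k is of order 1/log n. Eigenvectors are never compared one by one: eigenvalues
   between O(eta) and a constant are excluded, and only the span of the selected eigenvectors
   matters. Either regime of (v) supplies D_1 >= C log n for large n and f >> 1/sqrt(log n). *)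
Require Import Defs.
From HB Require Import structures.
From mathcomp Require Import all_boot all_order all_algebra.
From mathcomp Require Import complex.
From mathcomp Require Import all_classical all_reals all_analysis.
From mathcomp Require Import ring lra zify.

Set Implicit Arguments.
Unset Strict Implicit.
Unset Printing Implicit Defensive.

Import Order.TTheory GRing.Theory Num.Theory.

Local Open Scope ring_scope.

(** * Euclidean geometry and the real spectral theorem *)

Section Euclid.
Context {R : rcfType}.
Implicit Types n : nat.

Definition dot n (x y : 'rV[R]_n) : R := (x *m y^T) 0 0.
Definition nrm n (x : 'rV[R]_n) : R := Num.sqrt (dot x x).

Lemma dotE n (x y : 'rV[R]_n) : dot x y = \sum_i x 0 i * y 0 i.
Proof. by rewrite /dot mxE; apply: eq_bigr => i _; rewrite mxE. Qed.

Lemma dotC n (x y : 'rV[R]_n) : dot x y = dot y x.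
Proof. by rewrite !dotE; apply: eq_bigr => i _; rewrite mulrC. Qed.

Lemma dotDl n (x y z : 'rV[R]_n) : dot (x + y) z = dot x z + dot y z.
Proof. by rewrite /dot mulmxDl mxE. Qed.

Lemma dotZl n a (x y : 'rV[R]_n) : dot (a *: x) y = a * dot x y.
Proof. by rewrite /dot -scalemxAl mxE. Qed.

Lemma dotNl n (x y : 'rV[R]_n) : dot (- x) y = - dot x y.
Proof. by rewrite /dot mulNmx mxE. Qed.

Lemma dotDr n (x y z : 'rV[R]_n) : dot z (x + y) = dot z x + dot z y.
Proof. by rewrite dotC dotDl !(dotC z). Qed.

Lemma dotZr n a (x y : 'rV[R]_n) : dot x (a *: y) = a * dot x y.
Proof. by rewrite dotC dotZl dotC. Qed.

Lemma dotNr n (x y : 'rV[R]_n) : dot x (- y) = - dot x y.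
Proof. by rewrite dotC dotNl dotC. Qed.

Lemma dot_mulmx m n (x : 'rV[R]_m) (A : 'M[R]_(m, n)) y :
  dot (x *m A) y = dot x (y *m A^T).
Proof. by rewrite /dot trmx_mul trmxK mulmxA. Qed.

Lemma dotxx n (x : 'rV[R]_n) : dot x x = \sum_i x 0 i ^+ 2.
Proof. by rewrite dotE; apply: eq_bigr => i _; rewrite expr2. Qed.

Lemma dot_ge0 n (x : 'rV[R]_n) : 0 <= dot x x.
Proof. by rewrite dotxx sumr_ge0// => i _; rewrite sqr_ge0. Qed.

Lemma dot_eq0 n (x : 'rV[R]_n) : (dot x x == 0) = (x == 0).
Proof.
rewrite dotxx psumr_eq0; last by move=> i _; apply: sqr_ge0.
apply/allP/eqP => [h|-> i _]; last by rewrite mxE expr0n eqxx.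
apply/rowP => i; rewrite mxE; apply/eqP.
by have := h i; rewrite mem_index_enum sqrf_eq0 => /(_ isT).
Qed.

Lemma sqr_nrm n (x : 'rV[R]_n) : nrm x ^+ 2 = dot x x.
Proof. by rewrite sqr_sqrtr ?dot_ge0. Qed.

Lemma nrm_ge0 n (x : 'rV[R]_n) : 0 <= nrm x.
Proof. exact: sqrtr_ge0. Qed.

Lemma nrm_eq0 n (x : 'rV[R]_n) : (nrm x == 0) = (x == 0).
Proof. by rewrite -sqrf_eq0 sqr_nrm dot_eq0. Qed.

Lemma nrm0 n : nrm (0 : 'rV[R]_n) = 0.
Proof. by apply/eqP; rewrite nrm_eq0. Qed.

Lemma nrm_gt0 n (x : 'rV[R]_n) : (0 < nrm x) = (x != 0).
Proof. by rewrite lt_def nrm_ge0 nrm_eq0 andbT. Qed.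

Lemma nrmZ n a (x : 'rV[R]_n) : nrm (a *: x) = `|a| * nrm x.
Proof.
by rewrite /nrm dotZl dotZr mulrA -expr2 sqrtrM ?sqr_ge0// sqrtr_sqr.
Qed.

Lemma nrmN n (x : 'rV[R]_n) : nrm (- x) = nrm x.
Proof. by rewrite /nrm dotNl dotNr opprK. Qed.

Lemma cauchy_schwarz n (x y : 'rV[R]_n) : `|dot x y| <= nrm x * nrm y.
Proof.
have [->|x0] := eqVneq x 0.
  by rewrite nrm0 mul0r /dot mul0mx mxE normr0.
have xx : 0 < dot x x by rewrite lt_def dot_eq0 x0 dot_ge0.
rewrite -(@ler_pXn2r _ 2) ?nnegrE ?mulr_ge0 ?nrm_ge0//.
rewrite real_normK ?num_real// exprMn !sqr_nrm.
have := dot_ge0 (y - (dot x y / dot x x) *: x).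
rewrite dotDl !dotDr !dotNl !dotNr !dotZl !dotZr (dotC y x) => h.
have {}h : 0 <= dot y y - dot x y ^+ 2 / dot x x.
  suff <- : dot y y + - (dot x y / dot x x * dot x y) +
    (- (dot x y / dot x x * dot x y) -
     - (dot x y / dot x x * (dot x y / dot x x * dot x x)))
     = dot y y - dot x y ^+ 2 / dot x x by [].
  by field; rewrite gt_eqF.
by move: h; rewrite subr_ge0 ler_pdivrMr// [dot y y * _]mulrC.
Qed.

Lemma nrmD n (x y : 'rV[R]_n) : nrm (x + y) <= nrm x + nrm y.
Proof.
rewrite -(@ler_pXn2r _ 2) ?nnegrE ?addr_ge0 ?nrm_ge0// sqr_nrm.
rewrite sqrrD !sqr_nrm dotDl !dotDr (dotC y x).
have := le_trans (ler_norm _) (cauchy_schwarz x y); rewrite mulr2n; lra.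
Qed.

Lemma nrmB n (x y : 'rV[R]_n) : nrm (x - y) <= nrm x + nrm y.
Proof. by rewrite -(nrmN y) nrmD. Qed.

Lemma nrm_coord n (x : 'rV[R]_n) i : `|x 0 i| <= nrm x.
Proof.
rewrite -(@ler_pXn2r _ 2) ?nnegrE ?nrm_ge0// sqr_nrm real_normK ?num_real//.
by rewrite dotxx (bigD1 i)//= lerDl sumr_ge0// => j _; rewrite sqr_ge0.
Qed.

Definition frob m n (A : 'M[R]_(m, n)) : R := Num.sqrt (\sum_i \sum_j A i j ^+ 2).

Lemma frob_ge0 m n (A : 'M[R]_(m, n)) : 0 <= frob A.
Proof. exact: sqrtr_ge0. Qed.

Lemma frob_sum_ge0 m n (A : 'M[R]_(m, n)) : 0 <= \sum_i \sum_j A i j ^+ 2.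
Proof. by apply: sumr_ge0 => i _; apply: sumr_ge0 => j _; rewrite sqr_ge0. Qed.

Lemma sqr_frob m n (A : 'M[R]_(m, n)) : frob A ^+ 2 = \sum_i \sum_j A i j ^+ 2.
Proof. by rewrite sqr_sqrtr// frob_sum_ge0. Qed.

Lemma frob_trmx m n (A : 'M[R]_(m, n)) : frob A^T = frob A.
Proof.
by rewrite /frob exchange_big; congr Num.sqrt;
   apply: eq_bigr => i _; apply: eq_bigr => j _; rewrite mxE.
Qed.

Lemma nrm_mulmx_frob m n (x : 'rV[R]_m) (A : 'M[R]_(m, n)) :
  nrm (x *m A) <= frob A * nrm x.
Proof.
rewrite -(@ler_pXn2r _ 2) ?nnegrE ?mulr_ge0 ?nrm_ge0 ?frob_ge0//.
rewrite exprMn sqr_frob !sqr_nrm exchange_big/= mulr_suml dotxx.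
apply: ler_sum => j _.
have -> : (x *m A) 0 j = dot x (row j A^T).
  by rewrite dotE mxE; apply: eq_bigr => i _; rewrite !mxE.
rewrite -[_ ^+ 2]real_normK ?num_real//.
apply: le_trans (_ : (nrm x * nrm (row j A^T)) ^+ 2 <= _).
  by rewrite ler_pXn2r ?nnegrE ?mulr_ge0 ?nrm_ge0// cauchy_schwarz.
rewrite exprMn !sqr_nrm mulrC (dotxx (row _ _)) le_eqVlt; apply/orP; left.
by apply/eqP; congr (_ * _); apply: eq_bigr => i _; rewrite !mxE.
Qed.

Lemma nrm_orthogonal m n (x : 'rV[R]_m) (O : 'M[R]_(m, n)) :
  O *m O^T = 1%:M -> nrm (x *m O) = nrm x.
Proof. by move=> h; rewrite /nrm dot_mulmx -mulmxA h mulmx1. Qed.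

(** The residual [y - y *m X^T *m X] has squared norm |y|^2 - |y X^T|^2. *)
Lemma bessel m n (y : 'rV[R]_n) (X : 'M[R]_(m, n)) :
  X *m X^T = 1%:M -> nrm (y *m X^T) <= nrm y.
Proof.
move=> h; rewrite -(@ler_pXn2r _ 2) ?nnegrE ?nrm_ge0// !sqr_nrm.
have := dot_ge0 (y - y *m X^T *m X).
rewrite dotDl !dotDr !dotNl !dotNr.
have e1 : dot (y *m X^T *m X) y = dot (y *m X^T) (y *m X^T).
  by rewrite dot_mulmx.
rewrite (dotC y (y *m X^T *m X)) e1.
have -> : dot (y *m X^T *m X) (y *m X^T *m X) = dot (y *m X^T) (y *m X^T).
  by rewrite dot_mulmx -[in X in dot _ X]mulmxA h mulmx1.
lra.
Qed.

(** Take a complex eigenvector a + ib for mu. Symmetry of H, applied to the pair a, b, gives Im mu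
    (|a|^2 + |b|^2) = 0; hence mu is real, and whichever of a, b is nonzero is a real
    eigenvector. *)
Lemma real_eigenvector n (H : 'M[R]_n) : (0 < n)%N -> H^T = H ->
  exists (a : R) (v : 'rV[R]_n), v != 0 /\ v *m H = a *: v.
Proof.
move=> n0 Hs.
pose HC := map_mx (real_complex R) H.
have [mu /eigenvalueP[z zH z0]] := eigenvalue_closed HC n0.
pose a := \row_i complex.Re (z 0 i); pose b := \row_i complex.Im (z 0 i).
have E1 : a *m H = complex.Re mu *: a - complex.Im mu *: b.
  apply/rowP => j; have /rowP/(_ j)/(congr1 (@complex.Re R)) := zH.
  rewrite !mxE raddf_sum/= => h; rewrite -[RHS]/(complex.Re mu * complex.Re (z 0 j) - complex.Im mu * complex.Im (z 0 j)).
  transitivity (\sum_k complex.Re (z 0 k * HC k j)).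
    apply: eq_bigr => k _; rewrite !mxE; case: (z 0 k) => u v /=.
    by rewrite mulr0 subr0.
  by rewrite h; case: (mu) => ? ?; case: (z 0 j).
have E2 : b *m H = complex.Im mu *: a + complex.Re mu *: b.
  apply/rowP => j; have /rowP/(_ j)/(congr1 (@complex.Im R)) := zH.
  rewrite !mxE raddf_sum/= => h.
  transitivity (\sum_k complex.Im (z 0 k * HC k j)).
    apply: eq_bigr => k _; rewrite !mxE; case: (z 0 k) => u v /=.
    by rewrite mulr0 add0r.
  by rewrite h; case: (mu) => ? ?; case: (z 0 j) => ? ? /=; rewrite addrC.
have := dot_mulmx a H b; rewrite Hs E1 E2 dotDr dotDl dotNl !dotZl !dotZr => h.
have {}h : complex.Im mu * (dot a a + dot b b) = 0 by lra.
have ab : (a != 0) || (b != 0).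
  apply: contraR z0; rewrite negb_or !negbK => /andP[/eqP/rowP a0 /eqP/rowP b0].
  apply/eqP/rowP => i; have := a0 i; have := b0 i; rewrite !mxE.
  by case: (z 0 i) => ? ? /= -> ->.
have i0 : complex.Im mu = 0.
  apply/eqP; move/eqP: h; rewrite mulf_eq0 => /orP[//|].
  by rewrite paddr_eq0 ?dot_ge0// !dot_eq0; case/orP: ab => /negPf->; rewrite ?andbF.
case/orP: ab => h0.
  by exists (complex.Re mu), a; rewrite E1 i0 scale0r subr0.
by exists (complex.Re mu), b; rewrite E2 i0 scale0r add0r.
Qed.

(** The Householder reflection along [w = v - e] exchanges [e] and [v]; it is symmetric and squares
    to the identity. *)
Lemma orthogonal_completion n (v : 'rV[R]_n.+1) : dot v v = 1 ->
  exists O : 'M[R]_n.+1, O *m O^T = 1%:M /\ row 0 O = v.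
Proof.
move=> v1; pose e : 'rV[R]_n.+1 := delta_mx 0 0.
have ee : dot e e = 1.
  rewrite dotxx (bigD1 0)//= big1 ?addr0 => [|i i0]; rewrite mxE ?expr1n//=.
  by rewrite (negPf i0) expr0n.
have [->|ve] := eqVneq v e.
  by exists 1%:M; rewrite trmx1 mulmx1; split=> //; rewrite rowE mulmx1.
pose w := v - e.
have w0 : dot w w != 0 by rewrite dot_eq0 subr_eq0.
have ww : dot w w = 2 - 2 * dot e v.
  by rewrite /w dotDl !dotDr !dotNl !dotNr v1 ee (dotC v e); ring.
have wTw : w *m w^T = (dot w w)%:M by rewrite [LHS]mx11_scalar.
pose P := w^T *m w.
have PT : P^T = P by rewrite /P trmx_mul trmxK.
have PP : P *m P = dot w w *: P.
  by rewrite /P -mulmxA (mulmxA w) wTw mul_scalar_mx -scalemxAr.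
exists (1%:M - (2 / dot w w) *: P); split.
  have -> : (1%:M - (2 / dot w w) *: P)^T = 1%:M - (2 / dot w w) *: P.
    by rewrite [LHS]linearB/= trmx1 [X in _ - X]linearZ/= PT.
  rewrite mulmxBl mul1mx mulmxBr mulmx1 -scalemxAl -scalemxAr PP !scalerA.
  have -> : 2 / dot w w * (2 / dot w w) * dot w w = 2 / dot w w + 2 / dot w w.
    by field.
  by rewrite scalerDl; set Q := _ *: P; rewrite opprB addrK subrK.
rewrite rowE mulmxBr mulmx1 -scalemxAr /P mulmxA -/e.
have -> : e *m w^T = (dot e w)%:M by rewrite [LHS]mx11_scalar.
rewrite mul_scalar_mx scalerA.
have -> : dot e w = - (dot w w / 2) by rewrite ww /w dotDr dotNr ee; field.
have -> : 2 / dot w w * - (dot w w / 2) = -1 by field.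
by rewrite scaleN1r opprK /w addrCA subrr addr0.
Qed.

(** Deflation: in an orthonormal basis that starts with an eigenvector, symmetry kills both
    off-diagonal blocks and the remaining block is again symmetric. *)
Lemma real_spectral n (H : 'M[R]_n) : H^T = H ->
  exists (O : 'M[R]_n) (d : 'rV[R]_n),
    O *m O^T = 1%:M /\ H = O^T *m diag_mx d *m O.
Proof.
elim: n H => [|n IH] H Hs.
  exists 1%:M, 0; split; first by rewrite trmx1 mulmx1.
  by apply/matrixP => -[].
have [a [v0 [v00 v0H]]] := real_eigenvector (ltn0Sn n) Hs.
pose v := (nrm v0)^-1 *: v0.
have n0 : nrm v0 != 0 by rewrite nrm_eq0.
have v1 : dot v v = 1.
  by rewrite dotZl dotZr -sqr_nrm mulrA -expr2 exprVn mulVf// expf_neq0.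
have vH : v *m H = a *: v by rewrite -scalemxAl v0H !scalerA mulrC.
have [ O [OO rO]] := orthogonal_completion v1.
have OO' := mulmx1C OO.
pose A : 'M[R]_(1 + n) := O *m H *m O^T.
have AT : A^T = A by rewrite /A !trmx_mul trmxK Hs mulmxA.
have rA : row 0 A = a *: delta_mx 0 0.
  rewrite /A -mulmxA row_mul rO mulmxA vH -scalemxAl; congr (_ *: _).
  by rewrite -rO -row_mul OO rowE mulmx1.
have Aul : ulsubmx A = a%:M.
  rewrite [LHS]mx11_scalar; congr (_%:M); rewrite !mxE.
  have /rowP/(_ 0) := rA; rewrite !mxE /= mulr1.
  by have -> : lshift n (0 : 'I_1) = 0 by apply/val_inj.
have Aur : ursubmx A = 0.
  apply/matrixP => i j; rewrite ord1 !mxE.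
  have /rowP/(_ (rshift 1 j)) := rA; rewrite !mxE /=.
  have -> : lshift n (0 : 'I_1) = 0 by apply/val_inj.
  by move=> ->; rewrite mulr0.
have Adl : dlsubmx A = 0 by rewrite -[A in LHS]AT -trmx_ursub Aur trmx0.
have DT : (drsubmx A)^T = drsubmx A by rewrite trmx_drsub AT.
have [ O' [d [OO2 dO]]] := IH _ DT.
pose Q : 'M[R]_(1 + n) := block_mx 1%:M 0 0 O' *m (O : 'M[R]_(1 + n)).
have QQ : Q *m Q^T = 1%:M.
  rewrite /Q trmx_mul mulmxA -(mulmxA _ O) OO mulmx1 tr_block_mx !trmx0 trmx1.
  by rewrite mulmx_block !mul0mx !mulmx0 !mulmx1 !addr0 add0r OO2 -scalar_mx_block.
exists Q, (row_mx a%:M d); split => //.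
have -> : diag_mx (row_mx a%:M d) = block_mx a%:M 0 0 (diag_mx d) :> 'M[R]_(1 + n).
  rewrite diag_mx_row; congr (block_mx _ _ _ _).
  by apply/matrixP => i j; rewrite !ord1 !mxE eqxx.
have E : (O : 'M[R]_(1 + n)) *m H *m O^T = block_mx a%:M 0 0 (drsubmx A).
  by rewrite -/A -[A in LHS]submxK Aul Aur Adl.
have HE : H = O^T *m (O *m H *m O^T) *m O.
  by rewrite !mulmxA OO' mul1mx -mulmxA OO' mulmx1.
have QT : Q^T = (O : 'M[R]_(1 + n))^T *m block_mx 1%:M 0 0 O'^T.
  by rewrite /Q trmx_mul tr_block_mx !trmx0 trmx1.
have BB : block_mx a%:M 0 0 (O'^T *m diag_mx d *m O') =
    block_mx 1%:M 0 0 O'^T *m block_mx a%:M 0 0 (diag_mx d)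
    *m block_mx 1%:M 0 0 O' :> 'M[R]_(1 + n).
  by rewrite !mulmx_block !(mul0mx, mulmx0, mul1mx, mulmx1, addr0, add0r).
by rewrite [LHS]HE E dO [X in _ *m X *m _]BB QT /Q !mulmxA.
Qed.
End Euclid.

(** * Expectations under finite product laws *)

Section ProductExpectation.
Context {R : realFieldType} {I A : finType}.
Variable p : I -> A -> R.
Implicit Types F G : {ffun I -> A} -> R.

(** Expectation when the coordinates of [w] are independent with laws [p i]. A plain finite sum, so
    that it unfolds to the sums in [graph_law] and [run_Pr]. *)
Definition pE F : R := \sum_(w : {ffun I -> A}) (\prod_i p i (w i)) * F w.

Lemma eq_pE F G : F =1 G -> pE F = pE G.
Proof. by move=> h; apply: eq_bigr => w _; rewrite h. Qed.

Lemma pED F G : pE (fun w => F w + G w) = pE F + pE G.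
Proof. by rewrite -big_split; apply: eq_bigr => w _; rewrite mulrDr. Qed.

Lemma pEZ a F : pE (fun w => a * F w) = a * pE F.
Proof. by rewrite mulr_sumr; apply: eq_bigr => w _; rewrite mulrCA. Qed.

Lemma pEZr a F : pE (fun w => F w * a) = pE F * a.
Proof. by rewrite mulr_suml; apply: eq_bigr => w _; rewrite mulrA. Qed.

Lemma pE_sum (J : Type) (r : seq J) (P : pred J) (F : J -> {ffun I -> A} -> R) :
  pE (fun w => \sum_(j <- r | P j) F j w) = \sum_(j <- r | P j) pE (F j).
Proof. by rewrite exchange_big; apply: eq_bigr => w _; rewrite mulr_sumr. Qed.

Lemma pE_prod (g : I -> A -> R) :
  pE (fun w => \prod_i g i (w i)) = \prod_i \sum_a p i a * g i a.
Proof.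
rewrite bigA_distr_bigA; apply: eq_bigr => w _.
by rewrite -big_split.
Qed.

Hypothesis p0 : forall i a, 0 <= p i a.

Lemma weight_ge0 (w : {ffun I -> A}) : 0 <= \prod_i p i (w i).
Proof. exact: prodr_ge0. Qed.

Lemma le_pE F G : (forall w, F w <= G w) -> pE F <= pE G.
Proof.
by move=> h; apply: ler_sum => w _; rewrite ler_wpM2l ?weight_ge0.
Qed.

Lemma pE_ge0 F : (forall w, 0 <= F w) -> 0 <= pE F.
Proof. by move=> h; apply: sumr_ge0 => w _; rewrite mulr_ge0 ?weight_ge0. Qed.

Hypothesis p1 : forall i, \sum_a p i a = 1.

Lemma pE_cst c : pE (fun=> c) = c.
Proof.
rewrite (@eq_pE _ (fun w : {ffun I -> A} => (\prod_(i : I) 1) * c)); last first.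
  by move=> w; rewrite big1_eq mul1r.
rewrite pEZr (pE_prod (fun _ _ => 1)) big1 ?mul1r// => i _.
by rewrite -mulr_suml p1 mulr1.
Qed.

Definition upd (w : {ffun I -> A}) i a : {ffun I -> A} :=
  [ffun j => if j == i then a else w j].

(* Swapping the [i]-th coordinate with an independent copy of it preserves the
   product weight. *)
Lemma pE_indep i (g : A -> R) F :
  (forall w a, F (upd w i a) = F w) ->
  pE (fun w => g (w i) * F w) = (\sum_a p i a * g a) * pE F.
Proof.
move=> hF; rewrite mulr_suml.
rewrite [RHS](eq_bigr (fun a => \sum_(w : {ffun I -> A}) p i a * (\prod_j p j (w j)) * (g a * F w))); last first.
  by move=> a _; rewrite mulr_sumr; apply: eq_bigr => w _; ring.
rewrite pair_bigA /=.
pose h (x : A * {ffun I -> A}) := (x.2 i, upd x.2 i x.1).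
have hK : involutive h.
  move=> [a w]; rewrite /h /= ffunE eqxx; congr pair.
  by apply/ffunP => j; rewrite !ffunE; case: eqP => // ->.
rewrite (reindex_inj (inv_inj hK)) /=.
rewrite (eq_bigr (fun x : A * {ffun I -> A} =>
   p i x.1 * ((\prod_j p j (x.2 j)) * (g (x.2 i) * F x.2)))); last first.
  case=> a w _ /=; rewrite hF.
  have hp : p i (w i) * (\prod_j p j (upd w i a j)) = p i a * \prod_j p j (w j).
    rewrite (bigD1 i)//= [in RHS](bigD1 i)//= ffunE eqxx mulrCA.
    congr (_ * (_ * _)); apply: eq_bigr => j /negPf ji.
    by rewrite ffunE ji.
  by rewrite hp -mulrA.
rewrite -(pair_bigA _ (fun a (w : {ffun I -> A}) => p i a * ((\prod_j p j (w j)) * (g (w i) * F w)))) /=.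
by under eq_bigr do rewrite -mulr_sumr; rewrite -mulr_suml p1 mul1r.
Qed.

Lemma pE_coord i (g : A -> R) : pE (fun w => g (w i)) = \sum_a p i a * g a.
Proof.
rewrite (@eq_pE _ (fun w => g (w i) * 1)) => [|w]; last by rewrite mulr1.
by rewrite (@pE_indep i g (fun=> 1))// pE_cst mulr1.
Qed.

Lemma markov (b : pred {ffun I -> A}) F t : 0 < t -> (forall w, 0 <= F w) ->
  (forall w, b w -> t <= F w) -> pE (fun w => (b w)%:R) <= pE F / t.
Proof.
move=> t0 F0 h; rewrite -pEZr; apply: le_pE => w.
case: (boolP (b w)) => [/h|_]; first by rewrite ler_pdivlMr// mul1r.
by rewrite mulr_ge0// invr_ge0 ltW.
Qed.

Lemma pE_union (J : finType) (b : J -> pred {ffun I -> A}) :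
  pE (fun w => [exists j, b j w]%:R) <= \sum_j pE (fun w => (b j w)%:R).
Proof.
rewrite -pE_sum; apply: le_pE => w.
case: existsP => [[j bj]|_]; last by rewrite sumr_ge0.
by rewrite (bigD1 j)//= bj lerDl sumr_ge0.
Qed.

End ProductExpectation.

Lemma pE_exchange {R : realFieldType} {I A J B : finType} (p : I -> A -> R)
    (q : J -> B -> R) (F : {ffun I -> A} -> {ffun J -> B} -> R) :
  pE p (fun w => pE q (F w)) = pE q (fun v => pE p (fun w => F w v)).
Proof.
rewrite /pE.
under eq_bigr do rewrite mulr_sumr.
rewrite exchange_big; apply: eq_bigr => v _; rewrite mulr_sumr.
by apply: eq_bigr => w _; rewrite mulrCA.
Qed.

Lemma sum_even_ord {R : nmodType} m (F : nat -> R) :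
  (forall j, odd j -> F j = 0) ->
  \sum_(j < m.*2.+1) F j = \sum_(i < m.+1) F i.*2.
Proof.
move=> F0; elim: m => [|m IH]; first by rewrite !big_ord1.
by rewrite [in RHS]big_ord_recr -IH doubleS !big_ord_recr/= (F0 m.*2.+1) ?addr0//= odd_double.
Qed.

Lemma sum_exprn_le {R : numDomainType} (J : Type) (r : seq J) (a : J -> R) k :
  (0 < k)%N -> (forall j, 0 <= a j) ->
  \sum_(j <- r) a j ^+ k <= (\sum_(j <- r) a j) ^+ k.
Proof.
case: k => // k _ a0; elim: r => [|j r IH]; first by rewrite !big_nil expr0n.
rewrite !big_cons.
have S0 : 0 <= \sum_(j <- r) a j by apply: sumr_ge0.
apply: le_trans (lerD (lexx _) IH) _.
rewrite (exprS (_ + _)) mulrDl !exprS; apply: lerD.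
  by rewrite ler_wpM2l// lerXn2r ?nnegrE ?addr_ge0// lerDl.
by rewrite ler_wpM2l// lerXn2r ?nnegrE ?addr_ge0// lerDr.
Qed.

Section EvenMoments.
Context {R : realFieldType} {I A : finType}.
Variables (p : A -> R) (x : A -> R) (c : R) (k : nat).
Hypotheses (p1 : \sum_a p a = 1) (c0 : 0 <= c).
Hypothesis odd_mom : forall j, odd j -> \sum_a p a * x a ^+ j = 0.
Hypothesis even_mom : forall j, (j <= k)%N ->
  c ^+ j * (j.*2`!%:R / j`!%:R) <= \sum_a p a * x a ^+ j.*2.

(** [even_mom] says that the even moments dominate those of a centred Gaussian of variance 2c. This
    passes to linear forms as for Gaussians: add one coordinate at a time and expand; odd terms
    vanish. *)
Lemma linear_form_moment (v : I -> R) (r : seq I) m : uniq r -> (m <= k)%N ->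
  c ^+ m * (m.*2`!%:R / m`!%:R) * (\sum_(i <- r) v i ^+ 2) ^+ m
  <= pE (fun=> p) (fun w => (\sum_(i <- r) x (w i) * v i) ^+ m.*2).
Proof.
pose g j := c ^+ j * (j.*2`!%:R / j`!%:R).
have g0 j : 0 <= g j by rewrite mulr_ge0 ?exprn_ge0 ?divr_ge0.
elim: r m => [|i r IH] m.
  move=> _ _; rewrite big_nil (@eq_pE _ _ _ _ _ (fun=> 0 ^+ m.*2)); last first.
    by move=> w; rewrite big_nil.
  rewrite pE_cst//; case: m => [|m]; first by rewrite !expr0 mulr1 mul1r divff.
  by rewrite expr0n mulr0 doubleS expr0n.
rewrite cons_uniq => /andP[ir ur] mk.
pose S (w : {ffun I -> A}) := \sum_(i <- r) x (w i) * v i.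
have Su w a : S (upd w i a) = S w.
  rewrite /S; apply: eq_big_seq => j jr; rewrite ffunE.
  by case: eqP => // ji; rewrite -ji jr in ir.
rewrite big_cons.
rewrite (@eq_pE _ _ _ _ _ (fun w => \sum_(j < m.*2.+1)
   'C(m.*2, j)%:R * v i ^+ j * (x (w i) ^+ j * S w ^+ (m.*2 - j)))); last first.
  move=> w; rewrite big_cons addrC -/(S w) exprDn; apply: eq_bigr => j _.
  by rewrite exprMn -mulr_natl; ring.
rewrite pE_sum.
have E (j : 'I_m.*2.+1) : pE (fun=> p) (fun w => 'C(m.*2, j)%:R * v i ^+ j * (x (w i) ^+ j * S w ^+ (m.*2 - j)))
  = 'C(m.*2, j)%:R * v i ^+ j * ((\sum_a p a * x a ^+ j) * pE (fun=> p) (fun w => S w ^+ (m.*2 - j))).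
  rewrite pEZ; congr (_ * _); rewrite (@pE_indep _ _ _ _ _ i (fun a => x a ^+ j))//.
  by move=> w a; rewrite Su.
rewrite (eq_bigr _ (fun j _ => E j)).
pose F j := 'C(m.*2, j)%:R * v i ^+ j *
   ((\sum_a p a * x a ^+ j) * pE (fun=> p) (fun w => S w ^+ (m.*2 - j))).
rewrite (@sum_even_ord _ m F); last first.
  by move=> j oj; rewrite /F odd_mom// mul0r mulr0.
rewrite [v i ^+ 2 + _]addrC exprDn mulr_sumr; apply: ler_sum => j _.
have jm : (j <= m)%N by rewrite -ltnS.
have jmk := leq_trans jm mk.
have v2 : v i ^+ j.*2 = (v i ^+ 2) ^+ j by rewrite -mul2n exprM.
rewrite -mulr_natl /F v2.
apply: le_trans (_ : 'C(m.*2, j.*2)%:R * (v i ^+ 2) ^+ j *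
  (g j * (g (m - j)%N * (\sum_(i0 <- r) v i0 ^+ 2) ^+ (m - j))) <= _); last first.
  apply: ler_wpM2l; first by rewrite mulr_ge0// exprn_ge0// sqr_ge0.
  apply: ler_pM => //.
  - by rewrite mulr_ge0 ?exprn_ge0// sumr_ge0// => ? _; rewrite sqr_ge0.
  - exact: even_mom.
  - by rewrite -doubleB IH// (leq_trans (leq_subr _ _)).
(* Equality holds here: C(2m,2j) g(j) g(m-j) = C(m,j) g(m) for [g j] = c^j (2j)!/j!. *)
rewrite le_eqVlt; apply/orP; left; apply/eqP.
have cE : c ^+ m = c ^+ j * c ^+ (m - j) by rewrite -exprD subnKC.
have b1 := bin_fact jm.
have b2 : ('C(m.*2, j.*2) * (j.*2`! * (m - j).*2`!) = m.*2`!)%N.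
  by rewrite doubleB bin_fact// leq_double.
rewrite -{}b1 -{}b2 !natrM /g cE.
have f0 a : (a`!%:R : R) != 0 by rewrite pnatr_eq0 -lt0n fact_gt0.
have b0 : ('C(m, j)%:R : R) != 0 by rewrite pnatr_eq0 -lt0n bin_gt0.
by field; rewrite !f0 b0.
Qed.
End EvenMoments.

Lemma fact_double_le j : (j.*2`! <= j.*2 ^ j * j`!)%N.
Proof.
have h n m : (n ^_ m <= n ^ m)%N.
  elim: m n => [|m IH] n; first by rewrite ffactn0.
  by rewrite ffactnSr expnSr leq_mul// leq_subr.
have jj : (j <= j.*2)%N by rewrite -addnn leq_addr.
have := ffact_fact jj; rewrite -[in X in (_ * X)%N]addnn addnK => <-.
by rewrite leq_mul2r h orbT.
Qed.

Lemma fact_leq_exp n : (n`! <= n ^ n)%N.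
Proof.
elim: n => // n IH; rewrite factS expnS leq_mul2l /=.
by apply: leq_trans IH _; case: n => // n; rewrite leq_exp2r.
Qed.

(** * Moment comparison laws *)

Section Laws.
Context {R : realType}.

Section Geometric.
Variable k : nat.

(* Square root of a geometric variable with a random sign, the mass beyond [k]
   being moved to [0]: the even moments are, up to [8^j], at least the Gaussian
   ones. *)
Definition geo_wt (a : bool * 'I_k.+1) : R :=
  (2^-1 ^+ a.2.+1 + (a.2 == ord0)%:R * 2^-1 ^+ k.+1) / 2.
Definition geo_val (a : bool * 'I_k.+1) : R := (-1) ^+ a.1 * Num.sqrt a.2%:R.

Lemma geo_wt_ge0 a : 0 <= geo_wt a.
Proof. by rewrite divr_ge0// addr_ge0 ?mulr_ge0 ?exprn_ge0 ?invr_ge0. Qed.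

Lemma geo_sum (F : 'I_k.+1 -> R) :
  \sum_a geo_wt a * F a.2 = \sum_(i < k.+1) 2^-1 ^+ i.+1 * F i + 2^-1 ^+ k.+1 * F ord0.
Proof.
rewrite -(pair_bigA _ (fun b i => geo_wt (b, i) * F i))/= big_bool/= -big_split/=.
rewrite (eq_bigr (fun i : 'I_k.+1 => 2^-1 ^+ i.+1 * F i + (i == ord0)%:R * (2^-1 ^+ k.+1 * F i))).
  rewrite big_split/=; congr (_ + _); rewrite (bigD1 ord0)//= mul1r big1 ?addr0//.
  by move=> i /negPf->; rewrite mul0r.
by move=> i _; rewrite /geo_wt/=; field.
Qed.

Lemma sum_half n : \sum_(i < n) (2^-1 : R) ^+ i.+1 = 1 - 2^-1 ^+ n.
Proof.
elim: n => [|n IH]; first by rewrite big_ord0 expr0 subrr.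
by rewrite big_ord_recr/= IH exprS; field.
Qed.

Lemma geo_wt1 : \sum_a geo_wt a = 1.
Proof.
have := geo_sum (fun=> 1); rewrite mulr1.
under eq_bigr do rewrite mulr1; move=> ->.
by under eq_bigr do rewrite mulr1; rewrite sum_half subrK.
Qed.

Lemma geo_odd j : odd j -> \sum_a geo_wt a * geo_val a ^+ j = 0.
Proof.
move=> oj; rewrite -(pair_bigA _ (fun b i => geo_wt (b, i) * geo_val (b, i) ^+ j))/=.
rewrite big_bool/= -big_split/= big1// => i _.
rewrite /geo_val/= expr1 expr0 mul1r mulN1r exprNn -signr_odd oj expr1 /geo_wt/=.
ring.
Qed.

Lemma geo_val2 a j : geo_val a ^+ j.*2 = a.2%:R ^+ j.
Proof.
rewrite -mul2n exprM; congr (_ ^+ j).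
by rewrite /geo_val [LHS]exprMn sqrr_sign mul1r sqr_sqrtr.
Qed.

(** One term of the sum is enough: the index j has weight 2^-(j+1) and value j^j, whereas (2j)! <=
    (2j)^j j! bounds the left side by 4^-j j^j. The index exists because j <= k; j = 0 needs the
    total mass instead. *)
Lemma geo_even j : (j <= k)%N ->
  8^-1 ^+ j * (j.*2`!%:R / j`!%:R) <= \sum_a geo_wt a * geo_val a ^+ j.*2.
Proof.
case: j => [|j] jk.
  rewrite expr0 mul1r divff//= -geo_wt1 ler_sum// => a _.
  by rewrite expr0 mulr1.
under eq_bigr do rewrite geo_val2.
rewrite (geo_sum (fun i => i%:R ^+ j.+1)) expr0n mulr0 addr0.
pose J := Ordinal (n := k.+1) (m := j.+1) jk.
rewrite (bigD1 J)//=.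
apply: le_trans (_ : 2^-1 ^+ j.+2 * j.+1%:R ^+ j.+1 <= _); last first.
  by rewrite lerDl sumr_ge0// => i _; rewrite mulr_ge0// exprn_ge0// invr_ge0.
have h : (j.+1.*2)`!%:R <= (2 ^+ j.+1 * j.+1%:R ^+ j.+1) * (j.+1)`!%:R :> R.
  by rewrite -exprMn -natrM mul2n -natrX -natrM ler_nat fact_double_le.
have f0 : 0 < (j.+1)`!%:R :> R by rewrite ltr0n fact_gt0.
rewrite -ler_pdivrMr// in h.
apply: le_trans (_ : 8^-1 ^+ j.+1 * (2 ^+ j.+1 * j.+1%:R ^+ j.+1) <= _).
  by rewrite ler_wpM2l// exprn_ge0// invr_ge0.
rewrite mulrA -exprMn ler_wpM2r ?exprn_ge0//.
have -> : 8^-1 * 2 = 2^-1 * 2^-1 :> R by field.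
rewrite exprMn (exprS _ j.+1) ler_wpM2r ?exprn_ge0 ?invr_ge0//.
rewrite exprS -[leRHS]mulr1 ler_wpM2l ?invr_ge0// exprn_ile1 ?invr_ge0//.
by rewrite invf_le1// ler1n.
Qed.

(** The base 3/2 is below 2, the radius of convergence for a geometric law of ratio 1/2, so the
    bound does not depend on the truncation k. *)
Lemma geo_exp : \sum_a geo_wt a * (3 / 2) ^+ a.2 <= 3.
Proof.
rewrite (geo_sum (fun i => (3 / 2) ^+ i)) expr0 mulr1.
have h n : \sum_(i < n) 2^-1 ^+ i.+1 * (3 / 2) ^+ i = 2 - 2 * (3 / 4) ^+ n :> R.
  elim: n => [|n IH]; first by rewrite big_ord0 expr0 mulr1 subrr.
  rewrite big_ord_recr/= IH exprS -mulrA -exprMn.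
  have -> : 2^-1 * (3 / 2) = 3 / 4 :> R by field.
  by rewrite exprS; field.
rewrite h.
have : (2^-1 : R) ^+ k.+1 <= 1 by rewrite exprn_ile1 ?invr_ge0// invf_le1// ler1n.
have : 0 <= (3 / 4 : R) ^+ k.+1 by rewrite exprn_ge0// divr_ge0.
lra.
Qed.

End Geometric.

(* As the moments of order at least [2] are all at least [1], those of a thinned
   matrix of such entries dominate, entrywise and up to powers of a scale, those
   of any centred matrix with small entries. *)
Definition skew_wt (b : bool) : R := if b then 1 / 3 else 2 / 3.
Definition skew_val (b : bool) : R := if b then 2 else -1.

Lemma skew_wt_ge0 b : 0 <= skew_wt b.
Proof. by case: b; rewrite /skew_wt divr_ge0. Qed.

Lemma skew_wt1 : \sum_b skew_wt b = 1.
Proof. by rewrite big_bool /skew_wt /=; field. Qed.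

(** The law is centred and skewed to the right. A symmetric law would not serve for comparison,
    since its odd moments vanish while those of the noise may not. *)
Lemma skew_mom j :
  (if j == 1%N then 0 else 1) <= \sum_b skew_wt b * skew_val b ^+ j.
Proof.
rewrite big_bool /skew_wt /skew_val/=.
case: j => [|[|[|j]]]/=; rewrite ?expr0 ?expr1 ?expr2; try lra.
have h : 8 <= (2 : R) ^+ j.+3.
  have := @exprn_ege1 R j 2; rewrite ler1n => /(_ isT).
  by rewrite !exprS; lra.
have h2 : -1 <= (-1 : R) ^+ j.+3.
  by rewrite -signr_odd; case: odd; rewrite ?expr0 ?expr1; lra.
lra.
Qed.

(** The linear term is kept apart so that it cancels for centred variables. For x > 1/2 one has x <=
    2x^2; otherwise e^x <= 1/(1-x) <= 1 + x + 2x^2. *)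
Lemma expR_quad (x : R) : expR x <= x + expR (2 * x ^+ 2).
Proof.
have [h|h] := lerP x (1 / 2); last first.
  apply: le_trans (_ : expR (2 * x ^+ 2) <= _); last by rewrite lerDr; lra.
  by rewrite ler_expR; nra.
have x1 : 0 < 1 - x by lra.
apply: le_trans (_ : (1 - x)^-1 <= _).
  rewrite -[leLHS]invrK lef_pV2 ?posrE ?invr_gt0 ?expR_gt0// -expRN.
  exact: expR_ge1Dx.
apply: le_trans (_ : x + (1 + 2 * x ^+ 2) <= _); last by rewrite lerD2l expR_ge1Dx.
rewrite -[leLHS]mul1r ler_pdivrMr//.
have : 0 <= x ^+ 2 * (1 - 2 * x) by rewrite mulr_ge0 ?sqr_ge0//; lra.
rewrite expr2; lra.
Qed.

Lemma skew_mgf (l : R) :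
  \sum_b skew_wt b * expR (l * skew_val b) <= expR (8 * l ^+ 2).
Proof.
rewrite big_bool /skew_wt /skew_val/=.
have h1 := expR_quad (l * 2); have h2 := expR_quad (l * -1).
have e1 : 2 * (l * 2) ^+ 2 = 8 * l ^+ 2 by ring.
have h3 : expR (2 * (l * -1) ^+ 2) <= expR (8 * l ^+ 2).
  by rewrite ler_expR; have := sqr_ge0 l; rewrite exprMn sqrrN expr1n; lra.
by rewrite e1 in h1; lra.
Qed.

(** Chernoff for moments: Z^(2k) is at most (2k)!/l^(2k) times e^(lZ) + e^(-lZ), and the exponential
    moments factor over the coordinates. *)
Lemma skew_linear_moment {I : finType} (c : I -> R) k : (0 < k)%N ->
  pE (fun=> skew_wt) (fun w => (\sum_i c i * skew_val (w i)) ^+ k.*2)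
  <= 2 * (4 * expR 8 * k%:R * \sum_i c i ^+ 2) ^+ k.
Proof.
move=> k0; set Q := \sum_i c i ^+ 2.
have k0R : 0 < k%:R :> R by rewrite ltr0n.
have Q0 : 0 <= Q by apply: sumr_ge0 => i _; rewrite sqr_ge0.
pose Z (w : {ffun I -> bool}) := \sum_i c i * skew_val (w i).
(* When Q = 0 the linear form is identically zero, and the parameter [l] below would degenerate. *)
have [Qe|Qn] := eqVneq Q 0.
  rewrite (@eq_pE _ _ _ _ _ (fun=> 0)); last first.
    move=> w; have -> : \sum_i c i * skew_val (w i) = 0.
      apply: big1 => i _; suff -> : c i = 0 by rewrite mul0r.
      move/eqP: Qe; rewrite /Q psumr_eq0; last by move=> j _; apply: sqr_ge0.
      by move=> /allP/(_ i); rewrite mem_index_enum sqrf_eq0 => /(_ isT)/=/eqP.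
    by rewrite expr0n double_eq0 eqn0Ngt k0.
  rewrite pE_cst; last by move=> _; exact: skew_wt1.
  by rewrite mulr_ge0// exprn_ge0// mulr_ge0// mulr_ge0// mulr_ge0// expR_ge0.
have Qp : 0 < Q by rewrite lt_def Qn Q0.
(* With l^2 = k/Q the exponential moments are at most e^(8k), a constant to the power k, while
   l^(-2k) supplies the factor Q^k. *)
pose l := Num.sqrt (k%:R / Q).
have l2 : l ^+ 2 = k%:R / Q by rewrite sqr_sqrtr// divr_ge0.
have mgf s : s ^+ 2 = k%:R / Q ->
    pE (fun=> skew_wt) (fun w => expR (s * Z w)) <= expR 8 ^+ k.
  move=> s2.
  rewrite (@eq_pE _ _ _ _ _ (fun w => \prod_i expR (s * c i * skew_val (w i)))); last first.
    by move=> w; rewrite -expR_sum /Z mulr_sumr; congr expR; apply: eq_bigr => i _; rewrite mulrA.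
  rewrite (pE_prod _ (fun i b => expR (s * c i * skew_val b))).
  apply: le_trans (_ : \prod_i expR (8 * (s * c i) ^+ 2) <= _).
    apply: ler_prod => i _; rewrite skew_mgf andbT sumr_ge0// => b _.
    by rewrite mulr_ge0 ?skew_wt_ge0 ?expR_ge0.
  rewrite -expR_sum -expRM_natr.
  under eq_bigr do rewrite exprMn mulrA.
  by rewrite -mulr_sumr s2 -/Q -mulrA divfK.
have key w : Z w ^+ k.*2 <= (k.*2)`!%:R / l ^+ k.*2 * (expR (l * Z w) + expR (- l * Z w)).
  have l0 : 0 < l ^+ k.*2 by rewrite -mul2n exprM l2 exprn_gt0// divr_gt0.
  have f0 : 0 < (k.*2)`!%:R :> R by rewrite ltr0n fact_gt0.
  rewrite mulrAC ler_pdivlMr// -exprMn [leRHS]mulrC -ler_pdivrMr//.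
  have -> : (Z w * l) ^+ k.*2 = `|Z w * l| ^+ k.*2.
    by rewrite -mul2n !exprM real_normK ?num_real.
  apply: le_trans (_ : expR `|Z w * l| <= _).
    case E : (k.*2) => [|m]; first by move/eqP: E; rewrite double_eq0; case: (k) k0.
    by have := expR_ge1Dxn m (normr_ge0 (Z w * l)); rewrite -E; lra.
  have := expR_ge0 (l * Z w); have := expR_ge0 (- l * Z w).
  rewrite (mulrC (Z w)) mulNr; case: (ger0P (l * Z w)) => _ /=; lra.
apply: le_trans (le_pE _ key) _; first by move=> _ b; exact: skew_wt_ge0.
rewrite pEZ pED.
have M1 := mgf l l2; have M2 := mgf (- l) _; rewrite sqrrN in M2; have {M2} := M2 l2 => M2.
apply: le_trans (_ : (k.*2)`!%:R / l ^+ k.*2 * (2 * expR 8 ^+ k) <= _).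
  apply: ler_wpM2l; last by rewrite mulr_natl mulr2n lerD.
  by rewrite divr_ge0// exprn_ge0// sqrtr_ge0.
rewrite -mul2n exprM l2 mul2n mulrCA ler_wpM2l//.
apply: le_trans (_ : (4 * k%:R ^+ 2) ^+ k / (k%:R / Q) ^+ k * expR 8 ^+ k <= _).
  rewrite ler_wpM2r ?exprn_ge0 ?expR_ge0// ler_wpM2r ?invr_ge0 ?exprn_ge0 ?divr_ge0//.
  have := fact_leq_exp k.*2; rewrite -(ler_nat R) natrX.
  have -> : (k.*2%:R : R) ^+ k.*2 = (4 * k%:R ^+ 2) ^+ k.
    rewrite -mul2n natrM exprM; congr (_ ^+ k); ring.
  by [].
rewrite -exprVn -!exprMn le_eqVlt; apply/orP; left; apply/eqP; congr (_ ^+ k).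
by field; rewrite Qn gt_eqF.
Qed.

Definition bern_wt (rho : R) (b : bool) : R := if b then rho else 1 - rho.

Lemma bern_wt_ge0 rho b : 0 <= rho <= 1 -> 0 <= bern_wt rho b.
Proof. by case/andP => ? ?; case: b => //=; rewrite subr_ge0. Qed.

Lemma bern_mom rho j : \sum_b bern_wt rho b * b%:R ^+ j = if j == 0%N then 1 else rho.
Proof.
rewrite big_bool/= expr1n mulr1 expr0n; case: eqP => _; last by rewrite mulr0 addr0.
by rewrite mulr1 addrC subrK.
Qed.

(** The squares of [geo_val] are integers with a geometric law, so z^k <= 3^k k! e^(z/3) and e^(1/3)
    <= 3/2 turn the moment into a product over coordinates. Each factor is 1 when the coordinate is
    dropped and at most 3 in mean when kept, hence at most 1 + 2 rho <= e^(2 rho). *)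
Lemma thinned_norm_moment {I : finType} k (rho : R) : 0 <= rho <= 1 -> (0 < k)%N ->
  pE (fun _ : I => bern_wt rho) (fun s => pE (fun _ : I => @geo_wt k)
     (fun x => (\sum_i ((s i)%:R * geo_val (x i)) ^+ 2) ^+ k))
  <= (3 ^+ k * k`!%:R) * expR (2 * rho * #|I|%:R).
Proof.
move=> r01 k0; have [r0 r1] := andP r01.
pose T (s : {ffun I -> bool}) (x : {ffun I -> bool * 'I_k.+1}) : R :=
  \prod_i (if s i then (3 / 2) ^+ (x i).2 else 1).
have key (s : {ffun I -> bool}) (x : {ffun I -> bool * 'I_k.+1}) : (\sum_i ((s i)%:R * geo_val (x i)) ^+ 2) ^+ k <= 3 ^+ k * k`!%:R * T s x.
  pose z : R := (\sum_i (s i * (x i).2)%N)%:R.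
  have -> : \sum_i ((s i)%:R * geo_val (x i)) ^+ 2 = z.
    rewrite /z natr_sum; apply: eq_bigr => i _; rewrite exprMn.
    by rewrite (geo_val2 _ 1) expr1 natrM; case: (s i); rewrite ?expr1n ?expr0n.
  have z0 : 0 <= z by rewrite ler0n.
  have <- : (3 / 2) ^+ (\sum_i (s i * (x i).2)%N) = T s x.
    by rewrite -prodrXr; apply: eq_bigr => i _; case: (s i); rewrite ?mul1n ?mul0n.
  have e3 : expR (z / 3) <= (3 / 2) ^+ (\sum_i (s i * (x i).2)%N).
    rewrite mulrC expRM_natr lerXn2r ?nnegrE ?expR_ge0 ?divr_ge0//.
    rewrite -[leLHS]invrK -[leRHS]invrK lef_pV2 ?posrE ?invr_gt0 ?expR_gt0 ?divr_gt0// -expRN.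
    by apply: le_trans (expR_ge1Dx _); lra.
  apply: le_trans (_ : 3 ^+ k * k`!%:R * expR (z / 3) <= _); last first.
    by rewrite ler_wpM2l// mulr_ge0// exprn_ge0.
  have f0 : 0 < k`!%:R :> R by rewrite ltr0n fact_gt0.
  rewrite -[leLHS](@divfK _ (3 ^+ k * k`!%:R)) ?mulf_neq0 ?gt_eqF ?exprn_gt0//.
  rewrite mulrC ler_wpM2l ?mulr_ge0 ?exprn_ge0//.
  rewrite invfM mulrA -expr_div_n.
  have z30 : 0 <= z / 3 by rewrite divr_ge0.
  by case: (k) k0 => // m _; have := expR_ge1Dxn m z30; lra.
have pg : forall i a, 0 <= (fun _ : I => @geo_wt k) i a by move=> _ a; exact: geo_wt_ge0.
have pb : forall i a, 0 <= (fun _ : I => bern_wt rho) i a by move=> _ a; exact: bern_wt_ge0.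
apply: le_trans (le_pE pb (fun s => le_pE pg (key s))) _.
rewrite (@eq_pE _ _ _ _ _ (fun s => 3 ^+ k * k`!%:R * pE (fun _ : I => @geo_wt k) (T s))); last first.
  by move=> s; rewrite pEZ.
rewrite pEZ ler_wpM2l ?mulr_ge0 ?exprn_ge0//.
apply: le_trans (_ : pE (fun _ : I => bern_wt rho) (fun s => \prod_i (if s i then 3 else 1)) <= _).
  apply: le_pE => // s; rewrite /T.
  rewrite (pE_prod (fun _ : I => @geo_wt k) (fun i (a : bool * 'I_k.+1) => if s i then (3 / 2) ^+ a.2 else 1)).
  apply: ler_prod => i _; rewrite sumr_ge0 => [|a _]; last first.
    by rewrite mulr_ge0 ?geo_wt_ge0//; case: (s i); rewrite ?exprn_ge0 ?divr_ge0.
  case: (s i); first exact: geo_exp.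
  by rewrite -[leRHS](geo_wt1 k) ler_sum// => a _; rewrite mulr1.
rewrite (pE_prod (fun _ : I => bern_wt rho) (fun _ (b : bool) => if b then 3 else 1)).
rewrite prodr_const expRM_natr lerXn2r ?nnegrE ?expR_ge0//.
  by rewrite big_bool/=; lra.
by rewrite big_bool/=; apply: le_trans (expR_ge1Dx _); lra.
Qed.
End Laws.

Lemma prod_count {R : comPzSemiRingType} {T : finType} (a : T -> R) (es : seq T) :
  \prod_(e <- es) a e = \prod_e a e ^+ count_mem e es.
Proof.
elim: es => [|x es IH]; first by rewrite big_nil big1.
rewrite big_cons IH.
rewrite [RHS](eq_bigr (fun e => a e ^+ (x == e) * a e ^+ count_mem e es)); last first.
  by move=> e _; rewrite -exprD.
rewrite big_split/=; congr (_ * _).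
by rewrite (bigD1 x)//= eqxx expr1 big1 ?mulr1// => e /negPf; rewrite eq_sym => ->.
Qed.

Lemma prod_mem_undup {R : pzSemiRingType} {T : finType} (r : R) (s : seq T) :
  \prod_e (if e \in s then r else 1) = r ^+ size (undup s).
Proof.
rewrite -big_mkcond/= prodr_const; congr (_ ^+ _).
rewrite -(card_uniqP (undup_uniq s)); apply: eq_card => e.
by rewrite mem_undup.
Qed.

Lemma size_undup_cons {T : eqType} (x : T) s :
  size (undup (x :: s)) = ((x \notin s) + size (undup s))%N.
Proof. by rewrite /=; case: (x \in s). Qed.

(** * Traces as sums over walks *)

Section Zigzag.
Context {R : comPzRingType} {n m : nat}.
Let I := 'I_n.+1.
Let J := 'I_m.+1.

(* The edges, as pairs (left vertex, right vertex), of the walks of length [2k]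
   from [u] to [u'] in the complete bipartite graph. *)
Fixpoint zigzags k (u u' : I) : seq (seq (I * J)) :=
  if k is k'.+1 then
    [seq (u, p.2) :: (p.1, p.2) :: es | p <- index_enum (I * J)%type, es <- zigzags k' p.1 u']
  else if u == u' then [:: [::]] else [::].

Lemma expr_zigzags (A : 'M[R]_(n.+1, m.+1)) k u u' :
  ((A *m A^T) ^+ k) u u' = \sum_(es <- zigzags k u u') \prod_(e <- es) A e.1 e.2.
Proof.
elim: k u => [|k IH] u /=.
  rewrite expr0; have -> : (1 : 'M[R]_n.+1) u u' = (u == u')%:R.
    by rewrite -[1]/(1%:M : 'M[R]_n.+1) mxE.
  by case: eqP => _; rewrite ?big_seq1 ?big_nil.
rewrite exprS; set M := A *m A^T.
have -> : (M * M ^+ k) u u' = \sum_t M u t * (M ^+ k) t u'.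
  by rewrite -[M * _]/(M *m _) mxE.
rewrite big_allpairs_dep.
transitivity (\sum_t \sum_v A u v * A t v * (M ^+ k) t u').
  apply: eq_bigr => t _; rewrite -mulr_suml; congr (_ * _).
  by rewrite /M mxE; apply: eq_bigr => v _; rewrite mxE.
rewrite pair_bigA/=; apply: eq_bigr => -[t v] _ /=.
rewrite IH mulr_sumr; apply: eq_bigr => es _.
by rewrite !big_cons /= mulrA.
Qed.

Lemma size_zigzags k u u' es : es \in zigzags k u u' -> size es = k.*2.
Proof.
elim: k u es => [|k IH] u es /=.
  by case: ifP => _; rewrite ?inE ?in_nil// => /eqP->.
by case/allpairsPdep => p [es' [_ /IH h ->]] /=; rewrite h doubleS.
Qed.

(** Induction on the walk: prepending the steps u, v, t adds a distinct edge for each vertex not met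
    before. Counting [u] separately covers the empty walk. *)
Lemma zigzags_connected k u u' es : es \in zigzags k u u' ->
  (size (undup (u :: map fst es)) + size (undup (map snd es))
   <= (size (undup es)).+1)%N.
Proof.
elim: k u es => [|k IH] u es.
  rewrite /=; case: ifP => _; rewrite ?inE ?in_nil// => /eqP->//.
case/allpairsPdep => -[t v] [es' [_ /IH h ->]].
(* A new [v] makes the edge (t, v) new; a new [u] makes (u, v) new. *)
have h1 : (v \notin map snd es') -> ((t, v) \notin es').
  by apply: contra => /(map_f snd).
have h2 : (u \notin t :: map fst es') -> ((u, v) \notin (t, v) :: es').
  by apply: contra => /(map_f fst).
have -> : map fst ((u, (t, v).2) :: ((t, v).1, (t, v).2) :: es') = u :: t :: map fst es' by [].
have -> : map snd ((u, (t, v).2) :: ((t, v).1, (t, v).2) :: es') = v :: v :: map snd es' by [].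
rewrite !(size_undup_cons u) (size_undup_cons v (v :: _)) (size_undup_cons v (map _ _)).
rewrite (size_undup_cons (u, _)) (size_undup_cons (t, _)) !mem_head /=.
move: h h1 h2; rewrite -/(size (undup (t :: map fst es'))).
case: (u \notin _); case: (v \notin _); case: (_ \notin es'); case: (_ \notin _);
 move=> /= h h1 h2; try (by have := h1 isT); try (by have := h2 isT); lia.
Qed.
End Zigzag.

(** * Moments of singular values *)

Section SpectralMoments.
Context {R : rcfType} {n : nat}.
Implicit Types (M O : 'M[R]_n.+1) (d : 'rV[R]_n.+1).

Lemma expr_diag_mx d k : diag_mx d ^+ k = diag_mx (\row_i d 0 i ^+ k).
Proof.
elim: k => [|k IH].
  by rewrite expr0; apply/matrixP => i j; rewrite -[1]/(1%:M : 'M[R]_n.+1) !mxE.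
rewrite exprS IH -[_ * _]/(_ *m _) mulmx_diag; congr diag_mx.
by apply/rowP => i; rewrite !mxE exprS.
Qed.

Lemma expr_conj_orthogonal O M k : O *m O^T = 1%:M ->
  (O^T *m M *m O) ^+ k = O^T *m (M ^+ k) *m O.
Proof.
move=> OO; elim: k => [|k IH].
  by rewrite !expr0 -[1]/(1%:M : 'M[R]_n.+1) mulmx1 (mulmx1C OO).
rewrite !exprS IH -[(_ *m _) * _]/(_ *m _) -[M * _]/(M *m _).
by rewrite !mulmxA -(mulmxA (_ *m M)) OO mulmx1.
Qed.

Lemma trace_expr_spectral O d k : O *m O^T = 1%:M ->
  \tr ((O^T *m diag_mx d *m O) ^+ k) = \sum_i d 0 i ^+ k.
Proof.
move=> OO; rewrite expr_conj_orthogonal// mxtrace_mulC mulmxA OO mul1mx.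
by rewrite expr_diag_mx mxtrace_diag; apply: eq_bigr => i _; rewrite mxE.
Qed.

Lemma dot_spectral O d (x : 'rV[R]_n.+1) :
  dot (x *m (O^T *m diag_mx d *m O)) x = \sum_i d 0 i * (x *m O^T) 0 i ^+ 2.
Proof.
rewrite !mulmxA dot_mulmx dotE; apply: eq_bigr => i _.
by rewrite mul_mx_diag mxE expr2 mulrCA mulrA.
Qed.

Lemma gram_spectral m (A : 'M[R]_(n.+1, m)) : exists O d,
  [/\ O *m O^T = 1%:M, A *m A^T = O^T *m diag_mx d *m O & forall i, 0 <= d 0 i].
Proof.
have AT : (A *m A^T)^T = A *m A^T by rewrite trmx_mul trmxK.
have [ O [d [OO E]]] := real_spectral AT; exists O, d; split => // i.
have : 0 <= dot (row i O *m (A *m A^T)) (row i O).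
  by rewrite mulmxA dot_mulmx trmxK dot_ge0.
rewrite E dot_spectral -row_mul OO (bigD1 i)//= big1 => [|j ji]; rewrite !mxE.
  by rewrite eqxx expr1n mulr1 addr0.
by rewrite eq_sym (negPf ji) expr0n mulr0.
Qed.

(** The squared norm of x A is at most the largest eigenvalue of [A *m A^T] times |x|^2, and the
    k-th power of that eigenvalue is one of the nonnegative terms of the trace. *)
Lemma nrm_le_trace_gram m (A : 'M[R]_(n.+1, m)) k (x : 'rV[R]_n.+1) : (0 < k)%N ->
  nrm (x *m A) ^+ k.*2 <= \tr ((A *m A^T) ^+ k) * nrm x ^+ k.*2.
Proof.
move=> k0; have [ O [d [OO E d0]]] := gram_spectral A.
rewrite -mul2n !exprM !sqr_nrm.
have -> : dot (x *m A) (x *m A) = dot (x *m (A *m A^T)) x.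
  by rewrite dot_mulmx dotC mulmxA.
have -> : dot x x = \sum_i (x *m O^T) 0 i ^+ 2.
  by rewrite -dotxx -!sqr_nrm nrm_orthogonal// trmxK (mulmx1C OO).
rewrite E dot_spectral trace_expr_spectral//.
case: (@arg_maxP _ _ _ ord0 predT (fun i => d 0 i)) => // j _ dj.
apply: le_trans (_ : (d 0 j * \sum_i (x *m O^T) 0 i ^+ 2) ^+ k <= _).
  rewrite lerXn2r ?nnegrE ?mulr_ge0 ?sumr_ge0// => [i _|i _|].
  - by rewrite mulr_ge0 ?sqr_ge0.
  - by rewrite sqr_ge0.
  - by rewrite mulr_sumr ler_sum// => i _; rewrite ler_wpM2r ?sqr_ge0//; apply: dj.
rewrite exprMn ler_wpM2r ?exprn_ge0 ?sumr_ge0// => [i _|]; first by rewrite sqr_ge0.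
by rewrite (bigD1 j)//= lerDl sumr_ge0// => i _; rewrite exprn_ge0.
Qed.

End SpectralMoments.

(** * Trace moments by comparison with a thinned skew matrix *)

Section TraceMoments.
Context {R : realType} {n : nat}.
Notation I := 'I_n.+1.

(** Moment of order 2k of a centred Gaussian of variance 1/4. *)
Let gauss k : R := 8^-1 ^+ k * (k.*2`!%:R / k`!%:R).

Lemma geo_linear_moment k (v : I -> R) :
  gauss k * (\sum_i v i ^+ 2) ^+ k
  <= pE (fun=> @geo_wt R k) (fun w => (\sum_i geo_val (w i) * v i) ^+ k.*2).
Proof.
apply: linear_form_moment (index_enum_uniq _) (leqnn k).
- exact: geo_wt1.
- by rewrite invr_ge0.
- exact: geo_odd.
- exact: geo_even.
Qed.

(* Diagonalizing [A A^T], the trace is a sum of even powers of singular values,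
   each of which is seen by independent random test vectors on both sides. *)
Lemma trace_le_bilinear_moment k (A : 'M[R]_n.+1) : (0 < k)%N ->
  gauss k ^+ 2 * \tr ((A *m A^T) ^+ k)
  <= pE (fun _ : I => @geo_wt R k) (fun x => pE (fun _ : I => @geo_wt R k) (fun y =>
       (\sum_u \sum_v geo_val (x u) * A u v * geo_val (y v)) ^+ k.*2)).
Proof.
move=> k0; have [Q [d [QQ E d0]]] := gram_spectral A.
have g0 : 0 <= gauss k by rewrite mulr_ge0 ?divr_ge0 ?exprn_ge0 ?invr_ge0.
have pg : forall (i : I) a, 0 <= (fun _ : I => @geo_wt R k) i a.
  by move=> _ a; exact: geo_wt_ge0.
pose X (x : {ffun I -> bool * 'I_k.+1}) : 'rV[R]_n.+1 := \row_u geo_val (x u).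
apply: le_trans (_ : pE (fun _ : I => @geo_wt R k) (fun x =>
    gauss k * (\sum_v (X x *m A) 0 v ^+ 2) ^+ k) <= _); last first.
  apply: le_pE => // x; apply: le_trans (geo_linear_moment _ _) _.
  apply: le_pE => // y; rewrite le_eqVlt; apply/orP; left; apply/eqP.
  congr (_ ^+ _); rewrite exchange_big/=; apply: eq_bigr => v _.
  rewrite mxE mulr_sumr; apply: eq_bigr => u _.
  by rewrite mxE mulrC.
rewrite pEZ expr2 -mulrA ler_wpM2l//.
apply: le_trans (_ : pE (fun _ : I => @geo_wt R k) (fun x =>
    \sum_i d 0 i ^+ k * (\sum_u geo_val (x u) * Q i u) ^+ k.*2) <= _).
  rewrite pE_sum E trace_expr_spectral// mulr_sumr ler_sum// => i _.
  rewrite pEZ mulrC ler_wpM2l ?exprn_ge0//.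
  apply: le_trans (geo_linear_moment _ _).
  suff -> : \sum_u Q i u ^+ 2 = 1 by rewrite expr1n mulr1.
  have /matrixP/(_ i i) := QQ; rewrite !mxE eqxx; apply: etrans.
  by apply: eq_bigr => u _; rewrite mxE expr2.
apply: le_pE => // x.
have -> : \sum_v (X x *m A) 0 v ^+ 2 = \sum_i d 0 i * (X x *m Q^T) 0 i ^+ 2.
  rewrite -dot_spectral -E -dotxx.
  by rewrite [LHS]dot_mulmx [LHS]dotC -mulmxA.
apply: le_trans (sum_exprn_le _ k0 _); last by move=> i; rewrite mulr_ge0 ?sqr_ge0.
apply: ler_sum => i _; rewrite exprMn ler_wpM2l ?exprn_ge0//.
rewrite -mul2n exprM le_eqVlt; apply/orP; left; apply/eqP; congr (_ ^+ 2 ^+ k).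
by rewrite mxE; apply: eq_bigr => u _; rewrite !mxE.
Qed.

Definition thin (s s' : {ffun I -> bool}) (xi : {ffun I * I -> bool}) : 'M[R]_n.+1 :=
  \matrix_(u, v) ((s u)%:R * skew_val (xi (u, v)) * (s' v)%:R).

Lemma skew_mom_ge0 j : 0 <= \sum_b @skew_wt R b * skew_val b ^+ j.
Proof. by apply: le_trans (skew_mom _); case: ifP. Qed.

Variables (theta rho : R).
Hypotheses (theta0 : 0 <= theta) (rho0 : 0 < rho) (rho1 : rho <= 1).

(** Bounds for the moments of a centred variable of absolute value at most [theta] and variance at
    most [theta ^+ 2 * rho]; the first moment vanishes exactly. *)
Let mom (c : nat) : R := if c == 0%N then 1 else if c == 1%N then 0 else theta ^+ c * rho.

Let rho01 : 0 <= rho <= 1. Proof. by rewrite ltW. Qed.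
Let pb : forall (i : I) a, 0 <= (fun _ : I => bern_wt rho) i a.
Proof. by move=> i a; exact: bern_wt_ge0. Qed.
Let ps : forall (i : I * I) a, 0 <= (fun _ : I * I => @skew_wt R) i a.
Proof. by move=> i a; exact: skew_wt_ge0. Qed.

(** The indicators of kept vertices are idempotent: a vertex costs one factor [rho] however often
    the walk visits it on a given side. *)
Lemma thin_walk_moment (es : seq (I * I)) :
  pE (fun _ : I => bern_wt rho) (fun s => pE (fun _ : I => bern_wt rho) (fun s' =>
    pE (fun _ : I * I => @skew_wt R) (fun xi => \prod_(e <- es) thin s s' xi e.1 e.2)))
  = rho ^+ size (undup (map fst es)) * rho ^+ size (undup (map snd es))
    * \prod_e \sum_b @skew_wt R b * skew_val b ^+ count_mem e es.
Proof.
have E0 (r : seq I) : pE (fun _ : I => bern_wt rho) (fun s : {ffun I -> bool} => \prod_(u <- r) (s u)%:R)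
    = rho ^+ size (undup r).
  rewrite -prod_mem_undup.
  rewrite (@eq_pE _ _ _ _ _ (fun s : {ffun I -> bool} => \prod_u (s u)%:R ^+ count_mem u r)); last first.
    by move=> s; rewrite -prod_count.
  rewrite (pE_prod _ (fun u (b : bool) => b%:R ^+ count_mem u r)).
  apply: eq_bigr => u _; rewrite bern_mom; case: (boolP (u \in r)).
    by rewrite -has_pred1 has_count; case: (count_mem u r).
  by move=> /count_memPn ->.
rewrite (@eq_pE _ _ _ _ _ (fun s : {ffun I -> bool} => \prod_(u <- map fst es) (s u)%:R *
   (rho ^+ size (undup (map snd es)) * \prod_e \sum_b @skew_wt R b * skew_val b ^+ count_mem e es))).
  by rewrite pEZr E0 mulrA.
move=> s; rewrite (@eq_pE _ _ _ _ _ (fun s' : {ffun I -> bool} => \prod_(u <- map fst es) (s u)%:R *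
   (\prod_(v <- map snd es) (s' v)%:R * \prod_e \sum_b @skew_wt R b * skew_val b ^+ count_mem e es))).
  by rewrite pEZ pEZr E0.
move=> s'; rewrite -(pE_prod _ (fun e b => skew_val b ^+ count_mem e es)) mulrA -pEZ.
apply: eq_pE => xi; rewrite -(prod_count (fun e => skew_val (xi e))) !big_map -!big_split/=.
by apply: eq_bigr => -[u v] _; rewrite mxE/=; ring.
Qed.

(* A connected graph has at most one vertex more than it has edges, so that
   thinning rows and columns instead of entries costs a single factor [rho]. *)
Lemma walk_moment_le (es : seq (I * I)) (V : R) :
  (size (undup (map fst es)) + size (undup (map snd es)) <= (size (undup es)).+1)%N ->
  V <= \prod_e mom (count_mem e es) ->
  V <= theta ^+ size es / rho *
    (rho ^+ size (undup (map fst es)) * rho ^+ size (undup (map snd es))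
    * \prod_e \sum_b @skew_wt R b * skew_val b ^+ count_mem e es).
Proof.
move=> conn /le_trans; apply.
have P0 : 0 <= \prod_e \sum_b @skew_wt R b * skew_val b ^+ count_mem e es.
  by apply: prodr_ge0 => e _; exact: skew_mom_ge0.
have r0 := ltW rho0.
case: (boolP [exists e, count_mem e es == 1%N]) => [/existsP[e /eqP he]|].
  rewrite (bigD1 e)//= {1}/mom he eqxx /= mul0r.
  by rewrite !mulr_ge0 ?exprn_ge0 ?invr_ge0.
rewrite negb_exists => /forallP h1.
have -> : \prod_e mom (count_mem e es) = theta ^+ size es * rho ^+ size (undup es).
  rewrite -prod_mem_undup.
  have -> : theta ^+ size es = \prod_(e <- es) theta.
    by rewrite big_const_seq count_predT -Monoid.iteropE.
  rewrite (prod_count (fun=> theta)) -big_split/=; apply: eq_bigr => e _.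
  rewrite /mom (negPf (h1 e)); case: (boolP (e \in es)) => [|/count_memPn->].
    by rewrite -has_pred1 has_count; case: (count_mem e es).
  by rewrite eqxx mulr1 expr0.
rewrite -mulrA ler_wpM2l ?exprn_ge0//.
rewrite mulrC ler_pdivlMr// -exprSr.
apply: le_trans (_ : rho ^+ size (undup (map fst es)) * rho ^+ size (undup (map snd es)) <= _).
  by rewrite -exprD ler_wiXn2l.
rewrite ler_peMr ?mulr_ge0 ?exprn_ge0//.
apply: le_trans (_ : \prod_(e : I * I) (1 : R) <= _); first by rewrite big1.
by apply: ler_prod => e _; rewrite ler01/=; apply: le_trans (skew_mom _); rewrite (negPf (h1 e)).
Qed.

(** 2304 = 4 * 3^2 * 8^2: the factor 4, and e^8, from the linear form in the skew entries, 3 from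
    each test vector, and 8 from each Gaussian lower bound. *)
Definition rm_const : R := 2304 * expR 8.

(** Each of the two test vectors costs a factor k!, but [gauss k] is at least 8^-k k!, so that only
    k^k survives. This is what makes the moment of the right size when k is of order log n. *)
Lemma trace_moment_bound k (EV : seq (I * I) -> R) : (0 < k)%N ->
  (forall es, EV es <= \prod_e mom (count_mem e es)) ->
  \sum_u \sum_(es <- zigzags k u u) EV es
  <= theta ^+ k.*2 / rho * (2 * (rm_const * k%:R) ^+ k * expR (4 * rho * n.+1%:R)).
Proof.
move=> k0 hEV.
apply: le_trans (_ : theta ^+ k.*2 / rho *
  pE (fun _ : I => bern_wt rho) (fun s => pE (fun _ : I => bern_wt rho) (fun s' =>
    pE (fun _ : I * I => @skew_wt R) (fun xi =>
      \tr ((thin s s' xi *m (thin s s' xi)^T) ^+ k)))) <= _).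
  rewrite (@eq_pE _ _ _ _ _ (fun s => \sum_u \sum_(es <- zigzags k u u)
    pE (fun _ : I => bern_wt rho) (fun s' =>
    pE (fun _ : I * I => @skew_wt R) (fun xi => \prod_(e <- es) thin s s' xi e.1 e.2)))); last first.
    move=> s; under [RHS]eq_bigr do rewrite -pE_sum; rewrite -pE_sum; apply: eq_pE => s'.
    under [RHS]eq_bigr do rewrite -pE_sum; rewrite -pE_sum; apply: eq_pE => xi.
    by rewrite /mxtrace; apply: eq_bigr => u _; rewrite expr_zigzags.
  rewrite pE_sum mulr_sumr ler_sum// => u _.
  rewrite pE_sum mulr_sumr big_seq [leRHS]big_seq ler_sum// => es hes.
  rewrite thin_walk_moment -(size_zigzags hes).
  by apply: walk_moment_le => //; apply: leq_trans (zigzags_connected hes);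
     rewrite leq_add2r /=; case: ifP.
rewrite ler_wpM2l ?divr_ge0 ?exprn_ge0 ?(ltW rho0)//.
set T := pE _ _.
pose X : R := 3 ^+ k * k`!%:R * expR (2 * rho * #|'I_n.+1|%:R).
have pg : forall (i : I) a, 0 <= (fun _ : I => @geo_wt R k) i a.
  by move=> i a; exact: geo_wt_ge0.
have gT : gauss k ^+ 2 * T <= 2 * (4 * expR 8 * k%:R) ^+ k * X ^+ 2.
  rewrite /T -pEZ.
  pose Y (s : {ffun I -> bool}) (x : {ffun I -> bool * 'I_k.+1}) : R :=
    (\sum_i ((s i)%:R * geo_val (x i)) ^+ 2) ^+ k.
  have X0 : 0 <= X by rewrite mulr_ge0 ?expR_ge0 ?mulr_ge0 ?exprn_ge0.
  have Y0 s x : 0 <= Y s x by rewrite exprn_ge0// sumr_ge0// => i _; rewrite sqr_ge0.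
  apply: le_trans (_ : pE (fun _ : I => bern_wt rho) (fun s => pE (fun _ : I => bern_wt rho) (fun s' =>
     pE (fun _ : I => @geo_wt R k) (fun x => pE (fun _ : I => @geo_wt R k) (fun y =>
       2 * (4 * expR 8 * k%:R) ^+ k * (Y s x * Y s' y))))) <= _).
    apply: le_pE => // s; rewrite -pEZ; apply: le_pE => // s'; rewrite -pEZ.
    apply: le_trans (le_pE ps (fun xi => trace_le_bilinear_moment (thin s s' xi) k0)) _.
    (* For fixed test vectors the bilinear form is linear in the skew entries, and the sum of its
       squared coefficients is a product of two thinned squared norms. *)
    rewrite pE_exchange; apply: le_pE => // x.
    rewrite pE_exchange; apply: le_pE => // y.
    pose c (e : I * I) : R := (s e.1)%:R * geo_val (x e.1) * ((s' e.2)%:R * geo_val (y e.2)).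
    rewrite (@eq_pE _ _ _ _ _ (fun xi => (\sum_e c e * skew_val (xi e)) ^+ k.*2)); last first.
      move=> xi; congr (_ ^+ _); rewrite pair_bigA; apply: eq_bigr => -[u v] _.
      by rewrite mxE /c/=; ring.
    apply: le_trans (skew_linear_moment c k0) _.
    rewrite /Y -exprMn -(mulrA 2) -exprMn le_eqVlt; apply/orP; left; apply/eqP.
    congr (2 * (_ * _) ^+ k).
    rewrite mulr_suml -(pair_bigA _ (fun u v => c (u, v) ^+ 2))/=.
    by apply: eq_bigr => u _; rewrite mulr_sumr; apply: eq_bigr => v _; rewrite /c exprMn.
  rewrite (@eq_pE _ _ _ _ _ (fun s => 2 * (4 * expR 8 * k%:R) ^+ k *
     (pE (fun _ : I => @geo_wt R k) (Y s) * pE (fun _ : I => bern_wt rho) (fun s' => pE (fun _ : I => @geo_wt R k) (Y s'))))); last first.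
    move=> s; rewrite -2!pEZ; apply: eq_pE => s'.
    rewrite (@eq_pE _ _ _ _ _ (fun x => Y s x *
       (2 * (4 * expR 8 * k%:R) ^+ k * pE (fun _ : I => @geo_wt R k) (Y s')))).
      by rewrite pEZr mulrCA.
    move=> x; rewrite -pEZ -pEZ; apply: eq_pE => y; ring.
  rewrite pEZ pEZr expr2.
  rewrite ler_wpM2l ?mulr_ge0 ?exprn_ge0 ?mulr_ge0 ?expR_ge0//.
  have h : pE (fun _ : I => bern_wt rho) (fun s' => pE (fun _ : I => @geo_wt R k) (Y s')) <= X.
    exact: thinned_norm_moment.
  by apply: ler_pM => //; apply: pE_ge0 => // s; apply: pE_ge0 => // x.
(* (2k)!/k! >= k! because C(2k,k) >= 1. *)
have g1 : 8^-1 ^+ k * k`!%:R <= gauss k.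
  rewrite ler_wpM2l ?exprn_ge0 ?invr_ge0// ler_pdivlMr ?ltr0n ?fact_gt0//.
  rewrite -natrM ler_nat -addnn; have := bin_fact (leq_addl k k); rewrite addnK => <-.
  by rewrite -[leqLHS]mul1n leq_mul2r bin_gt0 leq_addl orbT.
have f0 : 0 < 8^-1 ^+ k * k`!%:R :> R.
  by rewrite mulr_gt0 ?exprn_gt0 ?invr_gt0// ltr0n fact_gt0.
have T0 : 0 <= T.
  have : 0 <= gauss k ^+ 2 * T.
    rewrite /T; rewrite mulr_ge0 ?sqr_ge0//.
    apply: pE_ge0 => // s; apply: pE_ge0 => // s'; apply: pE_ge0 => // xi.
    have [Q [d [QQ -> d0]]] := gram_spectral (thin s s' xi).
    by rewrite trace_expr_spectral// sumr_ge0// => i _; rewrite exprn_ge0.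
  by rewrite pmulr_rge0// exprn_gt0// (lt_le_trans f0).
rewrite -(@ler_pM2l _ ((8^-1 ^+ k * k`!%:R) ^+ 2)) ?exprn_gt0//.
apply: le_trans (_ : gauss k ^+ 2 * T <= _).
  by rewrite ler_wpM2r// lerXn2r ?nnegrE ?(le_trans (ltW f0))// ltW.
apply: le_trans gT _; rewrite /X card_ord le_eqVlt; apply/orP; left; apply/eqP.
rewrite !exprMn -(expRM_natl 2).
have -> : 2%:R * (2 * rho * n.+1%:R) = 4 * rho * n.+1%:R by ring.
rewrite /rm_const ?exprMn.
have -> : (2304 : R) ^+ k = 4 ^+ k * (3 ^+ k) ^+ 2 * (8 ^+ k) ^+ 2.
  by rewrite -!exprM !(mulnC k) !exprM -!exprMn; congr (_ ^+ k); ring.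
rewrite exprVn; field.
by rewrite expf_neq0.
Qed.

Lemma rm_const_gt0 : 0 < rm_const.
Proof. by apply: mulr_gt0; [rewrite ltr0n|exact: expR_gt0]. Qed.

End TraceMoments.
(* The unary numeral [2304] must not be unfolded by conversion. *)
Global Opaque rm_const.

(** * The noise matrix *)

Section Adjacency.
Context {n : nat}.
Implicit Types (g : graph n) (u v : 'I_n).

Lemma adj_sym g u v : adj g u v = adj g v u.
Proof. by apply: eq_existsb => e; rewrite orbC. Qed.

Lemma adj_irrefl g u : adj g u u = false.
Proof.
apply/existsP => -[[[a b] /= ab]] /andP[_]; rewrite !xpair_eqE.
by case/orP => /andP[/eqP au /eqP bu]; rewrite au bu ltnn in ab.
Qed.

Lemma adj_upair g (e : upair n) : adj g (val e).1 (val e).2 = g e.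
Proof.
case: e => -[u v] /= uv; apply/existsP/idP => [[[[a b] /= ab]]|h].
  case/andP => h; rewrite !xpair_eqE => /orP[] /andP[/eqP e1 /eqP e2].
    by subst a b; rewrite (bool_irrelevance uv ab).
  by subst a b; have := ltn_trans uv ab; rewrite ltnn.
by exists (exist _ (u, v) uv); rewrite h eqxx.
Qed.

End Adjacency.

Section UpperNoise.
Context {R : realType} {n : nat}.
Notation I := 'I_n.+1.
Variables (p : I -> I -> R) (c : I -> I -> R).
Hypothesis p01 : forall u v, 0 <= p u v <= 1.

Definition edge_wt (e : upair n.+1) (b : bool) : R :=
  if b then p (val e).1 (val e).2 else 1 - p (val e).1 (val e).2.

Lemma edge_wt_ge0 e b : 0 <= edge_wt e b.
Proof. by have /andP[? ?] := p01 (val e).1 (val e).2; case: b => //=; rewrite subr_ge0. Qed.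

Lemma edge_wt1 e : \sum_b edge_wt e b = 1.
Proof. by rewrite big_bool /= /edge_wt addrC subrK. Qed.

Definition upper_noise (g : graph n.+1) : 'M[R]_n.+1 :=
  \matrix_(u, v) if (u < v)%N then c u v * ((adj g u v)%:R - p u v) else 0.

Variables theta rho : R.
Hypotheses (theta0 : 0 <= theta) (rho0 : 0 < rho) (rho1 : rho <= 1).
Hypothesis c_le : forall u v, `|c u v| <= theta.
Hypothesis var_le : forall u v, c u v ^+ 2 * p u v <= theta ^+ 2 * rho.

Let mom (j : nat) : R := if j == 0%N then 1 else if j == 1%N then 0 else theta ^+ j * rho.

Lemma edge_moment (e : upair n.+1) j :
  `|\sum_b edge_wt e b * (c (val e).1 (val e).2 * (b%:R - p (val e).1 (val e).2)) ^+ j|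
  <= mom j.
Proof.
rewrite big_bool /edge_wt/=.
rewrite -[true%:R]/(1 : R) -[false%:R]/(0 : R).
set P := p _ _; set a := c _ _; have /andP[P0 P1] : 0 <= P <= 1 := p01 _ _.
case: j => [|[|j]].
- by rewrite /mom eqxx !expr0 !mulr1 addrC subrK normr1.
- by rewrite /mom /= (_ : P * _ + _ = 0) ?normr0//; ring.
rewrite -[mom _]/(theta ^+ j.+2 * rho).
have at' : `|a| <= theta := c_le _ _.
have av : a ^+ 2 * P <= theta ^+ 2 * rho := var_le _ _.
rewrite !exprMn !(mulrCA _ (a ^+ j.+2)) -mulrDr normrM normrX.
apply: le_trans (_ : `|a| ^+ j.+2 * P <= _).
  rewrite ler_wpM2l ?exprn_ge0//.
  apply: le_trans (ler_normD _ _) _.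
  have -> : `|P * (1 - P) ^+ j.+2| = P * (1 - P) ^+ j.+2.
    by rewrite ger0_norm// mulr_ge0// exprn_ge0// subr_ge0.
  have -> : `|(1 - P) * (0 - P) ^+ j.+2| = (1 - P) * P ^+ j.+2.
    have e2 : `|(0 - P) ^+ j.+2| = P ^+ j.+2 by rewrite normrX sub0r normrN ger0_norm.
    by rewrite normrM e2 ger0_norm// subr_ge0.
  have h1 : (1 - P) ^+ j.+2 <= 1 - P.
    by rewrite exprS ler_piMr ?subr_ge0// exprn_ile1 ?subr_ge0// lerBlDr lerDl.
  have h2 : P ^+ j.+2 <= P * P.
    by rewrite exprS ler_wpM2l// exprS ler_piMr// exprn_ile1.
  apply: le_trans (_ : P * (1 - P) + (1 - P) * (P * P) <= _).
    by rewrite lerD// ler_wpM2l// subr_ge0.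
  have : 0 <= P * (P * P) by rewrite !mulr_ge0.
  lra.
(* Two of the factors |a| go with P into the variance bound; each of the others is at most
   [theta]. *)
rewrite -addn2 !exprD -!mulrA; apply: ler_pM => //.
- by rewrite !mulr_ge0.
- by rewrite lerXn2r ?nnegrE.
- by rewrite !mulrA -!expr2 real_normK ?num_real.
Qed.

(** Factors above the diagonal are independent and bounded by [edge_moment]. The others contribute 0
    to the power of their multiplicity, which is 1 exactly for pairs that the walk avoids. *)
Lemma upper_noise_walk (es : seq (I * I)) :
  pE edge_wt (fun g => \prod_(e <- es) upper_noise g e.1 e.2)
  <= \prod_e mom (count_mem e es).
Proof.
pose lt (e : I * I) := (e.1 < e.2)%N.
pose F (e : upair n.+1) (b : bool) : R := (c (val e).1 (val e).2 * (b%:R - p (val e).1 (val e).2)) ^+ count_mem (val e) es.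
pose K : R := \prod_(e | ~~ lt e) 0 ^+ count_mem e es.
rewrite (@eq_pE _ _ _ _ _ (fun g => \prod_e F e (g e) * K)); last first.
  move=> g; rewrite (prod_count (fun e => upper_noise g e.1 e.2)).
  rewrite (bigID lt)/=; congr (_ * _).
    rewrite (reindex_omap (val : upair n.+1 -> I * I) insub)/=; last first.
      by move=> e ee; rewrite insubT.
    apply: eq_big => [e|e _]; first by rewrite valK eqxx /lt (valP e : (_ < _)%N).
    by rewrite mxE (valP e : (_ < _)%N) adj_upair.
  by apply: eq_bigr => e le; rewrite mxE ifN.
rewrite pEZr pE_prod (bigID lt) /=.
apply: le_trans (ler_norm _) _; rewrite normrM normr_prod; apply: ler_pM => //.
  by apply: prodr_ge0.
  rewrite [leRHS](reindex_omap (val : upair n.+1 -> I * I) insub)/=; last first.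
    by move=> e ee; rewrite insubT.
  rewrite [leRHS](eq_bigl predT) => [|e]; last by rewrite valK eqxx /lt (valP e : (_ < _)%N).
  by apply: ler_prod => e _; rewrite normr_ge0 edge_moment.
rewrite normr_prod; apply: ler_prod => e _; rewrite normr_ge0 normrX normr0 /mom expr0n.
by case: (count_mem e es) => [|[|j]]//=; rewrite mulr_ge0 ?exprn_ge0// ltW.
Qed.

Lemma upper_noise_trace k : (0 < k)%N ->
  pE edge_wt (fun g => \tr ((upper_noise g *m (upper_noise g)^T) ^+ k))
  <= theta ^+ k.*2 / rho * (2 * (@rm_const R * k%:R) ^+ k * expR (4 * rho * n.+1%:R)).
Proof.
move=> k0.
rewrite (@eq_pE _ _ _ _ _ (fun g => \sum_u \sum_(es <- zigzags k u u)
   \prod_(e <- es) upper_noise g e.1 e.2)); last first.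
  by move=> g; rewrite /mxtrace; apply: eq_bigr => u _; rewrite expr_zigzags.
rewrite pE_sum (eq_bigr (fun u => \sum_(es <- zigzags k u u) pE edge_wt
  (fun g => \prod_(e <- es) upper_noise g e.1 e.2))); last by move=> u _; rewrite pE_sum.
exact: trace_moment_bound (k0) upper_noise_walk.
Qed.

Lemma nrm_upper_noise k t (g : graph n.+1) x : (0 < k)%N -> 0 <= t ->
  \tr ((upper_noise g *m (upper_noise g)^T) ^+ k) <= t ^+ k.*2 ->
  nrm (x *m upper_noise g) <= t * nrm x.
Proof.
move=> k0 t0 h; rewrite -(@ler_pXn2r _ k.*2) ?nnegrE ?mulr_ge0 ?nrm_ge0 ?double_gt0//.
apply: le_trans (nrm_le_trace_gram _ _ k0) _.
by rewrite exprMn ler_wpM2r ?exprn_ge0 ?nrm_ge0.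
Qed.
End UpperNoise.

Lemma nrm_mulmx_tr {R : rcfType} m n (A : 'M[R]_(m, n)) t : 0 <= t ->
  (forall x, nrm (x *m A) <= t * nrm x) -> forall y, nrm (y *m A^T) <= t * nrm y.
Proof.
move=> t0 h y; have [->|n0] := eqVneq (nrm (y *m A^T)) 0.
  by rewrite mulr_ge0 ?nrm_ge0.
have np : 0 < nrm (y *m A^T) by rewrite lt_def n0 nrm_ge0.
rewrite -(ler_pM2r np) -expr2 sqr_nrm.
have -> : dot (y *m A^T) (y *m A^T) = dot (y *m A^T *m A) y.
  by rewrite dotC dot_mulmx trmxK dotC.
apply: le_trans (le_trans (ler_norm _) (cauchy_schwarz _ _)) _.
by rewrite mulrC -mulrA [leRHS]mulrCA ler_wpM2l ?nrm_ge0.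
Qed.

(** * Spectral embeddings *)

Section Spectrum.
Context {R : realType} {n : nat}.
Implicit Types (H Q : 'M[R]_n) (d : 'rV[R]_n) (s : seq R).

Lemma char_poly_spectral Q d : Q *m Q^T = 1%:M ->
  char_poly (Q^T *m diag_mx d *m Q) = \prod_i ('X - (d 0 i)%:P).
Proof.
move=> QQ; pose q := map_mx polyC Q.
have qq : q^T *m q = 1%:M.
  by rewrite /q map_trmx -map_mxM/= (mulmx1C QQ) map_mx1.
have E : char_poly_mx (Q^T *m diag_mx d *m Q) = q^T *m char_poly_mx (diag_mx d) *m q.
  rewrite /char_poly_mx mulmxBr mulmxBl; congr (_ - _).
    by rewrite scalar_mxC -mulmxA qq mulmx1.
  by rewrite !map_mxM/= map_trmx.
rewrite /char_poly E !det_mulmx mulrAC -det_mulmx qq det1 mul1r.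
rewrite -/(char_poly _) char_poly_trig; last exact: diag_mx_is_trig.
by apply: eq_bigr => i _; rewrite mxE eqxx mulr1n.
Qed.
End Spectrum.

Lemma nth_sorted_count {R : realType} (thr : R) (s : seq R) i :
  sorted (fun a b : R => `|b| <= `|a|) s ->
  (i < count (fun a : R => thr < `|a|)%R s)%N -> thr < `|s`_i|.
Proof.
elim: s i => [|a s IH] i //= ps.
have tr : transitive (fun a b : R => `|b| <= `|a|).
  by move=> x y z h1 h2; apply: le_trans h2 h1.
have [ta|ta] := boolP (thr < `|a|).
  by case: i => [|i] //=; rewrite add1n ltnS; apply: IH; apply: path_sorted ps.
rewrite add0n; have /allP h := order_path_min tr ps.
suff -> : count (fun a : R => thr < `|a|) s = 0%N by [].
apply/eqP; rewrite eqn0Ngt -has_count; apply/hasPn => b /h ba.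
by rewrite -leNgt (le_trans ba)// leNgt.
Qed.

Section Embedding.
Context {R : realType} {n : nat}.
Variables (H : 'M[R]_n) (thr : R).
Hypothesis HT : H^T = H.

Lemma embedding_eigenvalues L (X : 'M[R]_(L, n)) : spectral_embedding H thr X ->
  exists S : 'rV[R]_L, [/\ X *m X^T = 1%:M, X *m H = diag_mx S *m X
    & forall i, thr < `|S 0 i|].
Proof.
case=> s [[_ srt] Ls XX XH]; exists (\row_i s`_i); split => //.
  apply/row_matrixP => i; rewrite row_mul XH.
  by rewrite [RHS]row_mul row_diag_mx -scalemxAl -rowE mxE.
by move=> i; rewrite mxE nth_sorted_count// -Ls.
Qed.

(* The rows of [X] fill the eigenspaces of all eigenvalues above the threshold,
   since they are as many as these eigenvalues. *)
Lemma embedding_orthogonal L (X : 'M[R]_(L, n)) (x : 'rV[R]_n) :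
  0 <= thr -> spectral_embedding H thr X -> x *m X^T = 0 ->
  nrm (x *m H) <= thr * nrm x.
Proof.
move=> thr0 emb xX; have [S [XX XH SL]] := embedding_eigenvalues emb.
case: emb => s [[chs _] Ls _ _].
have [Q [d [QQ HE]]] := real_spectral HT.
have QQ' := mulmx1C QQ.
pose Y := X *m Q^T.
have YY : Y *m Y^T = 1%:M by rewrite /Y trmx_mul trmxK mulmxA -(mulmxA X) QQ' mulmx1.
have Yd : Y *m diag_mx d = diag_mx S *m Y.
  by rewrite /Y [RHS]mulmxA -XH HE -!mulmxA QQ mulmx1.
have Y0 i j : ~~ (thr < `|d 0 j|) -> Y i j = 0.
  move=> dj; have /matrixP/(_ i j) := Yd; rewrite mul_mx_diag mul_diag_mx !mxE.
  move/eqP; rewrite mulrC -subr_eq0 -mulrBl mulf_eq0 => /orP[|/eqP//].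
  by rewrite subr_eq0 => /eqP e; rewrite e SL in dj.
have cnt : L = #|[pred j | thr < `|d 0 j|]|.
  have ps : perm_eq s [seq d 0 j | j <- index_enum 'I_n].
    apply: prod_XsubC_eq; rewrite -chs HE char_poly_spectral// big_map.
    by [].
  rewrite Ls (permP ps) count_map cardE size_filter /index_enum -enumT.
  by [].
have col1 j : dot (delta_mx 0 j *m Y^T) (delta_mx 0 j *m Y^T) <= 1.
  rewrite -sqr_nrm; apply: le_trans (_ : nrm (delta_mx 0 j : 'rV[R]_n) ^+ 2 <= _).
    by rewrite lerXn2r ?nnegrE ?nrm_ge0// bessel.
  rewrite sqr_nrm dotxx (bigD1 j)//= big1 ?addr0 => [|i ij]; rewrite mxE eqxx/=.
    by rewrite eqxx expr1n.
  by rewrite (negPf ij) expr0n.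
have colE j : dot (delta_mx 0 j *m Y^T) (delta_mx 0 j *m Y^T) = \sum_i Y i j ^+ 2.
  rewrite -rowE dotxx; apply: eq_bigr => i _; by rewrite !mxE.
(* The column j of [Y] is zero when [d 0 j] is below the threshold. The L orthonormal rows give
   total squared mass L, shared by exactly L columns of squared norm at most 1: each of them has
   norm 1. *)
have tot : \sum_(j | thr < `|d 0 j|) (1 - \sum_i Y i j ^+ 2) = 0.
  rewrite sumrB sumr_const.
  have -> : \sum_(j | thr < `|d 0 j|) \sum_i Y i j ^+ 2 = \sum_j \sum_i Y i j ^+ 2.
    rewrite [RHS](bigID (fun j => thr < `|d 0 j|))/= [X in _ + X]big1 ?addr0// => j dj.
    by rewrite big1// => i _; rewrite Y0// expr0n.
  rewrite exchange_big/= (eq_bigr (fun=> 1)) => [|i _].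
    by rewrite sumr_const card_ord {1}cnt subrr.
  have /matrixP/(_ i i) := YY; rewrite mxE [1%:M _ _]mxE eqxx; apply: etrans.
  by apply: eq_bigr => j _; rewrite [Y^T _ _]mxE expr2.
have col j : thr < `|d 0 j| -> \sum_i Y i j ^+ 2 = 1.
  move=> dj; apply/esym/eqP; rewrite -subr_eq0; apply/eqP; move: j dj.
  apply/psumr_eq0P => // j _; by rewrite subr_ge0 -colE col1.
pose c := x *m Q^T.
have cY : c *m Y^T = 0 by rewrite /c /Y trmx_mul trmxK mulmxA -(mulmxA x) QQ' mulmx1.
(* A column of norm 1 means that the basis vector e_j lies in the row space of [Y], to which [c] is
   orthogonal. *)
have c0 j : thr < `|d 0 j| -> c 0 j = 0.
  move=> /col; rewrite -colE; set e : 'rV[R]_n := delta_mx 0 j => ej.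
  have ee : dot e e = 1.
    rewrite dotxx (bigD1 j)//= big1 ?addr0 => [|i ij]; rewrite mxE eqxx/=.
      by rewrite eqxx expr1n.
    by rewrite (negPf ij) expr0n.
  have rE : e - e *m Y^T *m Y = 0.
    apply/eqP; rewrite -dot_eq0 dotDl !dotDr !dotNl !dotNr.
    have e1 : dot (e *m Y^T *m Y) e = 1 by rewrite dot_mulmx.
    rewrite (dotC e (e *m Y^T *m Y)) e1.
    have -> : dot (e *m Y^T *m Y) (e *m Y^T *m Y) = 1.
      by rewrite dot_mulmx -(mulmxA (e *m Y^T)) YY mulmx1.
    by rewrite ee; apply/eqP; ring.
  have -> : c 0 j = dot c e.
    rewrite dotE (bigD1 j)//= big1 ?addr0 => [|i ij]; rewrite [e _ _]mxE eqxx/=.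
      by rewrite eqxx mulr1.
    by rewrite (negPf ij) mulr0.
  move/eqP: rE; rewrite subr_eq0 => /eqP ->.
  by rewrite dotC dot_mulmx dotC cY /dot mul0mx mxE.
have nx : nrm x = nrm c by rewrite /c nrm_orthogonal// trmxK.
have -> : nrm (x *m H) = nrm (c *m diag_mx d) by rewrite HE !mulmxA nrm_orthogonal.
rewrite nx -(@ler_pXn2r _ 2) ?nnegrE ?mulr_ge0 ?nrm_ge0// exprMn !sqr_nrm !dotxx.
rewrite mulr_sumr ler_sum// => j _; rewrite mul_mx_diag mxE exprMn mulrC.
have [dj|dj] := boolP (thr < `|d 0 j|); first by rewrite c0// expr0n !mulr0.
rewrite ler_wpM2r ?sqr_ge0// -[leLHS]real_normK ?num_real// lerXn2r ?nnegrE//.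
by rewrite leNgt.
Qed.

(** The residual rows satisfy the same eigenvalue equations, with eigenvalues above the threshold,
    yet are orthogonal to [X]; [embedding_orthogonal] forces them to vanish. *)
Lemma embedding_row_sub L L' (X : 'M[R]_(L, n)) (X' : 'M[R]_(L', n)) :
  0 <= thr -> spectral_embedding H thr X -> spectral_embedding H thr X' ->
  X' *m X^T *m X = X'.
Proof.
move=> thr0 e1 e2; have [S [XX XH SL]] := embedding_eigenvalues e1.
have [S' [XX' XH' SL']] := embedding_eigenvalues e2.
apply/eqP; rewrite -subr_eq0 -opprB oppr_eq0; apply/eqP.
set D := X' - _.
have DX : D *m X^T = 0 by rewrite mulmxBl -!mulmxA XX mulmx1 subrr.
have DH : D *m H = diag_mx S' *m D.
  have HX : H *m X^T = X^T *m diag_mx S.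
    by apply: (can_inj (@trmxK _ _ _)); rewrite !trmx_mul trmxK HT XH tr_diag_mx.
  have e : diag_mx S' *m X' *m X^T = X' *m X^T *m diag_mx S.
    by rewrite -XH' -mulmxA HX mulmxA.
  rewrite mulmxBl mulmxBr XH'; congr (_ - _).
  by rewrite -(mulmxA (X' *m X^T)) XH mulmxA -e !mulmxA.
apply/row_matrixP => i; rewrite row0; apply/eqP; rewrite -nrm_eq0.
have h : nrm (row i D *m H) <= thr * nrm (row i D).
  apply: embedding_orthogonal thr0 e1 _.
  by rewrite -row_mul DX row0.
move: h; rewrite -row_mul DH row_mul row_diag_mx -scalemxAl -rowE nrmZ.
apply: contraTT => n0; rewrite -ltNge ltr_pM2r ?SL'//.
by rewrite lt_def n0 nrm_ge0.
Qed.

Lemma embedding_projector_unique L L' (X : 'M[R]_(L, n)) (X' : 'M[R]_(L', n)) :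
  0 <= thr -> spectral_embedding H thr X -> spectral_embedding H thr X' ->
  X^T *m X = X'^T *m X'.
Proof.
move=> t0 e1 e2; have h1 := embedding_row_sub t0 e1 e2.
have h2 := embedding_row_sub t0 e2 e1.
transitivity (X^T *m (X *m X'^T *m X')); first by rewrite h2.
transitivity ((X' *m X^T *m X)^T *m X'); last by rewrite h1.
by rewrite !trmx_mul !trmxK !mulmxA.
Qed.

(** Distances depend on [X] only through the projector [X^T *m X]. Hence they do not depend on which
    eigenvectors the algorithm picks, and may be fixed before the pairs are sampled. *)
Lemma scaled_dist_unique L L' (X : 'M[R]_(L, n)) (X' : 'M[R]_(L', n)) u v :
  0 <= thr -> spectral_embedding H thr X -> spectral_embedding H thr X' ->
  scaled_dist X u v = scaled_dist X' u v.
Proof.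
move=> t0 e1 e2; rewrite /scaled_dist; congr (_ * Num.sqrt _).
have E m (Z : 'M[R]_(m, n)) : \sum_(i < m) (Z i u - Z i v) ^+ 2 =
    (Z^T *m Z) u u - (Z^T *m Z) u v - (Z^T *m Z) v u + (Z^T *m Z) v v.
  rewrite !mxE -!sumrB -big_split; apply: eq_bigr => i _; rewrite !mxE /=; ring.
by rewrite !E (embedding_projector_unique t0 e1 e2).
Qed.
End Embedding.

(** * Perturbation of block-constant matrices *)

Section Diag.
Context {R : rcfType}.

Lemma nrm_mulmx_diag_le n (x d : 'rV[R]_n) c : (forall i, `|d 0 i| <= c) -> 0 <= c ->
  nrm (x *m diag_mx d) <= c * nrm x.
Proof.
move=> h c0; rewrite -(@ler_pXn2r _ 2) ?nnegrE ?mulr_ge0 ?nrm_ge0//.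
rewrite exprMn !sqr_nrm !dotxx mulr_sumr ler_sum// => i _.
rewrite mul_mx_diag mxE exprMn mulrC ler_wpM2r ?sqr_ge0//.
by rewrite -[leLHS]real_normK ?num_real// lerXn2r ?nnegrE.
Qed.

Lemma nrm_mulmx_diag_ge n (x d : 'rV[R]_n) c : 0 <= c -> (forall i, c <= `|d 0 i|) ->
  c * nrm x <= nrm (x *m diag_mx d).
Proof.
move=> c0 h; rewrite -(@ler_pXn2r _ 2) ?nnegrE ?mulr_ge0 ?nrm_ge0//.
rewrite exprMn !sqr_nrm !dotxx mulr_sumr ler_sum// => i _.
rewrite mul_mx_diag mxE exprMn mulrC ler_wpM2l ?sqr_ge0//.
by rewrite -[leRHS]real_normK ?num_real// lerXn2r ?nnegrE// (le_trans c0).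
Qed.

Lemma pos_lower_bound (I : finType) (F : I -> R) : (forall i, 0 < F i) ->
  exists2 c, 0 < c & forall i, c <= F i.
Proof.
move=> F0; exists (\big[Order.min/1]_i F i).
  by apply: (big_ind (fun x : R => 0 < x)) => // x y x0 y0; rewrite lt_min x0.
by move=> i; exact: bigmin_le.
Qed.

Lemma proj_residual_le m n (U : 'M[R]_(m, n)) (x : 'rV[R]_n) :
  U *m U^T = 1%:M -> nrm (x - x *m U^T *m U) <= nrm x.
Proof.
move=> UU; rewrite -(@ler_pXn2r _ 2) ?nnegrE ?nrm_ge0// !sqr_nrm.
rewrite dotDl !dotDr !dotNl !dotNr.
have e1 : dot (x *m U^T *m U) x = dot (x *m U^T) (x *m U^T) by rewrite dot_mulmx.
have e2 : dot (x *m U^T *m U) (x *m U^T *m U) = dot (x *m U^T) (x *m U^T).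
  by rewrite dot_mulmx -(mulmxA (x *m U^T)) UU mulmx1.
by rewrite (dotC x (x *m U^T *m U)) e1 e2; have := dot_ge0 (x *m U^T); lra.
Qed.

(* Symmetry of [B] gives [B = B D B N] for some [N], where [D] is the inverse of
   [diag l]: this controls [q B] by its image under [D B], and the component of
   [q] in the kernel is only seen through [s]. *)
Lemma kernel_gap K (B : 'M[R]_K) (l : 'rV[R]_K) :
  B^T = B -> (forall i, 0 < l 0 i) ->
  exists c0 C0 gam : R, [/\ 0 < c0, 0 < C0, 0 < gam &
   forall (l' : 'rV[R]_K) (s : R) (q e : 'rV[R]_K),
     (forall i, `|l' 0 i - l 0 i| <= gam * l 0 i) -> `|s| <= c0 ->
     q *m B = s *: (q *m diag_mx l') - e -> `|s| * nrm q <= C0 * nrm e].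
Proof.
move=> BT l0.
pose r := \row_i (l 0 i)^-1; pose D := diag_mx r.
pose T := B *m D *m B.
have TT : T^T = T by rewrite /T !trmx_mul BT tr_diag_mx mulmxA.
(* T = B D B and B have the same kernel: T y = 0 gives (By)^T D (By) = 0, and D is positive
   definite. Equal kernels and symmetry let B factor through T. *)
have [N BN] : exists N, B = T *m N.
  have : (B <= T)%MS.
    rewrite submxE; set Y := cokermx T.
    have TY : T *m Y = 0 by exact: mulmx_coker.
    have Y0 : (B *m Y)^T *m D *m (B *m Y) = 0.
      by rewrite trmx_mul BT -!mulmxA (mulmxA B) (mulmxA (B *m D)) TY mulmx0.
    apply/eqP/matrixP => i j; rewrite [RHS]mxE.
    have /matrixP/(_ j j) := Y0.
    rewrite mul_mx_diag mxE [RHS]mxE.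
    under eq_bigr do rewrite mxE [_^T _ _]mxE.
    move=> /eqP; rewrite psumr_eq0 => [|k _]; last first.
      by rewrite mulrAC -expr2 mulr_ge0 ?sqr_ge0// mxE invr_ge0 ltW.
    move=> /allP/(_ i); rewrite mem_index_enum => /(_ isT) /=.
    rewrite mulrAC -expr2 [r _ _]mxE mulf_eq0 sqrf_eq0 invr_eq0 (gt_eqF (l0 i)) orbF.
    by move/eqP.
  case/submxP => Z BZ; exists Z^T.
  by rewrite -{1}BT {1}BZ trmx_mul TT.
have [lam lam0 hlam] := pos_lower_bound (fun i => l0 i).
pose F1 := frob N + 1; pose F2 := frob (B *m N) + 1; pose F3 := frob (D *m B *m N) + 1.
have F10 : 0 < F1 by rewrite ltr_wpDl ?frob_ge0.
have F20 : 0 < F2 by rewrite ltr_wpDl ?frob_ge0.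
have F30 : 0 < F3 by rewrite ltr_wpDl ?frob_ge0.
(* The bound 1/2 keeps [l'] above [l]/2; the other one makes the term in [F2 * gam] small enough to
   be absorbed by [lam / 2 * nrm q]. *)
pose gam := Num.min (1 / 2) (lam / (8 * F2)).
have gam0 : 0 < gam by rewrite lt_min !divr_gt0// mulr_gt0.
exists (1 / (2 * F1)), (4 / lam * (2 * F3 + 1)), gam; split => //.
- by rewrite divr_gt0// mulr_gt0.
- by rewrite mulr_gt0 ?divr_gt0// addr_gt0// mulr_gt0.
move=> l' s q e hl sc qB.
pose dl := \row_i (l' 0 i * r 0 i - 1).
have dlE : diag_mx l' *m D = 1%:M + diag_mx dl.
  rewrite /D mulmx_diag; apply/matrixP => i j; rewrite !mxE.
  by case: eqP => _; rewrite ?mulr1n ?mulr0n ?addr0// addrC subrK.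
have dlb i : `|dl 0 i| <= gam.
  rewrite !mxE; have -> : l' 0 i * (l 0 i)^-1 - 1 = (l' 0 i - l 0 i) / l 0 i.
    by field; rewrite gt_eqF.
  by rewrite normrM normfV (gtr0_norm (l0 i)) ler_pdivrMr.
(* Write q B = (q B) D B N and substitute the equation for the inner q B. For |s| <= c0 the first
   term on the right is at most half of the left side. *)
have key : q *m B = s *: (q *m B *m N) + s *: (q *m diag_mx dl *m (B *m N)) - e *m (D *m B *m N).
  rewrite [in LHS]BN /T !mulmxA [in LHS]qB !mulmxBl -!scalemxAl.
  rewrite -(mulmxA q (diag_mx l') D) dlE mulmxDr mulmx1 !mulmxDl scalerDr.
  by [].
have qn := nrm_ge0 q; have en := nrm_ge0 e; have sn := normr_ge0 s.
have b1 : nrm (q *m B) <= `|s| * (F1 * nrm (q *m B)) + `|s| * (F2 * (gam * nrm q)) + F3 * nrm e.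
  rewrite [leLHS](congr1 (@nrm _ _) key).
  apply: le_trans (nrmB _ _) _; apply: lerD; last first.
    apply: le_trans (nrm_mulmx_frob _ _) _.
    by rewrite ler_wpM2r// /F3 lerDl.
  apply: le_trans (nrmD _ _) _; rewrite !nrmZ; apply: lerD; rewrite ler_wpM2l//.
    apply: le_trans (nrm_mulmx_frob _ _) _.
    by rewrite ler_wpM2r ?nrm_ge0// /F1 lerDl.
  apply: le_trans (nrm_mulmx_frob _ _) _.
  apply: ler_pM; rewrite ?frob_ge0 ?nrm_ge0//; first by rewrite /F2 lerDl.
  by apply: nrm_mulmx_diag_le => //; exact: ltW.
have b2 : `|s| * F1 <= 1 / 2.
  rewrite -ler_pdivlMr//; apply: le_trans sc _.
  by rewrite le_eqVlt; apply/orP; left; apply/eqP; field; rewrite gt_eqF.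
have b3 : nrm (q *m B) <= 2 * (`|s| * (F2 * (gam * nrm q)) + F3 * nrm e).
  have : `|s| * F1 * nrm (q *m B) <= 1 / 2 * nrm (q *m B) by rewrite ler_wpM2r ?nrm_ge0.
  by rewrite mulrA in b1; lra.
have b4 : lam / 2 * nrm q <= nrm (q *m diag_mx l').
  apply: nrm_mulmx_diag_ge => [|i]; first by rewrite divr_ge0// ltW.
  apply: le_trans (ler_norm _).
  have := hl i; rewrite ler_norml => /andP[h _].
  have g2 : gam <= 1 / 2 by rewrite ge_min lexx.
  have : gam * l 0 i <= 1 / 2 * l 0 i by rewrite ler_wpM2r// ltW.
  by have := hlam i; lra.
have b5 : `|s| * nrm (q *m diag_mx l') <= nrm (q *m B) + nrm e.
  rewrite -nrmZ; have -> : s *: (q *m diag_mx l') = q *m B + e by rewrite qB subrK.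
  exact: nrmD.
have b6 : F2 * gam <= lam / 8.
  apply: le_trans (_ : F2 * (lam / (8 * F2)) <= _).
    by rewrite ler_wpM2l ?(ltW F20)// ge_min lexx orbT.
  by rewrite le_eqVlt; apply/orP; left; apply/eqP; field; rewrite gt_eqF.
have b7 : `|s| * (lam / 2 * nrm q) <= `|s| * nrm (q *m diag_mx l') by rewrite ler_wpM2l.
have b8 : `|s| * nrm q * (F2 * gam) <= `|s| * nrm q * (lam / 8) by rewrite ler_wpM2l// mulr_ge0.
have b9 : lam / 4 * (`|s| * nrm q) <= (2 * F3 + 1) * nrm e by lra.
have -> : 4 / lam * (2 * F3 + 1) * nrm e = (lam / 4)^-1 * ((2 * F3 + 1) * nrm e).
  by field; rewrite gt_eqF.
by rewrite ler_pdivlMl ?divr_gt0.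
Qed.
End Diag.

(** * Eigenvectors of a perturbation of [U^T *m T *m U] *)

Section Perturbation.
Context {R : rcfType} {n K : nat}.
Variables (U : 'M[R]_(K, n)) (T : 'M[R]_K) (H : 'M[R]_n) (eta : R).
Hypotheses (UU : U *m U^T = 1%:M) (eta0 : 0 <= eta).
Hypothesis hE : forall x, nrm (x *m (H - U^T *m T *m U)) <= eta * nrm x.

(** Off the row space of U the model matrix vanishes, so that s times the residual of x is the
    residual of x E alone. *)
Lemma eigenvector_residual s (x : 'rV[R]_n) : x *m H = s *: x ->
  `|s| * nrm (x - x *m U^T *m U) <= eta * nrm x.
Proof.
move=> xH; rewrite -nrmZ; set E := H - U^T *m T *m U.
have -> : s *: (x - x *m U^T *m U) = x *m E - x *m E *m U^T *m U.
  have e1 : x *m E = s *: x - x *m U^T *m T *m U.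
    by rewrite mulmxBr xH !mulmxA.
  have e2 : x *m E *m U^T *m U = s *: (x *m U^T *m U) - x *m U^T *m T *m U.
    by rewrite e1 !mulmxBl -!scalemxAl -(mulmxA _ U U^T) UU mulmx1.
  by rewrite e2 e1 scalerBr opprB addrA subrK.
exact: le_trans (proj_residual_le _ UU) (hE _).
Qed.

Lemma eigenvector_proj_ge s (x : 'rV[R]_n) : x *m H = s *: x -> 2 * eta <= `|s| ->
  0 < `|s| -> nrm x / 2 <= nrm (x *m U^T).
Proof.
move=> xH s2 s0.
have h := eigenvector_residual xH.
have h2 : nrm (x - x *m U^T *m U) <= nrm x / 2.
  rewrite -(ler_pM2l s0); apply: le_trans h _.
  by have : 2 * eta * nrm x <= `|s| * nrm x; [rewrite ler_wpM2r ?nrm_ge0|lra].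
rewrite -(nrm_orthogonal _ UU).
have := nrmD (x - x *m U^T *m U) (x *m U^T *m U); rewrite subrK; lra.
Qed.

(** In the coordinates q = x U^T diag(g) the eigenvalue equation becomes q B = s q diag(g^-2) - e
    with e of size eta. If |s| were at most c0, [hker] would bound |s| by a multiple of eta, against
    the assumption on s. *)
Lemma eigenvalue_lower (B : 'M[R]_K) (g : 'rV[R]_K) (glo c0 C0 : R) s (x : 'rV[R]_n) :
  T = diag_mx g *m B *m diag_mx g -> 0 < glo -> (forall i, glo <= g 0 i) -> 0 <= C0 ->
  (forall s (q e : 'rV[R]_K), `|s| <= c0 ->
     q *m B = s *: (q *m diag_mx (\row_i (g 0 i ^+ 2)^-1)) - e -> `|s| * nrm q <= C0 * nrm e) ->
  x != 0 -> x *m H = s *: x -> 2 * eta <= `|s| -> 2 * C0 * eta / glo ^+ 2 < `|s| ->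
  c0 < `|s|.
Proof.
move=> TE glo0 hg C00 hker x0 xH s1 s2; rewrite ltNge; apply/negP => sc.
have g0 i : 0 < g 0 i by apply: lt_le_trans (hg i).
have s0 : 0 < `|s|.
  apply: le_lt_trans s2; rewrite divr_ge0 ?sqr_ge0//; exact: mulr_ge0 (mulr_ge0 _ _) _.
pose E := H - U^T *m T *m U.
pose p := x *m U^T; pose q := p *m diag_mx g.
pose gi := \row_i (g 0 i)^-1.
pose e := x *m E *m U^T *m diag_mx gi.
have ggi : diag_mx g *m diag_mx gi = 1%:M.
  rewrite mulmx_diag; apply/matrixP => i j; rewrite !mxE.
  by case: eqP => _; rewrite ?mulr0n// mulr1n divff// gt_eqF.
have pT : p *m T = s *: p - x *m E *m U^T.
  have -> : x *m E *m U^T = s *: p - p *m T.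
    by rewrite /E mulmxBr xH mulmxBl -scalemxAl !mulmxA -(mulmxA _ U U^T) UU mulmx1.
  by rewrite opprB addrC subrK.
have qB : q *m B = s *: (q *m diag_mx (\row_i (g 0 i ^+ 2)^-1)) - e.
  have -> : q *m B = p *m T *m diag_mx gi by rewrite TE /q -!mulmxA ggi mulmx1.
  rewrite pT mulmxBl -scalemxAl; congr (_ *: _ - _).
  rewrite /q -mulmxA mulmx_diag; congr (_ *m diag_mx _).
  by apply/rowP => i; rewrite !mxE; field; rewrite gt_eqF.
have := hker _ _ _ sc qB; apply/negP; rewrite -ltNge.
have xn : 0 < nrm x by rewrite nrm_gt0.
have he : nrm e <= glo^-1 * (eta * nrm x).
  apply: le_trans (@nrm_mulmx_diag_le _ _ _ _ glo^-1 _ _) _.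
  - by move=> i; rewrite mxE gtr0_norm ?invr_gt0// lef_pV2 ?posrE.
  - by rewrite invr_ge0 ltW.
  by rewrite ler_wpM2l ?invr_ge0 ?(ltW glo0)// (le_trans (bessel _ UU)).
have hq : glo * (nrm x / 2) <= nrm q.
  apply: le_trans (@nrm_mulmx_diag_ge _ _ _ _ glo _ _); rewrite ?(ltW glo0)//.
    by rewrite ler_wpM2l ?(ltW glo0)// (eigenvector_proj_ge xH).
  by move=> i; apply: le_trans (hg i) (ler_norm _).
apply: le_lt_trans (_ : C0 * (glo^-1 * (eta * nrm x)) < _); first by rewrite ler_wpM2l.
apply: lt_le_trans (_ : `|s| * (glo * (nrm x / 2)) <= _); last by rewrite ler_wpM2l.
have -> : C0 * (glo^-1 * (eta * nrm x)) = 2 * C0 * eta / glo ^+ 2 * (glo * (nrm x / 2)).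
  by field; rewrite gt_eqF.
by rewrite ltr_pM2r// mulr_gt0// divr_gt0.
Qed.

Section Embedded.
Variables (L : nat) (X : 'M[R]_(L, n)) (S : 'rV[R]_L) (c0 : R).
Hypotheses (XX : X *m X^T = 1%:M) (XH : X *m H = diag_mx S *m X).
Hypotheses (c00 : 0 < c0) (S_gt : forall i, c0 < `|S 0 i|) (eta_c0 : 2 * eta <= c0).

Lemma row_eigen i : row i X *m H = S 0 i *: row i X.
Proof. by rewrite -row_mul XH row_mul row_diag_mx -scalemxAl -rowE. Qed.

Lemma nrm_row i : nrm (row i X) = 1.
Proof.
apply/eqP; rewrite -(@eqrXn2 _ 2) ?nrm_ge0// expr1n sqr_nrm dotxx.
have /matrixP/(_ i i) := XX; rewrite mxE [1%:M _ _]mxE eqxx => h.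
apply/eqP; apply: etrans h.
by apply: eq_bigr => j _; rewrite !mxE expr2.
Qed.

(** Each row of X keeps at least 1/4 of its squared norm when projected on U. The total, summed
    instead over the K rows of U, is at most K by Bessel. *)
Lemma embedding_dim : L%:R <= 4 * K%:R :> R.
Proof.
have h1 : L%:R / 4 <= \sum_i nrm (row i X *m U^T) ^+ 2.
  have -> : L%:R / 4 = \sum_(i < L) (1 / 4) :> R.
    by rewrite sumr_const card_ord -mulr_natl; field.
  apply: ler_sum => i _.
  have := eigenvector_proj_ge (row_eigen i) (le_trans eta_c0 (ltW (S_gt i))) (lt_trans c00 (S_gt i)).
  rewrite nrm_row => h; have : (1 / 2) ^+ 2 <= nrm (row i X *m U^T) ^+ 2 by rewrite lerXn2r ?nnegrE ?nrm_ge0 ?divr_ge0.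
  by rewrite expr2; lra.
have h2 : \sum_i nrm (row i X *m U^T) ^+ 2 = \sum_k nrm (row k U *m X^T) ^+ 2.
  under eq_bigr do rewrite sqr_nrm dotxx.
  under [RHS]eq_bigr do rewrite sqr_nrm dotxx.
  rewrite exchange_big; apply: eq_bigr => k _; apply: eq_bigr => i _.
  congr (_ ^+ 2); rewrite !mxE; apply: eq_bigr => j _; by rewrite !mxE mulrC.
have h3 : \sum_k nrm (row k U *m X^T) ^+ 2 <= K%:R.
  apply: le_trans (_ : \sum_(k < K) 1 <= _); last by rewrite sumr_const card_ord.
  apply: ler_sum => k _; rewrite exprn_ile1 ?nrm_ge0//.
  apply: le_trans (bessel _ XX) _.
  suff -> : nrm (row k U) = 1 by [].
  apply/eqP; rewrite -(@eqrXn2 _ 2) ?nrm_ge0// expr1n sqr_nrm dotxx.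
  have /matrixP/(_ k k) := UU; rewrite mxE [1%:M _ _]mxE eqxx => h.
  apply/eqP; apply: etrans h.
  by apply: eq_bigr => j _; rewrite !mxE expr2.
by rewrite h2 in h1; lra.
Qed.

Lemma embedding_residual :
  \sum_i nrm (row i X - row i X *m U^T *m U) ^+ 2 <= 4 * K%:R * (eta / c0) ^+ 2.
Proof.
apply: le_trans (_ : \sum_(i < L) (eta / c0) ^+ 2 <= _); last first.
  by rewrite sumr_const card_ord -[leLHS]mulr_natl ler_wpM2r ?sqr_ge0// embedding_dim.
apply: ler_sum => i _; rewrite lerXn2r ?nnegrE ?nrm_ge0 ?divr_ge0 ?(ltW c00)//.
rewrite ler_pdivlMr//; have := eigenvector_residual (row_eigen i).
rewrite nrm_row mulr1 mulrC; apply: le_trans.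
by rewrite ler_wpM2l ?nrm_ge0// ltW.
Qed.

(** Split z U into its projection on the rows of X and a part that H shrinks by [thr]. A vector with
    a large image under T therefore has a large embedding; applied to differences of classes, this
    keeps the centers apart. *)
Lemma separation thr (z : 'rV[R]_K) Tmax :
  (forall x, x *m X^T = 0 -> nrm (x *m H) <= thr * nrm x) -> 0 <= thr ->
  frob T <= Tmax ->
  nrm (z *m T) <= (Tmax + eta) * nrm (z *m U *m X^T) + (thr + eta) * nrm z.
Proof.
move=> hthr thr0 hT; pose f := z *m U.
have nf : nrm f = nrm z by rewrite /f nrm_orthogonal.
have fP : f *m (U^T *m T *m U) = z *m T *m U.
  by rewrite /f !mulmxA -(mulmxA z) UU mulmx1.
pose y := f *m X^T; pose f' := f - y *m X.
have f'0 : f' *m X^T = 0 by rewrite mulmxBl -(mulmxA y) XX mulmx1 subrr.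
have f'n : nrm f' <= nrm f by exact: proj_residual_le.
rewrite -(nrm_orthogonal (z *m T) UU) -fP.
have -> : f *m (U^T *m T *m U) = y *m X *m H + f' *m H - f *m (H - U^T *m T *m U).
  by rewrite mulmxBr -mulmxDl /f' [y *m X + _]addrC subrK opprB addrC subrK.
apply: le_trans (nrmB _ _) _.
have h1 : nrm (f *m (H - U^T *m T *m U)) <= eta * nrm z by rewrite -nf hE.
have h2 : nrm (f' *m H) <= thr * nrm z.
  by apply: le_trans (hthr _ f'0) _; rewrite ler_wpM2l// -nf.
have Smax i : `|S 0 i| <= Tmax + eta.
  have -> : `|S 0 i| = nrm (row i X *m H) by rewrite row_eigen nrmZ nrm_row mulr1.
  have -> : row i X *m H = row i X *m U^T *m T *m U + row i X *m (H - U^T *m T *m U).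
    by rewrite mulmxBr !mulmxA addrC subrK.
  apply: le_trans (nrmD _ _) _; apply: lerD; last first.
    by apply: le_trans (hE _) _; rewrite nrm_row mulr1.
  rewrite nrm_orthogonal//; apply: le_trans (nrm_mulmx_frob _ _) _.
  apply: le_trans hT; rewrite -[leRHS]mulr1 ler_wpM2l ?frob_ge0//.
  by rewrite -(nrm_row i) bessel.
have h3 : nrm (y *m X *m H) <= (Tmax + eta) * nrm y.
  rewrite -mulmxA XH mulmxA nrm_orthogonal//; apply: nrm_mulmx_diag_le => //.
  by rewrite addr_ge0// (le_trans (frob_ge0 T)).
apply: le_trans (lerD (nrmD _ _) (lexx _)) _.
by rewrite -/f -/y; lra.
Qed.
End Embedded.
End Perturbation.

Section BlockConstant.
Context {R : rcfType} {K n : nat}.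
Variables (alpha : 'I_K -> R) (sigma : 'I_n -> 'I_K) (B : 'M[R]_K) (m : 'I_K -> R).
Hypotheses (n0 : (0 < n)%N) (alpha0 : forall k, 0 < alpha k).
Hypothesis class_size : forall k, #|[pred u | sigma u == k]|%:R = alpha k * n%:R.

(** The rows are the normalized indicators of the communities; [block_core] is the K x K matrix of
    the block-constant model in this orthonormal family. *)
Definition class_mx : 'M[R]_(K, n) :=
  \matrix_(k, u) ((sigma u == k)%:R / Num.sqrt (alpha k * n%:R)).
Definition block_scale : 'rV[R]_K := \row_k (Num.sqrt (alpha k) / m k).
Definition block_core : 'M[R]_K := diag_mx block_scale *m B *m diag_mx block_scale.

Let n0R : 0 < n%:R :> R. Proof. by rewrite ltr0n. Qed.

Lemma class_mx_orthonormal : class_mx *m class_mx^T = 1%:M.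
Proof.
apply/matrixP => k l; rewrite !mxE.
have [<-|kl] := eqVneq k l; last first.
  rewrite big1// => u _; rewrite !mxE.
  by case: (eqVneq (sigma u) k) => [->|_]; rewrite ?(negPf kl) ?mul0r ?mulr0.
have an : 0 < alpha k * n%:R by rewrite mulr_gt0.
rewrite (eq_bigr (fun u => (sigma u == k)%:R * (alpha k * n%:R)^-1)); last first.
  move=> u _; rewrite !mxE -mulrA; case: (sigma u == k); rewrite ?mul0r// !mul1r.
  by rewrite -invfM -expr2 sqr_sqrtr// ltW.
by rewrite -mulr_suml -natr_sum -big_mkcond/= sum1_card class_size divff ?gt_eqF.
Qed.

Lemma class_mx_coreE u v : (class_mx^T *m block_core *m class_mx) u v =
  B (sigma u) (sigma v) / (n%:R * m (sigma u) * m (sigma v)).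
Proof.
have colE (A : 'M[R]_K) i w : (A *m class_mx) i w = A i (sigma w) / Num.sqrt (alpha (sigma w) * n%:R).
  rewrite mxE (bigD1 (sigma w))//= big1 => [|k kw]; rewrite mxE; first by rewrite eqxx mul1r addr0.
  by rewrite eq_sym (negPf kw) mul0r mulr0.
have -> : (class_mx^T *m block_core *m class_mx) u v =
   block_core (sigma u) (sigma v) / Num.sqrt (alpha (sigma u) * n%:R) / Num.sqrt (alpha (sigma v) * n%:R).
  rewrite -mulmxA mxE (bigD1 (sigma u))//= big1 => [|k ku]; rewrite [_^T _ _]mxE [class_mx _ u]mxE.
    by rewrite eqxx addr0 colE mul1r mulrA [_^-1 * _]mulrC.
  by rewrite eq_sym (negPf ku) mul0r mul0r.
rewrite /block_core mul_mx_diag mxE mul_diag_mx !mxE !sqrtrM ?(ltW (alpha0 _))//.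
have s k : Num.sqrt (alpha k) != 0 by rewrite gt_eqF// sqrtr_gt0.
have nn : n%:R = Num.sqrt (n%:R : R) ^+ 2 by rewrite sqr_sqrtr// ltW.
have ns : Num.sqrt (n%:R : R) != 0 by rewrite gt_eqF// sqrtr_gt0.
rewrite {3}nn.
rewrite !invfM.
rewrite -[LHS]mulrA.
set a := Num.sqrt (alpha (sigma u)); set b := Num.sqrt (alpha (sigma v)); set c := Num.sqrt n%:R.
have -> : a * (m (sigma u))^-1 * B (sigma u) (sigma v) * (b * (m (sigma v))^-1) * (a^-1 * c^-1 * (b^-1 * c^-1))
  = (a * a^-1) * (b * b^-1) * (B (sigma u) (sigma v) * ((c^-1 * c^-1) * (m (sigma u))^-1 * (m (sigma v))^-1)) by ring.
by rewrite !divff ?s// !mul1r -invfM -expr2 sqr_sqrtr ?(ltW n0R).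
Qed.
End BlockConstant.

Lemma nrm_delta {R : rcfType} n (i : 'I_n) : nrm (delta_mx 0 i : 'rV[R]_n) = 1.
Proof.
rewrite /nrm dotxx (bigD1 i)//= big1 => [|j ji]; rewrite mxE eqxx/=.
  by rewrite eqxx expr1n addr0 sqrtr1.
by rewrite (negPf ji) expr0n.
Qed.

Lemma delta_sub_mulmx {R : comPzRingType} m n (A : 'M[R]_(m, n)) i l a b j :
  ((a *: delta_mx 0 i - b *: delta_mx 0 l : 'rV[R]_m) *m A) 0 j
  = a * A i j - b * A l j.
Proof. by rewrite mulmxBl -!scalemxAl -!rowE !mxE. Qed.

Lemma nrm_le_frob {R : rcfType} m n (A B : 'M[R]_(m, n)) :
  (forall i j, `|A i j| <= B i j) -> frob A <= frob B.
Proof.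
move=> h; rewrite /frob ler_wsqrtr// ler_sum// => i _; rewrite ler_sum// => j _.
rewrite -[leLHS]real_normK ?num_real// lerXn2r ?nnegrE//.
by apply: le_trans (h i j).
Qed.

(** * Perturbation constants uniform in the number of vertices *)

Section Structure.
Context {R : realType} {K : nat}.
Variables (B : 'M[R]_K) (Mbar alpha : 'I_K -> R).
Hypotheses (BT : B^T = B) (B0 : forall i j, 0 <= B i j).
Hypotheses (M0 : forall i, 0 < Mbar i) (a0 : forall i, 0 < alpha i).
Hypothesis ident : forall i l, i != l -> exists j, B i j / Mbar i != B l j / Mbar l.

(** Hypothesis (iii) concerns the limits [Mbar]; since there are finitely many pairs of communities,
    the smallest gap is positive and survives a small relative change of the limits. *)
Lemma profile_gap : exists c1 c2 : R, [/\ 0 < c1, 0 < c2 &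
  forall m : 'I_K -> R, (forall i, `|m i - Mbar i| <= c1 * Mbar i) ->
  forall i l, i != l -> exists j, c2 <= `|B i j / m i - B l j / m l|].
Proof.
have hJ (x : 'I_K * 'I_K) : exists j, x.1 != x.2 ->
    B x.1 j / Mbar x.1 != B x.2 j / Mbar x.2.
  case: x => i l /=; have [->|il] := eqVneq i l; first by exists l.
  by have [j hj] := ident il; exists j.
have [J HJ] := choice hJ.
pose D x : R := `|B x.1 (J x) / Mbar x.1 - B x.2 (J x) / Mbar x.2|.
pose Q x : R := B x.1 (J x) / Mbar x.1 + B x.2 (J x) / Mbar x.2.
have Q0 x : 0 <= Q x by rewrite addr_ge0// divr_ge0// ltW.
have D0 x : x.1 != x.2 -> 0 < D x by move=> /HJ h; rewrite normr_gt0 subr_eq0.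
pose F (x : 'I_K * 'I_K) : R := if x.1 == x.2 then 1 else Num.min (D x / 2) (D x / (4 * (Q x + 1))).
have [c c0 hc] : exists2 c, 0 < c & forall x, c <= F x.
  apply: pos_lower_bound => x; rewrite /F; case: eqVneq => // /D0 d0.
  by rewrite lt_min !divr_gt0// mulr_gt0// ltr_wpDl.
pose c1 := Num.min c (1 / 2).
have c1c : c1 <= c by rewrite ge_min lexx.
have c1h : c1 <= 1 / 2 by rewrite ge_min lexx orbT.
have c10 : 0 < c1 by rewrite lt_min c0 divr_gt0.
exists c1, c; split => // m hm i l il.
exists (J (i, l)).
have := hc (i, l); rewrite /F/= (negPf il) le_min => /andP[hd hq].
have Dp : 0 < D (i, l) by exact: D0.
have close k j : `|B k j / m k - B k j / Mbar k| <= B k j / Mbar k * (2 * c1).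
  have hk := hm k; have mk : Mbar k / 2 <= m k.
    have := hk; rewrite ler_norml => /andP[h _].
    have : c1 * Mbar k <= 1 / 2 * Mbar k by rewrite ler_wpM2r// ltW.
    lra.
  have mk0 : 0 < m k by apply: lt_le_trans mk; rewrite divr_gt0.
  have -> : B k j / m k - B k j / Mbar k = B k j / Mbar k * ((Mbar k - m k) / m k).
    by field; rewrite !gt_eqF.
  rewrite normrM ger0_norm ?divr_ge0 ?(ltW (M0 _))// ler_wpM2l ?divr_ge0 ?(ltW (M0 _))//.
  rewrite normrM normfV (gtr0_norm mk0) ler_pdivrMr// distrC (le_trans hk)//.
  have : c1 * (Mbar k / 2) <= c1 * m k by rewrite ler_wpM2l// ltW.
  lra.
have h1 := close i (J (i, l)); have h2 := close l (J (i, l)).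
have hQ : Q (i, l) * (2 * c1) <= D (i, l) / 2.
  have : c1 * (4 * (Q (i, l) + 1)) <= D (i, l).
    rewrite -ler_pdivlMr ?mulr_gt0 ?ltr_wpDl//; exact: le_trans hq.
  lra.
rewrite /Q/= in hQ.
have : D (i, l) <= `|B i (J (i, l)) / m i - B l (J (i, l)) / m l| + D (i, l) / 2.
  rewrite {1}/D /=.
  set x := B i _ / Mbar i; set y := B l _ / Mbar l.
  set x' := B i _ / m i; set y' := B l _ / m l.
  have -> : x - y = (x' - y') - (x' - x) + (y' - y) by ring.
  apply: le_trans (ler_normD _ _) _; have := ler_normB (x' - y') (x' - x).
  rewrite -/x -/x' -/y -/y' in h1 h2 hQ; lra.
lra.
Qed.

(** Here t is the threshold rescaled by the mean weight and eta the operator-norm error. The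
    constants precede n: the window between [c2 * eta] and [c1] is where thresholds select the right
    eigenvectors. *)
Definition block_structure (c1 c2 c3 : R) : Prop :=
  forall (n : nat) (sigma : 'I_n -> 'I_K) (m : 'I_K -> R) (H : 'M[R]_n) (eta t : R)
    (L : nat) (X : 'M[R]_(L, n)) (S : 'rV[R]_L),
  (0 < n)%N -> (forall k, #|[pred u | sigma u == k]|%:R = alpha k * n%:R) ->
  (forall i, `|m i - Mbar i| <= c1 * Mbar i) ->
  0 <= eta -> 0 < t -> t <= c1 -> c2 * eta <= t ->
  (forall x, nrm (x *m (H - (class_mx alpha sigma)^T *m block_core alpha B m
                          *m class_mx alpha sigma)) <= eta * nrm x) ->
  X *m X^T = 1%:M -> X *m H = diag_mx S *m X -> (forall i, t < `|S 0 i|) ->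
  (forall x, x *m X^T = 0 -> nrm (x *m H) <= t * nrm x) ->
  exists ctr : 'I_K -> 'I_L -> R,
    \sum_u \sum_i (X i u - ctr (sigma u) i) ^+ 2 <= (c2 * eta) ^+ 2
    /\ forall i l, i != l ->
       c3 <= Num.sqrt n%:R * Num.sqrt (\sum_j (ctr i j - ctr l j) ^+ 2).

Lemma embedding_structure : exists c1 c2 c3 : R,
  [/\ 0 < c1, 0 < c2, 0 < c3 & block_structure c1 c2 c3].
Proof.
pose linf := \row_i (Mbar i ^+ 2 / alpha i) : 'rV[R]_K.
have linf0 i : 0 < linf 0 i by rewrite mxE divr_gt0// exprn_gt0.
have [c0 [C0 [gam [c00 C00 gam0 hker]]]] := kernel_gap BT linf0.
have [d1 [d2 [d10 d20 hgap]]] := profile_gap.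
have [glo glo0 hglo] : exists2 g, 0 < g & forall i, g <= Num.sqrt (alpha i) / (2 * Mbar i).
  by apply: pos_lower_bound => i; rewrite divr_gt0 ?sqrtr_gt0// mulr_gt0.
have [amin amin0 hamin] : exists2 a, 0 < a & forall i, a <= Num.sqrt (alpha i).
  by apply: pos_lower_bound => i; rewrite sqrtr_gt0.
pose T0 : 'M[R]_K := \matrix_(i, j) (2 * Num.sqrt (alpha i) / Mbar i * B i j * (2 * Num.sqrt (alpha j) / Mbar j)).
pose Tmax := frob T0.
have Tmax0 : 0 <= Tmax := frob_ge0 _.
pose sep := glo * d2; have sep0 : 0 < sep by rewrite mulr_gt0.
pose zq := 2 / amin; have zq0 : 0 < zq by rewrite divr_gt0.
(* In order: stability of [kernel_gap] (m^2 moves by at most 3 c1 relatively), m within a factor 2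
   of [Mbar], stability of the profiles, 2 eta <= c0, and a loss of at most half in the
   separation. *)
pose c1 := Num.min (Num.min (gam / 3) (1 / 2)) (Num.min (Num.min d1 c0) (sep / (4 * zq))).
have c10 : 0 < c1.
  have q1 : 0 < gam / 3 by rewrite divr_gt0.
  have q2 : 0 < sep / (4 * zq) by rewrite divr_gt0// mulr_gt0.
  by rewrite !lt_min q1 q2 d10 c00 /= !andbT divr_gt0.
have c1gam : c1 <= gam / 3 by rewrite !ge_min lexx.
have c1h : c1 <= 1 / 2 by rewrite !ge_min lexx orbT.
have c1d1 : c1 <= d1 by rewrite !ge_min lexx !orbT.
have c1c0 : c1 <= c0 by rewrite !ge_min lexx !orbT.
have c1s : c1 <= sep / (4 * zq) by rewrite !ge_min lexx !orbT.
have g20 : 0 < glo ^+ 2 by rewrite exprn_gt0.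
(* The summands serve, in order, the projection bound, [eigenvalue_lower], and the residual, where
   (4K+1)^2 >= 4K. *)
pose c2 := 2 + 2 * C0 / glo ^+ 2 + (4 * K%:R + 1) / c0.
have e1 : 0 <= 2 * C0 / glo ^+ 2 by apply: divr_ge0; [lra|exact: ltW].
have k0 : 0 <= K%:R :> R by rewrite ler0n.
have e2 : 0 <= (4 * K%:R + 1) / c0 by apply: divr_ge0; [lra|exact: ltW].
have c22 : 2 <= c2 by rewrite /c2; lra.
pose c3 := sep / (2 * (Tmax + 1)).
have T1 : 0 < Tmax + 1 by rewrite ltr_wpDl.
have c30 : 0 < c3 by rewrite divr_gt0// mulr_gt0.
exists c1, c2, c3; split => //; first by lra.
move=> n sigma m H eta t L X S n0 cs hm eta0 t0 tc1 et hE XX XH St Xorth.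
have n0R : 0 < n%:R :> R by rewrite ltr0n.
set U := class_mx alpha sigma in hE *; set T := block_core alpha B m in hE *.
have UU : U *m U^T = 1%:M := class_mx_orthonormal n0 a0 cs.
have mb i : Mbar i / 2 <= m i /\ m i <= 2 * Mbar i.
  have := hm i; rewrite ler_norml => /andP[h h'].
  have : c1 * Mbar i <= 1 / 2 * Mbar i by rewrite ler_wpM2r// ltW.
  have := M0 i; split; lra.
have m0 i : 0 < m i by have [h _] := mb i; apply: lt_le_trans h; rewrite divr_gt0.
have gE i : block_scale alpha m 0 i = Num.sqrt (alpha i) / m i by rewrite mxE.
have sa i : 0 < Num.sqrt (alpha i) by rewrite sqrtr_gt0.
have glob i : glo <= block_scale alpha m 0 i.
  rewrite gE; apply: le_trans (hglo i) _; rewrite ler_wpM2l ?(ltW (sa i))//.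
  by rewrite lef_pV2 ?posrE ?mulr_gt0//; case: (mb i).
have eta1 : 2 * eta <= c2 * eta by rewrite ler_wpM2r.
have St2 i : 2 * eta <= `|S 0 i| by have := St i; lra.
have c2C : 2 * C0 * eta / glo ^+ 2 <= c2 * eta.
  have -> : 2 * C0 * eta / glo ^+ 2 = 2 * C0 / glo ^+ 2 * eta by ring.
  by rewrite ler_wpM2r// /c2; lra.
have Sc0 i : c0 < `|S 0 i|.
  have rn : row i X != 0.
    rewrite -nrm_eq0; apply/eqP => h.
    have /matrixP/(_ i i) := XX; rewrite mxE [1%:M _ _]mxE eqxx => h1.
    have : nrm (row i X) ^+ 2 = 1.
      by rewrite sqr_nrm dotxx; apply: etrans h1; apply: eq_bigr => j _; rewrite !mxE expr2.
    by rewrite h expr0n => /eqP; rewrite eq_sym oner_eq0.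
  apply: (eigenvalue_lower UU eta0 hE (T := T) (B := B) (g := block_scale alpha m) erefl glo0 glob (ltW C00) _ rn).
  - move=> s q e hs hq; apply: hker hs hq => k.
    rewrite !mxE exprMn exprVn sqr_sqrtr ?(ltW (a0 k))// invf_div.
    have -> : m k ^+ 2 / alpha k - Mbar k ^+ 2 / alpha k = (m k - Mbar k) * (m k + Mbar k) / alpha k.
      by field; rewrite gt_eqF.
    rewrite mulrA normrM normfV (gtr0_norm (a0 k)) ler_wpM2r ?invr_ge0 ?(ltW (a0 k))//.
    rewrite normrM (gtr0_norm (addr_gt0 (m0 k) (M0 k))).
    have [_ mk] := mb k.
    apply: le_trans (_ : (c1 * Mbar k) * (3 * Mbar k) <= _).
      by apply: ler_pM => //; [rewrite ltW ?addr_gt0|lra].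
    have -> : gam * Mbar k ^+ 2 = (gam / 3 * Mbar k) * (3 * Mbar k) by field.
    by rewrite ler_wpM2r ?mulr_ge0 ?(ltW (M0 k))// ler_wpM2r ?(ltW (M0 k)).
  - exact: row_eigen XH i.
  - exact: St2.
  - by apply: le_lt_trans c2C _; apply: le_lt_trans et _.
have etac0 : 2 * eta <= c0 by lra.
(* The center is the average of the embedding over the community. *)
pose ctr k i := (X *m U^T) i k / Num.sqrt (alpha k * n%:R).
have proj i u : (X *m U^T *m U) i u = ctr (sigma u) i.
  rewrite mxE (bigD1 (sigma u))//= big1 => [|k ku]; rewrite [U _ u]mxE.
    by rewrite eqxx mul1r addr0.
  by rewrite eq_sym (negPf ku) mul0r mulr0.
exists ctr; split.
  have := embedding_residual UU eta0 hE XX XH c00 Sc0 etac0.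
  have -> : \sum_i nrm (row i X - row i X *m U^T *m U) ^+ 2 =
      \sum_u \sum_i (X i u - ctr (sigma u) i) ^+ 2.
    rewrite exchange_big; apply: eq_bigr => i _; rewrite sqr_nrm dotxx.
    by apply: eq_bigr => u _; rewrite -proj -!row_mul !mxE.
  move=> h; apply: le_trans h _.
  have -> : 4 * K%:R * (eta / c0) ^+ 2 = 4 * K%:R / c0 ^+ 2 * eta ^+ 2 by field; rewrite gt_eqF.
  rewrite [leRHS]exprMn ler_wpM2r ?sqr_ge0//.
  apply: le_trans (_ : ((4 * K%:R + 1) / c0) ^+ 2 <= _); last first.
    by rewrite lerXn2r ?nnegrE//; rewrite /c2; lra.
  rewrite exprMn exprVn ler_wpM2r ?invr_ge0 ?sqr_ge0// expr2.
  nra.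
move=> i l il.
have [j hj] : exists j, d2 <= `|B i j / m i - B l j / m l|.
  by apply: hgap il => k; apply: le_trans (hm k) _; rewrite ler_wpM2r// ltW.
(* This z embeds to the difference of the two centers, while the j-th coordinate of z T is a
   multiple of the difference of profiles that [profile_gap] bounds from below. *)
pose z : 'rV[R]_K := (Num.sqrt (alpha i * n%:R))^-1 *: delta_mx 0 i
                   - (Num.sqrt (alpha l * n%:R))^-1 *: delta_mx 0 l.
have sn0 : 0 < Num.sqrt (n%:R : R) by rewrite sqrtr_gt0.
have san k : 0 < Num.sqrt (alpha k * n%:R) by rewrite sqrtr_gt0 mulr_gt0.
have zn : nrm z <= zq / Num.sqrt n%:R.
  apply: le_trans (nrmB _ _) _; rewrite !nrmZ !nrm_delta !mulr1 !gtr0_norm ?invr_gt0//.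
  have h k : (Num.sqrt (alpha k * n%:R))^-1 <= amin^-1 / Num.sqrt n%:R.
    rewrite sqrtrM ?(ltW (a0 k))// invfM ler_wpM2r ?invr_ge0 ?(ltW sn0)//.
    by rewrite lef_pV2 ?posrE.
  by have := h i; have := h l; rewrite /zq; lra.
have TE a b : T a b = block_scale alpha m 0 a * B a b * block_scale alpha m 0 b.
  by rewrite /T /block_core mul_mx_diag mxE mul_diag_mx mxE.
have zTj : (z *m T) 0 j = block_scale alpha m 0 j * (B i j / m i - B l j / m l) / Num.sqrt n%:R.
  rewrite /z delta_sub_mulmx !TE !gE !sqrtrM ?(ltW (a0 _))//; field.
  by rewrite !gt_eqF.
have zT : sep / Num.sqrt n%:R <= nrm (z *m T).
  apply: le_trans (nrm_coord _ j); rewrite zTj normrM normfV (gtr0_norm sn0).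
  rewrite ler_wpM2r ?invr_ge0 ?(ltW sn0)// normrM.
  apply: ler_pM; rewrite ?(ltW glo0) ?(ltW d20)//.
  exact: le_trans (glob j) (ler_norm _).
have hT : frob T <= Tmax.
  apply: nrm_le_frob => a b; rewrite TE !gE [T0 a b]mxE.
  have hs k : 0 <= Num.sqrt (alpha k) / m k /\ Num.sqrt (alpha k) / m k <= 2 * Num.sqrt (alpha k) / Mbar k.
    split; first by rewrite divr_ge0// ltW.
    have -> : 2 * Num.sqrt (alpha k) / Mbar k = Num.sqrt (alpha k) / (Mbar k / 2).
      by field; rewrite gt_eqF.
    by rewrite ler_wpM2l// lef_pV2 ?posrE ?divr_gt0//; case: (mb k).
  have [p1 p2] := hs a; have [p3 p4] := hs b.
  rewrite ger0_norm; last by apply: mulr_ge0 => //; apply: mulr_ge0.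
  by apply: ler_pM => //; [rewrite mulr_ge0|rewrite ler_wpM2r].
have := separation UU eta0 hE XX XH z Xorth (ltW t0) hT.
have zX : nrm (z *m U *m X^T) = Num.sqrt (\sum_k (ctr i k - ctr l k) ^+ 2).
  rewrite /nrm dotxx; congr Num.sqrt; apply: eq_bigr => k _; congr (_ ^+ 2).
  rewrite -mulmxA /z delta_sub_mulmx /ctr ![_ / Num.sqrt _]mulrC.
  have e a : (U *m X^T) a k = (X *m U^T) k a.
    by rewrite !mxE; apply: eq_bigr => u _; rewrite !mxE mulrC.
  by rewrite !e.
rewrite zX; set d := Num.sqrt (\sum_k _).
have d0 : 0 <= d by exact: sqrtr_ge0.
move=> h.
have eta12 : eta <= 1 by lra.
have h1 : (Tmax + eta) * d <= (Tmax + 1) * d by rewrite ler_wpM2r// lerD2l.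
have h2 : (t + eta) * nrm z <= 2 * c1 * (zq / Num.sqrt n%:R).
  by apply: ler_pM; rewrite ?nrm_ge0 ?addr_ge0 ?(ltW t0)//; lra.
have h3 : 2 * c1 * zq <= sep / 2.
  have : c1 * (4 * zq) <= sep by rewrite -ler_pdivlMr// mulr_gt0.
  lra.
have h4 : 2 * c1 * (zq / Num.sqrt n%:R) <= sep / 2 / Num.sqrt n%:R.
  by rewrite mulrA ler_wpM2r// invr_ge0 ltW.
have h5 : sep / 2 / Num.sqrt n%:R <= (Tmax + 1) * d.
  have -> : sep / 2 / Num.sqrt n%:R = sep / Num.sqrt n%:R - sep / 2 / Num.sqrt n%:R.
    by field; rewrite gt_eqF.
  lra.
rewrite /c3 ler_pdivrMr ?mulr_gt0//.
by move: h5; rewrite ler_pdivrMr// => h5; lra.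
Qed.
End Structure.

(** * Clustering *)

Section ScaledDist.
Context {R : realType} {n L : nat}.
Variable X : 'M[R]_(L, n).

Lemma scaled_distE u v :
  scaled_dist X u v = Num.sqrt n%:R * nrm (row u X^T - row v X^T).
Proof.
rewrite /scaled_dist /nrm dotxx; congr (_ * Num.sqrt _).
by apply: eq_bigr => i _; rewrite !mxE.
Qed.

Definition center_dist (c : 'rV[R]_L) u := Num.sqrt n%:R * nrm (row u X^T - c).

Lemma scaled_dist_sym u v : scaled_dist X u v = scaled_dist X v u.
Proof. by rewrite !scaled_distE -nrmN opprB. Qed.

Lemma scaled_dist_triangle u v w :
  scaled_dist X u w <= scaled_dist X u v + scaled_dist X v w.
Proof.
rewrite !scaled_distE -mulrDr ler_wpM2l ?sqrtr_ge0//.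
have -> : row u X^T - row w X^T = (row u X^T - row v X^T) + (row v X^T - row w X^T).
  by rewrite addrA subrK.
exact: nrmD.
Qed.

Lemma scaled_dist_le_centers c c' u v :
  scaled_dist X u v <= center_dist c u + Num.sqrt n%:R * nrm (c - c') + center_dist c' v.
Proof.
rewrite scaled_distE /center_dist -!mulrDr ler_wpM2l ?sqrtr_ge0//.
have -> : row u X^T - row v X^T = (row u X^T - c) + (c - c') - (row v X^T - c').
  by rewrite opprB !addrA !subrK.
by apply: le_trans (nrmB _ _) _; rewrite lerD2r nrmD.
Qed.

Lemma scaled_dist_ge_centers c c' u v :
  Num.sqrt n%:R * nrm (c - c') <= center_dist c u + scaled_dist X u v + center_dist c' v.
Proof.
rewrite scaled_distE /center_dist -!mulrDr ler_wpM2l ?sqrtr_ge0//.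
have -> : c - c' = - (row u X^T - c) + (row u X^T - row v X^T) + (row v X^T - c').
  by rewrite opprB !addrA !subrK.
by apply: le_trans (nrmD _ _) _; rewrite lerD2r -[nrm (_ - c)]nrmN nrmD.
Qed.
End ScaledDist.

Section Clustering.
Context {R : realType} {n L K : nat}.
Variables (X : 'M[R]_(L, n)) (phi : R) (eps : \bar R) (sigma : 'I_n -> 'I_K).
Variable good : pred 'I_n.

Definition within (c : R) u v := ((scaled_dist X u v)%:E <= eps * c%:E)%E.

Hypothesis same8 : forall u v, good u -> good v -> sigma u = sigma v -> within 8^-1 u v.
Hypothesis same4 : forall m u v, within 8^-1 m u -> good u -> good v ->
  sigma u = sigma v -> within 4^-1 m v.
Hypothesis diff4 : forall m u v, within 8^-1 m u -> good u -> good v ->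
  sigma u != sigma v -> ~~ within 4^-1 m v.
Hypothesis few_bad : #|[pred u | ~~ good u]|%:R <= phi `^ (1 / 3) * n%:R.
Hypothesis large_class : forall k,
  phi `^ (1 / 3) * n%:R < #|[pred u | good u && (sigma u == k)]|%:R.

(** Invariant: the good vertices that remain are exactly those of the communities in Q. Each round
    removes the good vertices of one community, and the procedure cannot stop while Q is nonempty,
    since any good vertex of a remaining community is a dense center. *)
Lemma clustering_labels (out : seq {set 'I_n}) (rem : {set 'I_n}) (Q : {set 'I_K}) :
  (forall u, good u -> (u \in rem) = (sigma u \in Q)) ->
  clustering X phi eps rem out ->
  exists l : seq 'I_K, [/\ uniq l, l =i Q, size l = size out &
    forall u, good u -> sigma u \in Q -> u \in nth finset.set0 out (index (sigma u) l)].
Proof.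
elim: out rem Q => [|C out IH] rem Q inv /=.
  move=> nodense.
  have Q0 k : k \in Q -> False.
    move=> kQ.
    have : (0 < #|[pred u | good u && (sigma u == k)]|)%N.
      rewrite -(ltr_nat R); apply: le_lt_trans (large_class k).
      by rewrite mulr_ge0 ?powR_ge0.
    case/card_gt0P => m; rewrite !inE => /andP[gm /eqP mk].
    have := nodense m; apply/negP; rewrite negbK /dense_center inv// mk kQ /=.
    apply: lt_le_trans (large_class k) _; rewrite ler_nat.
    apply: subset_leq_card; apply/fintype.subsetP => u; rewrite !inE => /andP[gu /eqP uk].
    rewrite inv// uk kQ /=; apply: same8 => //; by rewrite mk uk.
  exists [::]; split => // [k|u _ /Q0//].
  by rewrite in_nil; case: (boolP (k \in Q)) => // /Q0.
case=> -[m /andP[mrem dense] CE] cl.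
(* The center m may itself be bad, but its small ball holds more vertices than there are bad ones; a
   good vertex g in it decides the community. *)
have [g /and3P[grem gg wmg]] : exists g, [&& g \in rem, good g & within 8^-1 m g].
  apply/existsP; apply: contraLR dense => /existsPn h.
  rewrite -leNgt; apply: le_trans few_bad; rewrite ler_nat.
  apply: subset_leq_card; apply/fintype.subsetP => u; rewrite !inE => /andP[ur wu].
  by have := h u; rewrite ur /within wu andbT.
pose k := sigma g.
have kQ : k \in Q by rewrite -inv.
have CP u : good u -> (u \in C) = (sigma u == k).
  move=> gu; rewrite CE !inE.
  have [uk|uk] := eqVneq (sigma u) k.
    rewrite inv// uk kQ /=; exact: (same4 wmg gg gu).
  by apply/negP => /andP[_]; apply/negP; apply: (diff4 wmg gg gu); rewrite eq_sym.
have inv' u : good u -> (u \in rem :\: C)%SET = (sigma u \in Q :\ k)%SET.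
  by move=> gu; rewrite !inE CP// inv//.
have [l [ul lQ sl hl]] := IH _ _ inv' cl.
exists (k :: l); split => /=.
- by rewrite ul andbT lQ !inE eqxx.
- move=> j; rewrite inE lQ !inE; case: eqVneq => [->|_] //=; by rewrite ?kQ.
- by rewrite sl.
- move=> u gu uQ; rewrite eq_sym; case: (eqVneq (sigma u) k) => [uk|uk] /=.
    by rewrite CP// uk.
  by apply: hl => //; rewrite !inE uk.
Qed.

Lemma clustering_recovers (out : seq {set 'I_n}) :
  clustering X phi eps [set: 'I_n]%SET out ->
  exists2 pi : 'I_K -> 'I_(size out), bijective pi
    & (#|[pred u | u \notin nth finset.set0 out (pi (sigma u))]| <= #|[pred u | ~~ good u]|)%N.
Proof.
move=> /(clustering_labels (Q := [set: 'I_K]%SET)) [|l [ul lQ sl hl]].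
  by move=> u _; rewrite !inE.
have il k : (index k l < size out)%N by rewrite -sl index_mem lQ inE.
exists (fun k => Ordinal (il k)).
  apply: inj_card_bij.
    move=> k k' /(congr1 val) /= e; transitivity (nth k l (index k l)).
      by rewrite nth_index// lQ inE.
    by rewrite e nth_index// lQ inE.
  rewrite !card_ord -sl -(card_uniqP ul) -[leqRHS]card_ord.
  by apply: subset_leq_card; apply/fintype.subsetP => k _.
apply: subset_leq_card; apply/fintype.subsetP => u; rewrite !inE /=.
by apply: contra => gu; apply: hl => //; rewrite inE.
Qed.
End Clustering.

(** * The radius estimated from sampled pairs *)

Section Gap.
Context {R : realType} {n L K t : nat}.
Variables (X : 'M[R]_(L, n)) (phi : R) (sigma : 'I_n -> 'I_K) (ctr : 'I_K -> 'rV[R]_L).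
Variables (w : pair_sample n t) (c : R).

(** Half of the cut-off f^(2/3): two vertices of one community within r of their center are never
    counted in the minimum. *)
Let r := phi `^ (2 / 3) / 2.
Definition near_center (u : 'I_n) := center_dist X (ctr (sigma u)) u <= r.

Hypothesis sep : forall i l, i != l -> c <= Num.sqrt n%:R * nrm (ctr i - ctr l).
Hypothesis r_small : 20 * r <= c.
Hypothesis phi0 : 0 < phi.
Hypothesis sample_near : forall j, near_center (w j).1 /\ near_center (w j).2.
Hypothesis sample_all : forall a b, exists j, sigma (w j).1 = a /\ sigma (w j).2 = b.

Let r0 : 0 < r. Proof. by rewrite divr_gt0// powR_gt0. Qed.
Let c0 : 0 < c. Proof. by apply: lt_le_trans r_small; rewrite mulr_gt0. Qed.

Lemma near_same u v : near_center u -> near_center v -> sigma u = sigma v ->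
  scaled_dist X u v <= 2 * r.
Proof.
move=> gu gv e; have := scaled_dist_le_centers X (ctr (sigma u)) (ctr (sigma v)) u v.
move: gu gv; rewrite /near_center e subrr nrm0 mulr0; lra.
Qed.

Lemma gap_lower : (((c - 2 * r)%:E) <= gap X phi w)%E.
Proof.
rewrite /gap; apply: (big_ind (fun e => ((c - 2 * r)%:E <= e)%E)).
- by rewrite leey.
- by move=> x y hx hy; rewrite le_min hx.
move=> j hj; rewrite lee_fin.
have [g1 g2] := sample_near j.
have [e|ne] := eqVneq (sigma (w j).1) (sigma (w j).2).
  have := near_same g1 g2 e; rewrite /r => h; exfalso; move: hj; apply/negP; rewrite -leNgt; lra.
have := scaled_dist_ge_centers X (ctr (sigma (w j).1)) (ctr (sigma (w j).2)) (w j).1 (w j).2.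
by have := sep ne; rewrite /near_center in g1 g2; lra.
Qed.

(** A sampled pair across a and b realizes the distance of the centers up to 2r, and exceeds the
    cut-off, so it takes part in the minimum. *)
Lemma gap_upper a b : a != b ->
  (gap X phi w <= (Num.sqrt n%:R * nrm (ctr a - ctr b) + 2 * r)%:E)%E.
Proof.
move=> ab; have [j [ja jb]] := sample_all a b.
have [g1 g2] := sample_near j; rewrite /near_center ja jb in g1 g2.
have h1 := scaled_dist_le_centers X (ctr a) (ctr b) (w j).1 (w j).2.
have h2 := scaled_dist_ge_centers X (ctr a) (ctr b) (w j).1 (w j).2.
have hs := sep ab.
apply: le_trans (_ : (scaled_dist X (w j).1 (w j).2)%:E <= _)%E; last by rewrite lee_fin; lra.
rewrite /gap (bigD1 j)/=; first by rewrite ge_min lexx.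
have : 2 * r < scaled_dist X (w j).1 (w j).2 by have := r0; move: hs h2 g1 g2 r_small; lra.
by rewrite /r mulrC divfK.
Qed.

Lemma near_diff_gap u v : near_center u -> near_center v -> sigma u != sigma v ->
  (gap X phi w <= (scaled_dist X u v + 4 * r)%:E)%E.
Proof.
move=> gu gv ne; apply: le_trans (gap_upper ne) _; rewrite lee_fin.
have := scaled_dist_ge_centers X (ctr (sigma u)) (ctr (sigma v)) u v.
by rewrite /near_center in gu gv; lra.
Qed.

(** From 20 r <= c the gap is at least 18 r. Same-community distances are at most 2r <= gap/8,
    passing from radius gap/8 to gap/4 needs gap >= 16 r, and excluding other communities needs 5/8
    of the gap to exceed 4r. *)
Lemma gap_clustering_recovers (out : seq {set 'I_n}) :
  #|[pred u | ~~ near_center u]|%:R <= phi `^ (1 / 3) * n%:R ->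
  (forall k, phi `^ (1 / 3) * n%:R < #|[pred u | near_center u && (sigma u == k)]|%:R) ->
  clustering X phi (gap X phi w) [set: 'I_n]%SET out ->
  exists2 pi : 'I_K -> 'I_(size out), bijective pi
    & (#|[pred u | u \notin nth finset.set0 out (pi (sigma u))]|
       <= #|[pred u | ~~ near_center u]|)%N.
Proof.
move=> few large; apply: (clustering_recovers _ _ _ few large).
- move=> u v gu gv e; have h := near_same gu gv e; rewrite /within.
  have := gap_lower; case: (gap X phi w) => [x| |] //=; rewrite ?lee_fin => hx.
    by rewrite -?EFinM ?lee_fin; have := r0; move: h hx r_small; lra.
  (* The gap is +oo when K = 1: no sampled pair exceeds the cut-off and every ball is the whole
     set. *)
  by rewrite mulyr gtr0_sg ?invr_gt0// mul1e leey.
- move=> m u v; rewrite /within => + gu gv e; have h := near_same gu gv e.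
  have tr := scaled_dist_triangle X m u v.
  have := gap_lower; case: (gap X phi w) => [x| |] //=; rewrite ?lee_fin => hx.
    by rewrite -?EFinM ?lee_fin => hm; have := r0; move: h hx tr hm r_small; lra.
  by move=> _; rewrite mulyr gtr0_sg ?invr_gt0// mul1e leey.
move=> m u v; rewrite /within => + gu gv ne; have h := near_diff_gap gu gv ne.
have tr := scaled_dist_triangle X u m v; rewrite (scaled_dist_sym X u m) in tr.
have := gap_lower; move: h; case: (gap X phi w) => [x| |] //=; rewrite ?lee_fin => hx1 hx.
by rewrite -?EFinM ?lee_fin => hm; rewrite -ltNge; have := r0; move: hx1 hx tr hm r_small; lra.
Qed.
End Gap.

(** * Concentration of degrees and of the normalized adjacency matrix *)

Definition incident {n} (u : 'I_n) (e : upair n) := ((val e).1 == u) || ((val e).2 == u).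

Lemma sum_incident {R : nmodType} {n} (F : 'I_n -> 'I_n -> R) u :
  (forall v w, F v w = F w v) ->
  \sum_(e | incident u e) F (val e).1 (val e).2 = \sum_(v | v != u) F u v.
Proof.
move=> Fs.
transitivity (\sum_(x : 'I_n * 'I_n | (x.1 < x.2)%N && ((x.1 == u) || (x.2 == u))) F x.1 x.2).
  rewrite [RHS](reindex_omap (val : upair n -> 'I_n * 'I_n) insub)/=; last first.
    by move=> e /andP[ee _]; rewrite insubT.
  apply: eq_bigl => e; rewrite valK eqxx andbT.
  by rewrite (valP e : (_ < _)%N).
rewrite big_mkcond -(pair_bigA _ (fun v w : 'I_n =>
  if (v < w)%N && ((v == u) || (w == u)) then F v w else 0))/=.
transitivity (\sum_(v < n) \sum_(w < n) ((if v == u then if (u < w)%N then F u w else 0 else 0)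
   + (if w == u then if (v < u)%N then F u v else 0 else 0))).
  apply: eq_bigr => v _; apply: eq_bigr => w _.
  have [->|vu] := eqVneq v u; have [->|wu] := eqVneq w u; rewrite ?ltnn ?andbT ?andbF ?addr0 ?add0r//.
  by rewrite Fs.
rewrite (eq_bigr (fun v : 'I_n => (if v == u then \sum_(w < n) (if (u < w)%N then F u w else 0) else 0)
   + (if (v < u)%N then F u v else 0))); last first.
  move=> v _; rewrite big_split/=; congr (_ + _).
    by case: eqP => // _; rewrite big1.
  by rewrite -big_mkcond big_pred1_eq.
rewrite big_split/= -big_mkcond big_pred1_eq -big_split/= [RHS]big_mkcond.
apply: eq_bigr => v _; rewrite -val_eqE.
by case: (ltngtP u v) => /= _; rewrite ?addr0 ?add0r.
Qed.

Section Degrees.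
Context {R : realType} {n : nat}.
Notation I := 'I_n.+1.
Variable p : I -> I -> R.
Hypotheses (p01 : forall u v, 0 <= p u v <= 1) (pS : forall u v, p u v = p v u).

(** The loop term [p u u] is included although the graph has no loops: the sum then factors exactly
    as the weight of u times m of its label, at an error of at most 1. *)
Definition mean_deg u : R := \sum_v p u v.

Let wt0 : forall e b, 0 <= edge_wt p e b. Proof. exact: edge_wt_ge0. Qed.
Let wt1 : forall e, \sum_b edge_wt p e b = 1. Proof. exact: edge_wt1. Qed.

Lemma degreeE (g : graph n.+1) u :
  (degree g u)%:R = \sum_(e | incident u e) (g e)%:R :> R.
Proof.
rewrite /degree -sum1_card natr_sum big_mkcond/=.
rewrite (eq_bigr (fun e => (adj g (val e).1 (val e).2)%:R)) => [|e _]; last by rewrite adj_upair.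
rewrite (sum_incident (F := fun v w => (adj g v w)%:R)) => [|v w]; last by rewrite adj_sym.
rewrite [RHS]big_mkcond; apply: eq_bigr => v _; rewrite inE.
have [->|_] := eqVneq v u; first by rewrite adj_irrefl.
by case: (adj g u v).
Qed.

Lemma incident_prob u : \sum_(e | incident u e) p (val e).1 (val e).2 = mean_deg u - p u u.
Proof. by rewrite sum_incident// /mean_deg [in RHS](bigD1 u)//= [RHS]addrAC subrr add0r. Qed.

(** Chernoff with parameter 1, using 1/e <= 1/2. The summand 1/2 pays for the loop term in
    [mean_deg]. *)
Lemma degree_tail u :
  pE (edge_wt p) (fun g => ((degree g u)%:R < mean_deg u / 4)%R%:R)
  <= expR (1 / 2 - mean_deg u / 4).
Proof.
set a := mean_deg u.
apply: le_trans (_ : pE (edge_wt p) (fun g => expR (a / 4) *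
    \prod_e (if incident u e then expR (- (g e)%:R) else 1)) <= _).
  apply: le_pE => // g.
  rewrite -big_mkcond -expR_sum -expRD sumrN -degreeE.
  case: ltP => h; last exact: expR_ge0.
  by rewrite -[true%:R]/(1 : R); apply: le_trans (expR_ge1Dx _); lra.
rewrite pEZ (pE_prod _ (fun e (b : bool) => if incident u e then expR (- b%:R) else 1)).
apply: le_trans (_ : expR (a / 4) * \prod_e
    (if incident u e then expR (- (p (val e).1 (val e).2 / 2)) else 1) <= _).
  rewrite ler_wpM2l ?expR_ge0//; apply: ler_prod => e _.
  have /andP[q0 q1] := p01 (val e).1 (val e).2.
  case: ifP => _; rewrite big_bool /edge_wt/=; last by rewrite !mulr1 addrC subrK ler01 lexx.
  rewrite oppr0 expR0 mulr1 addr_ge0 ?mulr_ge0 ?expR_ge0 ?subr_ge0//=.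
  apply: le_trans (expR_ge1Dx _).
  have e1 : expR (-1) <= 1 / 2 :> R.
    rewrite expRN div1r lef_pV2 ?posrE ?expR_gt0//.
    by apply: le_trans (expR_ge1Dx 1); lra.
  have : p (val e).1 (val e).2 * expR (-1) <= p (val e).1 (val e).2 * (1 / 2) by rewrite ler_wpM2l.
  lra.
rewrite -big_mkcond -expR_sum -expRD ler_expR sumrN -mulr_suml incident_prob -/a.
have /andP[_ h] := p01 u u; lra.
Qed.

Lemma centered_sq (c : upair n.+1 -> R) :
  pE (edge_wt p) (fun g => (\sum_e c e * ((g e)%:R - p (val e).1 (val e).2)) ^+ 2)
  = \sum_e c e ^+ 2 * (p (val e).1 (val e).2 * (1 - p (val e).1 (val e).2)).
Proof.
pose x e (b : bool) : R := c e * (b%:R - p (val e).1 (val e).2).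
rewrite (@eq_pE _ _ _ _ _ (fun g => \sum_e \sum_f x e (g e) * x f (g f))); last first.
  by move=> g; rewrite expr2 mulr_suml; apply: eq_bigr => e _; rewrite mulr_sumr.
have x1 e : \sum_b edge_wt p e b * x e b = 0.
  by rewrite big_bool /edge_wt /x/=; ring.
rewrite pE_sum; apply: eq_bigr => e _; rewrite pE_sum (bigD1 e)//= big1 ?addr0 => [|f fe].
  rewrite (@pE_coord _ _ _ (edge_wt p) wt1 e (fun b => x e b * x e b)).
  by rewrite big_bool /edge_wt /x/=; ring.
rewrite (@pE_indep _ _ _ (edge_wt p) wt1 e (x e) (fun g => x f (g f))) ?x1 ?mul0r// => w a.
by rewrite ffunE (negPf fe).
Qed.

(** The degree minus [mean_deg] is a centred sum minus [p u u]; the factor 2 and the summand 2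
    absorb this shift. *)
Lemma degree_second_moment u :
  pE (edge_wt p) (fun g => ((degree g u)%:R - mean_deg u) ^+ 2) <= 2 * mean_deg u + 2.
Proof.
pose c (e : upair n.+1) : R := (incident u e)%:R.
have dE g : (degree g u)%:R - mean_deg u =
    \sum_e c e * ((g e)%:R - p (val e).1 (val e).2) - p u u.
  have -> : \sum_e c e * ((g e)%:R - p (val e).1 (val e).2)
     = \sum_(e | incident u e) ((g e)%:R - p (val e).1 (val e).2).
    rewrite [RHS]big_mkcond; apply: eq_bigr => e _.
    by rewrite /c; case: ifP => _; rewrite ?mul1r ?mul0r.
  rewrite sumrB -degreeE incident_prob; ring.
have /andP[q0 q1] := p01 u u.
apply: le_trans (_ : pE (edge_wt p) (fun g => 2 *
   (\sum_e c e * ((g e)%:R - p (val e).1 (val e).2)) ^+ 2 + 2) <= _).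
  apply: le_pE => // g; rewrite dE; set x := \sum_e _.
  have := sqr_ge0 (x + p u u); have : p u u ^+ 2 <= 1 by rewrite exprn_ile1.
  rewrite !expr2; nra.
rewrite pED pE_cst// pEZ centered_sq lerD2r ler_wpM2l//.
apply: le_trans (_ : \sum_(e | incident u e) p (val e).1 (val e).2 <= _).
  rewrite [leRHS]big_mkcond ler_sum// => e _; rewrite /c.
  have /andP[r0 r1] := p01 (val e).1 (val e).2.
  case: ifP => _; last by rewrite expr0n mul0r.
  by rewrite expr1n mul1r ler_piMr// lerBlDr lerDl.
by rewrite incident_prob lerBlDr lerDl.
Qed.

Lemma degree_mean_le u : pE (edge_wt p) (fun g => (degree g u)%:R) <= mean_deg u.
Proof.
rewrite (@eq_pE _ _ _ _ _ (fun g : graph n.+1 => \sum_(e | incident u e) (g e)%:R)); last first.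
  by move=> g; rewrite degreeE.
rewrite pE_sum (eq_bigr (fun e => p (val e).1 (val e).2)) => [|e _].
  by rewrite incident_prob lerBlDr lerDl; have /andP[] := p01 u u.
rewrite (@pE_coord _ _ _ (edge_wt p) wt1 e (fun b => b%:R)).
by rewrite big_bool /edge_wt/= mulr1 mulr0 addr0.
Qed.
End Degrees.

(** * The normalized adjacency matrix against its block-constant model *)

Section NormalizedNoise.
Context {R : realType} {n : nat}.
Notation I := 'I_n.+1.
Variables (p : I -> I -> R) (a : I -> R) (D : R) (g : graph n.+1) (P : 'M[R]_n.+1).
Variables (s Pc zeta : R).
Hypotheses (a0 : forall u, 0 < a u) (pS : forall u v, p u v = p v u).
Let c u v := D / (a u * a v).
Hypothesis PE : forall u v, P u v = c u v * p u v.
Hypotheses (P_le : forall u v, `|P u v| <= Pc / n.+1%:R) (Pc0 : 0 <= Pc).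
Hypothesis deg_ge : forall u, a u / 4 <= (degree g u)%:R.
Hypotheses (zeta0 : 0 <= zeta)
  (dev : \sum_u (((degree g u)%:R - a u) / a u) ^+ 2 <= n.+1%:R * zeta).
Hypotheses (s0 : 0 <= s)
  (upper : forall x, nrm (x *m upper_noise p c g) <= s * nrm x).

Let d u : R := (degree g u)%:R.
Let d0 u : 0 < d u.
Proof. by apply: lt_le_trans (deg_ge u); rewrite divr_gt0. Qed.
Let Dl : 'rV[R]_n.+1 := \row_u (a u / d u).
Let dl : 'rV[R]_n.+1 := \row_u (a u / d u - 1).
Let V := upper_noise p c g.
Let Pd : 'rV[R]_n.+1 := \row_u P u u.

(** Normalizing by expected degrees first confines the random degrees to the diagonal factors [Dl].
    The middle matrix is noise plus model, without the diagonal of the model. *)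
Lemma normalized_adj_factor :
  D *: normalized_adj R g = diag_mx Dl *m (V + V^T + (P - diag_mx Pd)) *m diag_mx Dl.
Proof.
have cS u v : c u v = c v u by rewrite /c [a u * _]mulrC.
have E u v : (V + V^T + (P - diag_mx Pd)) u v = c u v * (adj g u v)%:R.
  rewrite !mxE; case: (ltngtP u v) => [uv|vu|/val_inj->].
  - by rewrite -val_eqE (ltn_eqF uv) mulr0n PE; ring.
  - by rewrite -val_eqE (gtn_eqF vu) mulr0n PE (cS v) (pS v) adj_sym; ring.
  - by rewrite eqxx mulr1n adj_irrefl subrr !addr0 mulr0.
apply/matrixP => u v; rewrite mul_mx_diag mxE mul_diag_mx mxE E !mxE /c.
have := d0 u; have := d0 v; have := a0 u; have := a0 v; rewrite /d.
case: (adj g u v) => h1 h2 h3 h4 /=; last by rewrite !mulr0 mul0r.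
by rewrite -[true%:R]/(1 : R); field; rewrite !gt_eqF.
Qed.

Lemma Dl_le u : `|Dl 0 u| <= 4.
Proof.
rewrite mxE ger0_norm ?divr_ge0 ?(ltW (a0 u)) ?(ltW (d0 u))//.
rewrite ler_pdivrMr//; have := deg_ge u; rewrite /d; lra.
Qed.

Lemma dl_sq : \sum_u dl 0 u ^+ 2 <= 16 * (n.+1%:R * zeta).
Proof.
apply: le_trans (_ : \sum_u 16 * ((d u - a u) / a u) ^+ 2 <= _); last first.
  by rewrite -mulr_sumr ler_wpM2l.
apply: ler_sum => u _; rewrite mxE.
have -> : a u / d u - 1 = (a u / d u) * (- ((d u - a u) / a u)).
  by field; rewrite !gt_eqF ?d0 ?a0.
rewrite exprMn sqrrN ler_wpM2r ?sqr_ge0//.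
have := Dl_le u; rewrite mxE => h.
rewrite -[leLHS]real_normK ?num_real//.
have -> : 16 = 4 ^+ 2 :> R by ring.
by rewrite lerXn2r ?nnegrE.
Qed.

(** As the entries of P are at most Pc/n, the square sum of [dl] alone controls the norm: no uniform
    bound on the relative errors of degrees is used. *)
Lemma frob_dlP : frob (diag_mx dl *m P) <= 4 * Pc * Num.sqrt zeta.
Proof.
rewrite -(@ler_pXn2r _ 2) ?nnegrE ?frob_ge0 ?mulr_ge0 ?sqrtr_ge0//.
rewrite sqr_frob !exprMn sqr_sqrtr//.
apply: le_trans (_ : \sum_u dl 0 u ^+ 2 * (n.+1%:R * (Pc / n.+1%:R) ^+ 2) <= _).
  apply: ler_sum => u _.
  apply: le_trans (_ : \sum_(v < n.+1) dl 0 u ^+ 2 * (Pc / n.+1%:R) ^+ 2 <= _).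
    apply: ler_sum => v _; rewrite mul_diag_mx mxE exprMn ler_wpM2l ?sqr_ge0//.
    by rewrite -[leLHS]real_normK ?num_real// lerXn2r ?nnegrE ?divr_ge0.
  by rewrite sumr_const card_ord -[leLHS]mulr_natl mulrCA.
rewrite -mulr_suml.
apply: le_trans (_ : 16 * (n.+1%:R * zeta) * (n.+1%:R * (Pc / n.+1%:R) ^+ 2) <= _).
  by rewrite ler_wpM2r ?dl_sq// mulr_ge0 ?sqr_ge0.
rewrite le_eqVlt; apply/orP; left; apply/eqP.
by field; rewrite gt_eqF.
Qed.

(** Each triangular half of the noise, and the diagonal, is multiplied by [Dl] on both sides, of
    norm at most 4 each. In the model term [Dl] is replaced by the identity on the left, then on the
    right, at costs 16 and 4. *)
Lemma normalized_noise_bound x : P^T = P ->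
  nrm (x *m (D *: normalized_adj R g - P))
  <= (32 * s + 16 * (Pc / n.+1%:R) + 20 * Pc * Num.sqrt zeta) * nrm x.
Proof.
move=> PT; rewrite normalized_adj_factor.
have DE : diag_mx Dl = 1%:M + diag_mx dl.
  apply/matrixP => u v; rewrite !mxE; case: eqP => _; rewrite ?mulr0n ?addr0//.
  by rewrite !mulr1n addrC subrK.
have E : diag_mx Dl *m (V + V^T + (P - diag_mx Pd)) *m diag_mx Dl - P =
  diag_mx Dl *m V *m diag_mx Dl + diag_mx Dl *m V^T *m diag_mx Dl
  - diag_mx Dl *m diag_mx Pd *m diag_mx Dl
  + diag_mx dl *m P *m diag_mx Dl + P *m diag_mx dl.
  have hP : diag_mx Dl *m P *m diag_mx Dl = P + P *m diag_mx dl + diag_mx dl *m P *m diag_mx Dl.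
    rewrite {1}DE mulmxDl mul1mx mulmxDl; congr (_ + _).
    by rewrite DE mulmxDr mulmx1.
  rewrite !mulmxDr !mulmxDl mulmxN mulNmx hP.
  move: (diag_mx Dl *m V *m diag_mx Dl) (diag_mx Dl *m V^T *m diag_mx Dl)
    (diag_mx Dl *m diag_mx Pd *m diag_mx Dl) (diag_mx dl *m P *m diag_mx Dl)
    (P *m diag_mx dl) => A1 A2 A3 A4 A5.
  by apply/matrixP => i j; rewrite !mxE; ring.
have zs := sqrtr_ge0 zeta.
have bD y : nrm (y *m diag_mx Dl) <= 4 * nrm y by apply: nrm_mulmx_diag_le => //; exact: Dl_le.
have b1 : nrm (x *m (diag_mx Dl *m V *m diag_mx Dl)) <= 16 * s * nrm x.
  rewrite !mulmxA; apply: le_trans (bD _) _.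
  have h1 : nrm (x *m diag_mx Dl *m V) <= s * nrm (x *m diag_mx Dl) := upper _.
  have h2 : s * nrm (x *m diag_mx Dl) <= s * (4 * nrm x) by rewrite ler_wpM2l.
  move: h1 h2; lra.
have b2 : nrm (x *m (diag_mx Dl *m V^T *m diag_mx Dl)) <= 16 * s * nrm x.
  rewrite !mulmxA; apply: le_trans (bD _) _.
  have h1 : nrm (x *m diag_mx Dl *m V^T) <= s * nrm (x *m diag_mx Dl) := nrm_mulmx_tr s0 upper _.
  have h2 : s * nrm (x *m diag_mx Dl) <= s * (4 * nrm x) by rewrite ler_wpM2l.
  move: h1 h2; lra.
have PcN : 0 <= Pc / n.+1%:R by rewrite divr_ge0.
have b3 : nrm (x *m (diag_mx Dl *m diag_mx Pd *m diag_mx Dl)) <= 16 * (Pc / n.+1%:R) * nrm x.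
  rewrite !mulmxA; apply: le_trans (bD _) _.
  have : nrm (x *m diag_mx Dl *m diag_mx Pd) <= Pc / n.+1%:R * nrm (x *m diag_mx Dl).
    by apply: nrm_mulmx_diag_le => // i; rewrite mxE.
  have : Pc / n.+1%:R * nrm (x *m diag_mx Dl) <= Pc / n.+1%:R * (4 * nrm x).
    by rewrite ler_wpM2l.
  set q := Pc / _; lra.
have f0 := frob_dlP.
have b4 : nrm (x *m (diag_mx dl *m P *m diag_mx Dl)) <= 16 * Pc * Num.sqrt zeta * nrm x.
  rewrite mulmxA; apply: le_trans (bD _) _.
  have := nrm_mulmx_frob x (diag_mx dl *m P).
  have : frob (diag_mx dl *m P) * nrm x <= 4 * Pc * Num.sqrt zeta * nrm x.
    by rewrite ler_wpM2r ?nrm_ge0.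
  lra.
have b5 : nrm (x *m (P *m diag_mx dl)) <= 4 * Pc * Num.sqrt zeta * nrm x.
  apply: le_trans (nrm_mulmx_frob _ _) _; rewrite ler_wpM2r ?nrm_ge0//.
  by rewrite -frob_trmx trmx_mul tr_diag_mx PT.
rewrite E !mulmxDr mulmxN.
apply: le_trans (nrmD _ _) _; apply: le_trans (lerD (nrmD _ _) (lexx _)) _.
apply: le_trans (lerD (lerD (nrmB _ _) (lexx _)) (lexx _)) _.
apply: le_trans (lerD (lerD (lerD (nrmD _ _) (lexx _)) (lexx _)) (lexx _)) _.
set q := Pc / n.+1%:R in b3 *; move: b1 b2 b3 b4 b5; rewrite -/V; lra.
Qed.
End NormalizedNoise.

Section NoiseProbability.
Context {R : realType} {n : nat}.
Notation I := 'I_n.+1.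
Variables (p c : I -> I -> R) (Lc : R).
Hypothesis p01 : forall u v, 0 <= p u v <= 1.

(** The factor 2 comes from k <= 2 log n; e^6 is e^4, from the exponential cost of thinning, times a
    margin e^2 for Markov's inequality. *)
Definition noise_sq : R := 2 * Lc ^+ 2 * @rm_const R * expR 6.

(** Markov's inequality for the trace of order k between log n and 2 log n: the margin gives e^(-2k)
    <= n^-2, which beats the prefactor 2 theta n. *)
Lemma upper_noise_prob (l := ln n.+1%:R : R) : 1 <= l -> 1 <= Lc ->
  (forall u v, `|c u v| <= Lc / l) ->
  (forall u v, c u v ^+ 2 * p u v <= Lc / l / n.+1%:R) ->
  exists2 k, (0 < k)%N &
  pE (edge_wt p) (fun g => (Num.sqrt (noise_sq / l) ^+ k.*2
     < \tr ((upper_noise p c g *m (upper_noise p c g)^T) ^+ k))%R%:R) <= 2 * Lc / n.+1%:R.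
Proof.
move=> l1 L1 hc hv.
have n0 : 0 < n.+1%:R :> R by rewrite ltr0n.
have l0 : 0 < l by rewrite (lt_le_trans ltr01).
have L0 : 0 < Lc by rewrite (lt_le_trans ltr01).
have el : expR l = n.+1%:R by rewrite lnK// posrE.
have ln_le : l <= n.+1%:R by rewrite -el; apply: le_trans (expR_ge1Dx _); lra.
pose th := Lc / l; have th0 : 0 < th by rewrite divr_gt0.
have thN1 : 1 <= th * n.+1%:R.
  rewrite /th mulrAC ler_pdivlMr// mul1r; apply: le_trans ln_le _.
  by rewrite ler_peMl// ltW.
(* This choice makes the variance bound theta/n equal to theta^2 rho, and rho n = log n / Lc is at
   most k. *)
pose rho := (th * n.+1%:R)^-1.
have rho0 : 0 < rho by rewrite invr_gt0 mulr_gt0.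
have rho1 : rho <= 1 by rewrite /rho invf_le1 // mulr_gt0.
have [k [k0 kl k2l]] : exists k, [/\ (0 < k)%N, l <= k%:R & k%:R <= 2 * l].
  exists (Num.truncn l).+1; have /andP[k2 k1] := truncn_itv (ltW l0).
  by split; rewrite ?(ltW k1)// -natr1; lra.
exists k => //.
set T := fun g => \tr ((upper_noise p c g *m (upper_noise p c g)^T) ^+ k).
have C0 : 0 < @rm_const R := rm_const_gt0.
have L20 : 0 < Lc ^+ 2 by rewrite exprn_gt0.
have t0 : 0 < noise_sq / l.
  apply: divr_gt0 => //; apply: mulr_gt0 (expR_gt0 6); apply: mulr_gt0 C0.
  by apply: mulr_gt0.
have tE : Num.sqrt (noise_sq / l) ^+ k.*2 = (noise_sq / l) ^+ k.
  by rewrite -mul2n exprM sqr_sqrtr// ltW.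
have w0 : 0 <= 2 * th * n.+1%:R.
  by apply: mulr_ge0 (ler0n _ _); apply: mulr_ge0 (ltW th0).
have E1 : pE (edge_wt p) T <= 2 * th * n.+1%:R * (th ^+ 2 * @rm_const R * k%:R * expR 4) ^+ k.
  apply: le_trans (upper_noise_trace p01 (ltW th0) rho0 rho1 hc _ k0) _.
    move=> u v; apply: le_trans (hv u v) _; rewrite le_eqVlt; apply/orP; left; apply/eqP.
    by rewrite /rho -/th; field; rewrite !gt_eqF.
  have -> : th ^+ k.*2 / rho * (2 * (@rm_const R * k%:R) ^+ k * expR (4 * rho * n.+1%:R))
    = 2 * th * n.+1%:R * ((th ^+ 2) ^+ k * (@rm_const R * k%:R) ^+ k * expR (4 * rho * n.+1%:R)).
    rewrite -mul2n exprM /rho invrK.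
    move: ((th ^+ 2) ^+ k) ((@rm_const R * k%:R) ^+ k) (expR _) => A1 A2 A3; ring.
  rewrite ler_wpM2l//.
  apply: le_trans (_ : (th ^+ 2) ^+ k * ((@rm_const R * k%:R) ^+ k * expR 4 ^+ k) <= _); last first.
    by rewrite -!exprMn !mulrA.
  rewrite -[leLHS]mulrA; apply: ler_wpM2l; first by rewrite exprn_ge0// sqr_ge0.
  apply: ler_wpM2l; first by rewrite exprn_ge0// mulr_ge0// ltW.
  rewrite -expRM_natr ler_expR -(mulrA 4).
  have -> : rho * n.+1%:R = l / Lc by rewrite /rho /th; field; rewrite !gt_eqF.
  rewrite ler_wpM2l//; apply: le_trans kl.
  by rewrite ler_pdivrMr// ler_peMr// ltW.
have E2 : th ^+ 2 * @rm_const R * k%:R * expR 4 <= noise_sq / l * expR (-2).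
  have e6 : expR 4 = expR 6 * expR (-2) :> R by rewrite -expRD; congr expR; ring.
  rewrite e6 mulrA ler_wpM2r ?expR_ge0// /noise_sq.
  have -> : 2 * Lc ^+ 2 * @rm_const R * expR 6 / l = th ^+ 2 * @rm_const R * (2 * l) * expR 6.
    by rewrite /th; field; rewrite gt_eqF.
  rewrite ler_wpM2r ?expR_ge0// ler_wpM2l//.
  exact: mulr_ge0 (sqr_ge0 _) (ltW C0).
have T0 g : 0 <= T g.
  have [Q [d [QQ E d0]]] := gram_spectral (upper_noise p c g).
  by rewrite /T E trace_expr_spectral// sumr_ge0// => i _; rewrite exprn_ge0.
apply: le_trans (markov (edge_wt_ge0 p01) (exprn_gt0 k t0) T0 _) _.
  by move=> g; rewrite tE => /ltW.
rewrite ler_pdivrMr ?exprn_gt0//; apply: le_trans E1 _.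
apply: le_trans (_ : 2 * th * n.+1%:R * (noise_sq / l * expR (-2)) ^+ k <= _).
  rewrite ler_wpM2l// lerXn2r ?nnegrE//.
    apply: mulr_ge0 (expR_ge0 _); apply: mulr_ge0 (ler0n _ _).
    by apply: mulr_ge0 (sqr_ge0 _) (ltW C0).
  exact: mulr_ge0 (ltW t0) (expR_ge0 _).
rewrite exprMn mulrCA mulrC [leRHS]mulrC [leRHS]mulrC ler_wpM2r ?exprn_ge0 ?(ltW t0)//.
have e2 : expR (-2) ^+ k <= (n.+1%:R ^+ 2)^-1 :> R.
  rewrite -expRM_natr -el -expRM_natl -expRN ler_expR; move: kl; lra.
apply: le_trans (_ : 2 * th * n.+1%:R * (n.+1%:R ^+ 2)^-1 <= _).
  by rewrite ler_wpM2l.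
have -> : 2 * th * n.+1%:R * (n.+1%:R ^+ 2)^-1 = 2 * th / n.+1%:R by field; rewrite gt_eqF.
by rewrite ler_wpM2r ?invr_ge0// ler_wpM2l// ler_pdivrMr// ler_peMr// (ltW L0).
Qed.
End NoiseProbability.

(** * The sampled pairs *)

Section Sampling.
Context {R : realType} {n K t : nat}.
Variables (sigma : 'I_n -> 'I_K) (alpha : 'I_K -> R) (near : pred 'I_n) (beta : R).
Hypothesis n0 : (0 < n)%N.
Hypothesis class_size : forall k, #|[pred u | sigma u == k]|%:R = alpha k * n%:R.
Hypothesis few : #|[pred u | ~~ near u]|%:R <= beta * n%:R.

Definition unif_wt (_ : 'I_t) (_ : 'I_n * 'I_n) : R := (n%:R ^+ 2)^-1.

Let n0R : 0 < n%:R :> R. Proof. by rewrite ltr0n. Qed.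

Lemma unif_wt_ge0 j x : 0 <= unif_wt j x.
Proof. by rewrite invr_ge0 exprn_ge0. Qed.

Lemma unif_wt1 j : \sum_x unif_wt j x = 1.
Proof.
rewrite sumr_const card_prod !card_ord -[LHS]mulr_natl natrM /unif_wt.
by rewrite -expr2 divff// gt_eqF// exprn_gt0.
Qed.

Lemma unif_prod (f h : 'I_n -> R) j :
  \sum_x unif_wt j x * (f x.1 * h x.2) = (\sum_u f u / n%:R) * (\sum_u h u / n%:R).
Proof.
rewrite -(pair_bigA _ (fun u v => unif_wt j (u, v) * (f u * h v)))/= mulr_suml.
apply: eq_bigr => u _; rewrite mulr_sumr; apply: eq_bigr => v _.
by rewrite /unif_wt; field; rewrite gt_eqF.
Qed.

Lemma sum_indicator (b : pred 'I_n) : \sum_u (b u)%:R / n%:R = #|[pred u | b u]|%:R / n%:R :> R.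
Proof.
rewrite -mulr_suml; congr (_ / _); rewrite -sum1_card natr_sum [RHS]big_mkcond.
by apply: eq_bigr => u _; rewrite inE; case: (b u).
Qed.

Definition good_sample (w : pair_sample n t) : bool :=
  [forall j, near (w j).1 && near (w j).2]
  && [forall a, forall b, exists j, (sigma (w j).1 == a) && (sigma (w j).2 == b)].

(** A union bound over the 2t sampled vertices that might be far, and over the ordered pairs of
    communities that all t samples might miss. *)
Lemma good_sample_prob :
  pE unif_wt (fun w => (~~ good_sample w)%:R)
  <= 2 * t%:R * beta + \sum_a \sum_b (1 - alpha a * alpha b) ^+ t.
Proof.
pose F1 (x : 'I_n * 'I_n) : R := (~~ near x.1)%:R * 1.
pose F2 (x : 'I_n * 'I_n) : R := 1 * (~~ near x.2)%:R.
pose F3 a b (x : 'I_n * 'I_n) : R := 1 - (sigma x.1 == a)%:R * (sigma x.2 == b)%:R.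
have F30 a b x : 0 <= F3 a b x.
  by rewrite /F3; case: (_ == a); case: (_ == b); rewrite ?mulr1 ?mulr0 ?subr0 ?subrr.
have n1 : \sum_(u < n) (1 : R) / n%:R = 1.
  by rewrite sumr_const card_ord -[LHS]mulr_natl mul1r divff// gt_eqF.
apply: le_trans (_ : pE unif_wt (fun w => (\sum_j F1 (w j) + \sum_j F2 (w j))
    + \sum_a \sum_b \prod_j F3 a b (w j)) <= _).
  apply: le_pE => [|w]; first exact: unif_wt_ge0.
  have s1 : 0 <= \sum_j F1 (w j) by apply: sumr_ge0 => j _; rewrite mulr_ge0.
  have s2 : 0 <= \sum_j F2 (w j) by apply: sumr_ge0 => j _; rewrite mulr_ge0.
  have s3 : 0 <= \sum_a \sum_b \prod_j F3 a b (w j).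
    by do 2!apply: sumr_ge0 => ? _; apply: prodr_ge0.
  have [//|/nandP[]] := boolP (good_sample w); first by rewrite !addr_ge0.
    rewrite negb_forall => /existsP[j]; rewrite negb_and -[true%:R]/(1 : R) => /orP[h|h].
      have : 1 <= \sum_j F1 (w j); last by lra.
      by rewrite (bigD1 j)//= /F1 h mulr1 lerDl sumr_ge0// => i _; rewrite mulr_ge0.
    have : 1 <= \sum_j F2 (w j); last by lra.
    by rewrite (bigD1 j)//= /F2 h mulr1 lerDl sumr_ge0// => i _; rewrite mulr_ge0.
  rewrite negb_forall => /existsP[a]; rewrite negb_forall => /existsP[b].
  rewrite negb_exists => /forallP h; rewrite -[true%:R]/(1 : R).
  have : 1 <= \sum_a \sum_b \prod_j F3 a b (w j); last by lra.
  rewrite (bigD1 a)//= (bigD1 b)//= [\prod_j _]big1 => [|j _].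
    rewrite -addrA lerDl addr_ge0// sumr_ge0// => ? _; first exact: prodr_ge0.
    by apply: sumr_ge0 => ? _; apply: prodr_ge0.
  by have := h j; rewrite /F3; case: (_ == a); case: (_ == b) => //=; rewrite ?mulr0 ?mul0r ?subr0.
have few' : #|[pred u | ~~ near u]|%:R / n%:R <= beta by rewrite ler_pdivrMr.
rewrite !pED; apply: lerD.
  have -> : 2 * t%:R * beta = \sum_(j < t) beta + \sum_(j < t) beta.
    have -> : \sum_(j < t) beta = t%:R * beta by rewrite sumr_const card_ord mulr_natl.
    ring.
  apply: lerD; rewrite pE_sum ler_sum// => j _.
    rewrite (pE_coord unif_wt1 j F1) (unif_prod (fun u => (~~ near u)%:R) (fun=> 1)).
    by rewrite n1 mulr1 (sum_indicator (fun u => ~~ near u)).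
  rewrite (pE_coord unif_wt1 j F2) (unif_prod (fun=> 1) (fun u => (~~ near u)%:R)).
  by rewrite n1 mul1r (sum_indicator (fun u => ~~ near u)).
rewrite pE_sum ler_sum// => a _; rewrite pE_sum ler_sum// => b _.
rewrite (pE_prod _ (fun _ => F3 a b)).
rewrite (eq_bigr (fun=> 1 - alpha a * alpha b)) => [|j _].
  by rewrite prodr_const card_ord.
rewrite /F3; under eq_bigr do rewrite mulrBr mulr1.
rewrite sumrB unif_wt1 (unif_prod (fun u => (sigma u == a)%:R) (fun v => (sigma v == b)%:R)).
rewrite !sum_indicator !class_size; congr (_ - _).
by field; rewrite gt_eqF.
Qed.

Lemma power_tail (y : R) : 0 < y -> y <= 1 -> (1 - y) ^+ t <= (1 + t%:R * y)^-1.
Proof.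
move=> y0 y1; apply: le_trans (_ : expR (- y) ^+ t <= _).
  by rewrite lerXn2r ?nnegrE ?subr_ge0 ?expR_ge0// expR_ge1Dx.
rewrite -expRM_natl mulrN expRN lef_pV2 ?posrE ?expR_gt0 ?expR_ge1Dx//.
by rewrite ltr_wpDr// mulr_ge0// ltW.
Qed.
End Sampling.

(** * The good event *)

Section GoodGraph.
Context {R : realType} {n K : nat}.
Notation I := 'I_n.+1.
Variables (B : 'M[R]_K) (sigma : I -> 'I_K) (w : I -> R).
Hypotheses (BT : B^T = B) (B0 : forall i j, 0 <= B i j).

Let total := \sum_u w u.
Let D := total / n.+1%:R.
Let m i := (\sum_u w u * B i (sigma u)) / total.
Let p u v := w u * w v / (n.+1%:R * D) * B (sigma u) (sigma v).
Let l := ln n.+1%:R : R.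

Variables (w0 Mlo Mhi Bmax kappa delta : R).
Hypotheses (w00 : 0 < w0) (w_ge : forall u, w0 <= w u).
Hypotheses (Mlo0 : 0 < Mlo) (m_ge : forall i, Mlo <= m i) (m_le : forall i, m i <= Mhi).
Hypotheses (B_le : forall i j, B i j <= Bmax) (p_le1 : forall u v, p u v <= 1).
Hypotheses (kappa0 : 0 <= kappa) (delta0 : 0 < delta) (l1 : 1 <= l).
Hypothesis w0_log : 8 * l <= w0 * Mlo.
Hypothesis w0_sq : D * l <= kappa * w0 ^+ 2.

Let wp u : 0 < w u. Proof. exact: lt_le_trans (w_ge u). Qed.
Let total0 : 0 < total.
Proof. by rewrite /total (bigD1 ord0)//= ltr_wpDr// sumr_ge0// => u _; rewrite ltW. Qed.
Let D0 : 0 < D. Proof. by rewrite divr_gt0. Qed.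
Let l0 : 0 < l. Proof. exact: lt_le_trans l1. Qed.
Let mp i : 0 < m i. Proof. exact: lt_le_trans (m_ge i). Qed.

Let nD : n.+1%:R * D = total.
Proof. by rewrite /D mulrC divfK// gt_eqF. Qed.

Let pS u v : p u v = p v u.
Proof. by rewrite /p (mulrC (w u)) -{2}BT mxE. Qed.

Let p01 u v : 0 <= p u v <= 1.
Proof.
rewrite p_le1 andbT /p nD mulr_ge0// divr_ge0 ?(ltW total0)//.
by rewrite mulr_ge0// ltW.
Qed.

Let a u := mean_deg p u.

Let aE u : a u = w u * m (sigma u).
Proof.
rewrite /a /mean_deg /m mulrA mulr_sumr mulr_suml; apply: eq_bigr => v _.
by rewrite /p nD; ring.
Qed.

Let a_ge u : 8 * l <= a u.
Proof. by rewrite aE; apply: le_trans w0_log _; rewrite ler_pM// ltW. Qed.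

Let a0 u : 0 < a u. Proof. by apply: lt_le_trans (a_ge u); rewrite mulr_gt0. Qed.

Let ln_le : l <= n.+1%:R.
Proof.
have el : expR l = n.+1%:R by rewrite lnK// posrE.
by rewrite -el; apply: le_trans (expR_ge1Dx _); lra.
Qed.

Definition core_bound : R := Bmax / Mlo ^+ 2.
(** The summand 1 ensures [noise_scale >= 1]; the second bounds the noise entries and the third
    their variances, both through hypothesis (iv) with constant [kappa]. *)
Definition noise_scale : R := 1 + kappa / Mlo ^+ 2 + kappa * Bmax / Mlo ^+ 4.
Definition eta_const : R := 32 * Num.sqrt (noise_sq noise_scale) + 16 * core_bound
  + 20 * core_bound * Num.sqrt ((2 * delta)^-1).

Let Bmax0 : 0 <= Bmax. Proof. exact: le_trans (B0 (sigma ord0) (sigma ord0)) (B_le _ _). Qed.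
Let Pc0 : 0 <= core_bound. Proof. by rewrite divr_ge0// exprn_ge0// ltW. Qed.
Let e1 : 0 <= kappa / Mlo ^+ 2. Proof. by rewrite divr_ge0// exprn_ge0// ltW. Qed.
Let e2 : 0 <= kappa * Bmax / Mlo ^+ 4.
Proof. by apply: divr_ge0; [rewrite mulr_ge0|rewrite exprn_ge0// ltW]. Qed.
Let Lc1 : 1 <= noise_scale. Proof. by rewrite /noise_scale; have := e1; have := e2; lra. Qed.

Let c u v := D / (a u * a v).

Let c_ge0 u v : 0 <= c u v.
Proof. exact: divr_ge0 (ltW D0) (mulr_ge0 (ltW (a0 u)) (ltW (a0 v))). Qed.

Let cp_ge0 u v : 0 <= c u v * p u v.
Proof. by have /andP[h _] := p01 u v; exact: mulr_ge0 (c_ge0 u v) h. Qed.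

Let aa_gt0 u v : 0 < a u * a v. Proof. exact: mulr_gt0 (a0 u) (a0 v). Qed.

Let aa_ge u v : w0 ^+ 2 * Mlo ^+ 2 <= a u * a v.
Proof.
rewrite -exprMn expr2 !aE.
by apply: ler_pM; rewrite ?mulr_ge0 ?(ltW w00) ?(ltW Mlo0)// ler_pM// ltW.
Qed.

Let c_le u v : `|c u v| <= noise_scale / l.
Proof.
rewrite ger0_norm// /c.
rewrite ler_pdivrMr// mulrAC ler_pdivlMr//.
apply: le_trans w0_sq _.
apply: le_trans (_ : kappa / Mlo ^+ 2 * (w0 ^+ 2 * Mlo ^+ 2) <= _).
  by rewrite le_eqVlt; apply/orP; left; apply/eqP; field; rewrite gt_eqF.
apply: ler_pM => //; first by rewrite mulr_ge0 ?sqr_ge0.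
by rewrite /noise_scale; have := e2; lra.
Qed.

Let P_eq u v : c u v * p u v = B (sigma u) (sigma v) / (n.+1%:R * m (sigma u) * m (sigma v)).
Proof.
rewrite /c /p !aE.
have := wp u; have := wp v; have := mp (sigma u); have := mp (sigma v); have := D0.
by move=> h1 h2 h3 h4 h5; field; rewrite !gt_eqF.
Qed.

Let P_le u v : c u v * p u v <= core_bound / n.+1%:R.
Proof.
rewrite P_eq /core_bound.
have -> : B (sigma u) (sigma v) / (n.+1%:R * m (sigma u) * m (sigma v)) =
   B (sigma u) (sigma v) / (m (sigma u) * m (sigma v)) / n.+1%:R.
  have := mp (sigma u); have := mp (sigma v) => h1 h2.
  by field; rewrite !gt_eqF.
rewrite ler_wpM2r ?invr_ge0//; apply: ler_pM => //.
  by rewrite invr_ge0 mulr_ge0// ltW.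
have mm : Mlo ^+ 2 <= m (sigma u) * m (sigma v).
  by rewrite expr2; apply: ler_pM => //; exact: ltW.
have Mlo2 : 0 < Mlo ^+ 2 by rewrite exprn_gt0.
by rewrite lef_pV2 ?posrE// (lt_le_trans Mlo2).
Qed.

Let var_le u v : c u v ^+ 2 * p u v <= noise_scale / l / n.+1%:R.
Proof.
have -> : c u v ^+ 2 * p u v = c u v * (c u v * p u v) by rewrite expr2 mulrA.
apply: le_trans (_ : (kappa / Mlo ^+ 2 / l) * (core_bound / n.+1%:R) <= _); last first.
  have -> : kappa / Mlo ^+ 2 / l * (core_bound / n.+1%:R) = kappa * Bmax / Mlo ^+ 4 / l / n.+1%:R.
    by rewrite /core_bound; field; rewrite !gt_eqF.
  rewrite ler_wpM2r ?invr_ge0// ler_wpM2r ?invr_ge0 ?(ltW l0)// /noise_scale.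
  by have := e1; lra.
apply: ler_pM; rewrite ?P_le//.
rewrite /c ler_pdivrMr// mulrAC ler_pdivlMr//.
apply: le_trans w0_sq _.
apply: le_trans (_ : kappa / Mlo ^+ 2 * (w0 ^+ 2 * Mlo ^+ 2) <= _).
  by rewrite le_eqVlt; apply/orP; left; apply/eqP; field; rewrite gt_eqF.
by rewrite ler_wpM2l// aa_ge.
Qed.

Let wt0 := edge_wt_ge0 p01.
Let wt1 := @edge_wt1 R n p.

(** An expected degree of at least 8 log n makes each tail at most e^(1/2) n^-2, which a union over
    the vertices can afford. This fixes the constant 8 in the lower bound on weights. *)
Let low_degree_prob :
  pE (edge_wt p) (fun g => [exists u, (degree g u)%:R < a u / 4]%R%:R) <= expR (1 / 2) / n.+1%:R.
Proof.
apply: le_trans (pE_union wt0 (fun u g => (degree g u)%:R < a u / 4)) _.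
apply: le_trans (_ : \sum_(u : I) expR (1 / 2 - 2 * l) <= _).
  apply: ler_sum => u _; apply: le_trans (degree_tail p01 pS u) _.
  by rewrite ler_expR; have := a_ge u; rewrite /a; lra.
rewrite sumr_const card_ord -[leLHS]mulr_natl expRD.
have -> : expR (- (2 * l)) = (n.+1%:R ^+ 2)^-1.
  by rewrite expRN expRM_natl lnK// posrE.
by rewrite le_eqVlt; apply/orP; left; apply/eqP; field; rewrite gt_eqF.
Qed.

(** The mean of [dev] is at most n/(2l), so Markov's inequality at level [n.+1%:R * zeta] leaves
    probability [delta]. *)
Let zeta := (2 * l * delta)^-1.
Let zeta0 : 0 < zeta. Proof. by rewrite invr_gt0 !mulr_gt0. Qed.

Let dev (g : graph n.+1) := \sum_u (((degree g u)%:R - a u) / a u) ^+ 2.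

Let deviation_prob : pE (edge_wt p) (fun g => (n.+1%:R * zeta < dev g)%R%:R) <= delta.
Proof.
apply: le_trans (markov wt0 (t := n.+1%:R * zeta) (F := dev) _ _ _) _.
- by rewrite mulr_gt0.
- by move=> g; apply: sumr_ge0 => u _; rewrite sqr_ge0.
- by move=> g /ltW.
rewrite ler_pdivrMr ?mulr_gt0// /dev pE_sum.
apply: le_trans (_ : \sum_(u : I) (2 * l)^-1 <= _); last first.
  rewrite sumr_const card_ord -[leLHS]mulr_natl /zeta le_eqVlt; apply/orP; left; apply/eqP.
  by field; rewrite !gt_eqF.
apply: ler_sum => u _.
rewrite (@eq_pE _ _ _ _ _ (fun g => (a u ^+ 2)^-1 * ((degree g u)%:R - a u) ^+ 2)); last first.
  by move=> g; rewrite exprMn exprVn mulrC.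
rewrite pEZ mulrC ler_pdivrMr ?exprn_gt0//.
apply: le_trans (degree_second_moment p01 pS u) _.
rewrite -/(a u) ler_pdivlMl ?mulr_gt0//.
have := a_ge u; have := l1 => h1 h2.
rewrite expr2; nra.
Qed.

(** Markov's inequality loses a factor 1/delta. This is harmless: delta is fixed before n grows, and
    f exceeds every constant multiple of 1/sqrt(log n). *)
Let mean_degree_prob : pE (edge_wt p) (fun g => (Mhi / delta * D < mean_degree R g)%R%:R) <= delta.
Proof.
have Mhi0 : 0 < Mhi by apply: lt_le_trans (m_le (sigma ord0)).
have t0 : 0 < Mhi / delta * D := mulr_gt0 (divr_gt0 Mhi0 delta0) D0.
apply: le_trans (markov wt0 (t := Mhi / delta * D) (F := fun g => mean_degree R g) _ _ _) _.
- exact: t0.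
- by move=> g; rewrite divr_ge0// sumr_ge0.
- by move=> g /ltW.
rewrite ler_pdivrMr//.
have -> : delta * (Mhi / delta * D) = Mhi * D by field; rewrite gt_eqF.
rewrite pEZr pE_sum ler_pdivrMr// -mulrA (mulrC D) nD /total mulr_sumr.
apply: ler_sum => u _; apply: le_trans (degree_mean_le p01 pS u) _.
by rewrite -/(a u) aE mulrC ler_wpM2r// ltW.
Qed.

Lemma good_graph_prob : exists good : pred (graph n.+1),
  pE (edge_wt p) (fun g => (~~ good g)%:R)
    <= (expR (1 / 2) + 2 * noise_scale) / n.+1%:R + 2 * delta
  /\ forall g, good g ->
     [/\ Mlo / 4 * D <= mean_degree R g, mean_degree R g <= Mhi / delta * D
       & forall (P : 'M[R]_n.+1) x,
         (forall u v, P u v = B (sigma u) (sigma v) / (n.+1%:R * m (sigma u) * m (sigma v))) ->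
         nrm (x *m (D *: normalized_adj R g - P)) <= eta_const / Num.sqrt l * nrm x].
Proof.
have [k k0 hk] := upper_noise_prob p01 l1 Lc1 c_le var_le.
set tr := Num.sqrt (noise_sq noise_scale / l) in hk.
pose b1 (g : graph n.+1) := [exists u, (degree g u)%:R < a u / 4].
pose b2 (g : graph n.+1) := n.+1%:R * zeta < dev g.
pose b3 (g : graph n.+1) := Mhi / delta * D < mean_degree R g.
pose b4 (g : graph n.+1) := tr ^+ k.*2 < \tr ((upper_noise p c g *m (upper_noise p c g)^T) ^+ k).
exists (fun g => ~~ [|| b1 g, b2 g, b3 g | b4 g]); split.
  apply: le_trans (_ : pE (edge_wt p) (fun g => (b1 g)%:R + (b2 g)%:R + (b3 g)%:R + (b4 g)%:R) <= _).
    apply: le_pE => // g; rewrite negbK -!natrD ler_nat.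
    by case: (b1 g); case: (b2 g); case: (b3 g); case: (b4 g).
  have q1 : pE (edge_wt p) (fun g => (b1 g)%:R) <= expR (1 / 2) / n.+1%:R := low_degree_prob.
  have q2 : pE (edge_wt p) (fun g => (b2 g)%:R) <= delta := deviation_prob.
  have q3 : pE (edge_wt p) (fun g => (b3 g)%:R) <= delta := mean_degree_prob.
  have q4 : pE (edge_wt p) (fun g => (b4 g)%:R) <= 2 * noise_scale / n.+1%:R := hk.
  rewrite !pED mulrDl; apply: le_trans (lerD (lerD (lerD q1 q2) q3) q4) _.
  rewrite le_eqVlt; apply/orP; left; apply/eqP; ring.
move=> g; rewrite !negb_or => /and4P[h1 h2 h3 h4].
have deg u : a u / 4 <= (degree g u)%:R.
  by rewrite leNgt; apply: contra h1 => h; apply/existsP; exists u.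
split.
- rewrite ler_pdivlMr// -[leLHS]mulrA (mulrC D) nD /total mulr_sumr; apply: ler_sum => u _.
  apply: le_trans (deg u); rewrite aE.
  have -> : w u * m (sigma u) / 4 = m (sigma u) / 4 * w u by ring.
  by rewrite ler_wpM2r ?(ltW (wp u))// ler_wpM2r// invr_ge0.
- by rewrite leNgt.
move=> P x PE.
have PE' u v : P u v = c u v * p u v by rewrite PE P_eq.
have PT : P^T = P.
  apply/matrixP => u v; rewrite mxE !PE -{1}BT mxE; congr (_ / _); ring.
have tr0 : 0 <= tr := sqrtr_ge0 _.
have upper y : nrm (y *m upper_noise p c g) <= tr * nrm y.
  by apply: nrm_upper_noise k0 tr0 _; rewrite leNgt.
have Pn u v : `|P u v| <= core_bound / n.+1%:R.
  by rewrite PE' ger0_norm ?P_le.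
have dv : dev g <= n.+1%:R * zeta by rewrite leNgt.
apply: le_trans (normalized_noise_bound a0 pS PE' Pn Pc0 deg (ltW zeta0) dv tr0 upper x PT) _.
rewrite ler_wpM2r ?nrm_ge0//.
have sl0 : 0 < Num.sqrt l by rewrite sqrtr_gt0.
have trE : tr = Num.sqrt (noise_sq noise_scale) / Num.sqrt l.
  rewrite /tr sqrtrM ?sqrtrV ?(ltW l0)//.
  rewrite /noise_sq; apply: mulr_ge0 (expR_ge0 _); apply: mulr_ge0 (ltW rm_const_gt0).
  by apply: mulr_ge0 (sqr_ge0 _).
have zE : Num.sqrt zeta = Num.sqrt ((2 * delta)^-1) / Num.sqrt l.
  rewrite /zeta -sqrtrV ?(ltW l0)// -sqrtrM ?invr_ge0 ?mulr_ge0 ?(ltW delta0)//.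
  by congr Num.sqrt; field; rewrite !gt_eqF.
have nl : core_bound / n.+1%:R <= core_bound / Num.sqrt l.
  rewrite ler_wpM2l// lef_pV2 ?posrE//; apply: le_trans ln_le.
  rewrite -[leRHS]sqr_sqrtr ?(ltW l0)// expr2 ler_peMr ?(ltW sl0)//.
  by rewrite -[leLHS]sqrtr1 ler_wsqrtr.
rewrite trE zE /eta_const; set q := core_bound / n.+1%:R in nl *.
set x1 := Num.sqrt (noise_sq _); set x2 := Num.sqrt (_^-1).
have -> : (32 * x1 + 16 * core_bound + 20 * core_bound * x2) / Num.sqrt l =
  32 * (x1 / Num.sqrt l) + 16 * (core_bound / Num.sqrt l) + 20 * core_bound * (x2 / Num.sqrt l) by ring.
lra.
Qed.
End GoodGraph.

(** * Recovery with high probability *)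

Lemma clustering_dist_ext {R : realType} {n L L' : nat} (X : 'M[R]_(L, n)) (X' : 'M[R]_(L', n))
    phi eps rem out :
  (forall u v, scaled_dist X u v = scaled_dist X' u v) ->
  clustering X phi eps rem out -> clustering X' phi eps rem out.
Proof.
move=> h.
have N r m c : near_in X r m c = near_in X' r m c.
  by apply/setP => u; rewrite !inE h.
have Dn r m : dense_center X phi eps r m = dense_center X' phi eps r m.
  by rewrite /dense_center N.
elim: out rem => [|C out IH] rem /=; first by move=> H m; rewrite -Dn.
case=> -[m dm CE] /IH cl; split => //; exists m; first by rewrite -Dn.
by rewrite -N.
Qed.

Lemma gap_dist_ext {R : realType} {n L L' t : nat} (X : 'M[R]_(L, n)) (X' : 'M[R]_(L', n))
    phi (w : pair_sample n t) :
  (forall u v, scaled_dist X u v = scaled_dist X' u v) -> gap X phi w = gap X' phi w.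
Proof. by move=> h; apply: eq_big => [j|j _]; rewrite h. Qed.

Lemma normalized_adj_sym {R : realType} {n} (g : graph n) :
  (normalized_adj R g)^T = normalized_adj R g.
Proof.
apply/matrixP => u v; rewrite !mxE adj_sym; case: ifP => // _; congr (_ / _).
by rewrite mulrC.
Qed.

Section Recovery.
Context {R : realType} {n K : nat}.
Notation I := 'I_n.+1.
Variables (alpha : 'I_K -> R) (sigma : I -> 'I_K).
Variables (g : graph n.+1) (D phi eta lo hi c1 c2 c3 : R).
Let H0 := normalized_adj R g.
Hypothesis class_size : forall k, #|[pred u | sigma u == k]|%:R = alpha k * n.+1%:R.
Hypotheses (D0 : 0 < D) (phi0 : 0 < phi) (phi1 : phi <= 1) (eta0 : 0 <= eta).
Hypotheses (lo0 : 0 < lo) (hi0 : 0 < hi).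
Hypotheses (deg_lo : lo * D <= mean_degree R g) (deg_hi : mean_degree R g <= hi * D).
Hypotheses (phi_c1 : phi / lo <= c1) (eta_phi : c2 * eta <= phi / hi)
  (eta_phi2 : 2 * (c2 * eta) <= phi) (c20 : 0 < c2).
Hypothesis phi_c3 : 20 * (phi `^ (2 / 3) / 2) <= c3.
Hypothesis phi_alpha : forall k, phi `^ (1 / 3) + phi `^ (2 / 3) < alpha k.
Hypothesis structure : forall t L (X : 'M[R]_(L, n.+1)) (S : 'rV[R]_L),
  0 < t -> t <= c1 -> c2 * eta <= t ->
  X *m X^T = 1%:M -> X *m (D *: H0) = diag_mx S *m X -> (forall i, t < `|S 0 i|) ->
  (forall x, x *m X^T = 0 -> nrm (x *m (D *: H0)) <= t * nrm x) ->
  exists ctr : 'I_K -> 'I_L -> R,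
    \sum_u \sum_i (X i u - ctr (sigma u) i) ^+ 2 <= (c2 * eta) ^+ 2
    /\ forall i l, i != l ->
       c3 <= Num.sqrt n.+1%:R * Num.sqrt (\sum_j (ctr i j - ctr l j) ^+ 2).

Let thr := phi / mean_degree R g.
Let n0 : 0 < n.+1%:R :> R. Proof. by rewrite ltr0n. Qed.
Let deg0 : 0 < mean_degree R g. Proof. exact: lt_le_trans (mulr_gt0 lo0 D0) deg_lo. Qed.
Let thr0 : 0 < thr. Proof. exact: divr_gt0. Qed.

(** Each far vertex contributes at least (f^(2/3)/2)^2 / n to a residual of at most f^2/4, and f^2
    is the cube of f^(2/3). *)
Lemma few_far L (X : 'M[R]_(L, n.+1)) (ctr : 'I_K -> 'rV[R]_L) :
  \sum_u nrm (row u X^T - ctr (sigma u)) ^+ 2 <= (c2 * eta) ^+ 2 ->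
  #|[pred u | ~~ near_center X phi sigma ctr u]|%:R <= phi `^ (2 / 3) * n.+1%:R.
Proof.
move=> h; set q := phi `^ (2 / 3).
have q0 : 0 < q by rewrite powR_gt0.
have q3 : q ^+ 3 = phi ^+ 2.
  rewrite /q -powR_mulrn ?powR_ge0// -powRrM.
  have -> : 2 / 3 * 3%:R = 2%:R :> R by field.
  by rewrite powR_mulrn// ltW.
have far u : ~~ near_center X phi sigma ctr u ->
    (q / 2) ^+ 2 / n.+1%:R <= nrm (row u X^T - ctr (sigma u)) ^+ 2.
  rewrite /near_center -/q -ltNge /center_dist => hu.
  rewrite ler_pdivrMr//; apply: le_trans (_ : (Num.sqrt n.+1%:R * nrm (row u X^T - ctr (sigma u))) ^+ 2 <= _).
    by rewrite lerXn2r ?nnegrE ?(ltW hu)// ?divr_ge0 ?(ltW q0)// mulr_ge0 ?sqrtr_ge0 ?nrm_ge0.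
  by rewrite exprMn sqr_sqrtr ?(ltW n0)// mulrC.
have h1 : #|[pred u | ~~ near_center X phi sigma ctr u]|%:R * ((q / 2) ^+ 2 / n.+1%:R) <= (c2 * eta) ^+ 2.
  apply: le_trans h; rewrite -sum1_card natr_sum mulr_suml big_mkcond/=.
  apply: ler_sum => u _; rewrite inE; case: ifP => [/far|_]; last by rewrite sqr_ge0.
  by rewrite mul1r.
have h2 : (c2 * eta) ^+ 2 <= phi ^+ 2 / 4.
  have e : phi ^+ 2 / 4 = (phi / 2) ^+ 2 by field.
  rewrite e lerXn2r ?nnegrE ?mulr_ge0 ?(ltW c20) ?divr_ge0 ?(ltW phi0)//.
  move: eta_phi2; lra.
have h3 := le_trans h1 h2.
have q20 : 0 < (q / 2) ^+ 2 / n.+1%:R by apply: divr_gt0 => //; rewrite exprn_gt0// divr_gt0.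
rewrite -(ler_pM2r q20); apply: le_trans h3 _.
rewrite -q3 le_eqVlt; apply/orP; left; apply/eqP; field.
by rewrite gt_eqF.
Qed.

(** The set [near] depends on the graph only, as the independence of the sample requires. It is
    built from one embedding and serves all others, since they have the same distances. *)
Lemma recovery_on_good : exists2 near : pred I,
  #|[pred u | ~~ near u]|%:R <= phi `^ (2 / 3) * n.+1%:R
  & forall t (w : pair_sample n.+1 t), good_sample sigma near w ->
    forall out, algorithm_output phi g w out ->
    exists2 pi : 'I_K -> 'I_(size out), bijective pi
      & #|[pred u | u \notin nth finset.set0 out (pi (sigma u))]|%:R
        <= phi `^ (2 / 3) * n.+1%:R.
Proof.
(* Without an embedding the algorithm has no output on this graph, and any [near] will do. *)
have [[L [X emb]]|noemb] := pselect (exists L (X : 'M[R]_(L, n.+1)), spectral_embedding H0 thr X);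
  last first.
  exists predT => [|t w _ out [L [X [emb _]]]].
    by rewrite (eq_card0 (A := [pred u | ~~ predT u])) ?mulr_ge0 ?powR_ge0.
  by exfalso; apply: noemb; exists L, X.
have HT : H0^T = H0 := normalized_adj_sym g.
have [S [XX XH SL]] := embedding_eigenvalues emb.
have Xo x : x *m X^T = 0 -> nrm (x *m H0) <= thr * nrm x.
  by apply: embedding_orthogonal => //; exact: ltW.
have t0 : 0 < D * thr by exact: mulr_gt0.
have tE : D * thr = phi * (D / mean_degree R g) by rewrite /thr; ring.
have t1 : D * thr <= c1.
  apply: le_trans phi_c1; rewrite tE ler_wpM2l ?(ltW phi0)//.
  by rewrite ler_pdivrMr// ler_pdivlMl// mulrC.
have t2 : c2 * eta <= D * thr.
  apply: le_trans eta_phi _; rewrite tE ler_wpM2l ?(ltW phi0)//.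
  by rewrite ler_pdivlMr// ler_pdivrMl.
have XH' : X *m (D *: H0) = diag_mx (D *: S) *m X.
  by rewrite -scalemxAr XH linearZ/= scalemxAl.
have SL' i : D * thr < `|(D *: S) 0 i|.
  by rewrite mxE normrM (gtr0_norm D0) ltr_pM2l.
have Xo' x : x *m X^T = 0 -> nrm (x *m (D *: H0)) <= D * thr * nrm x.
  by move=> hx; rewrite -scalemxAr nrmZ (gtr0_norm D0) -mulrA ler_pM2l// Xo.
have [ctr [res sep]] := structure t0 t1 t2 XX XH' SL' Xo'.
pose C k : 'rV[R]_L := \row_i ctr k i.
have res' : \sum_u nrm (row u X^T - C (sigma u)) ^+ 2 <= (c2 * eta) ^+ 2.
  apply: le_trans res; apply: ler_sum => u _; rewrite sqr_nrm dotxx ler_sum// => i _.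
  by rewrite !mxE.
have sep' i l : i != l -> c3 <= Num.sqrt n.+1%:R * nrm (C i - C l).
  move=> il; apply: le_trans (sep _ _ il) _; rewrite /nrm dotxx.
  rewrite le_eqVlt; apply/orP; left; apply/eqP; congr (_ * Num.sqrt _).
  by apply: eq_bigr => j _; rewrite !mxE.
have far := few_far res'.
exists (near_center X phi sigma C) => // t w /andP[/forallP gn /forallP ga] out [L' [X' [emb' cl]]].
have dE u v : scaled_dist X' u v = scaled_dist X u v.
  exact: (scaled_dist_unique HT u v (ltW thr0) emb' emb).
rewrite (gap_dist_ext _ _ dE) in cl; have {}cl := clustering_dist_ext dE cl.
have few : #|[pred u | ~~ near_center X phi sigma C u]|%:R <= phi `^ (1 / 3) * n.+1%:R.
  apply: le_trans far _; rewrite ler_wpM2r// ger_powR ?phi0//.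
  lra.
have large k : phi `^ (1 / 3) * n.+1%:R < #|[pred u | near_center X phi sigma C u && (sigma u == k)]|%:R.
  have : #|[pred u | sigma u == k]|%:R <= #|[pred u | near_center X phi sigma C u && (sigma u == k)]|%:R
       + #|[pred u | ~~ near_center X phi sigma C u]|%:R :> R.
    rewrite -natrD ler_nat -cardUI.
    apply: leq_trans (leq_addr _ _); apply: subset_leq_card; apply/fintype.subsetP => u.
    by rewrite !inE => ->; rewrite andbT orbN.
  rewrite class_size.
  have : (phi `^ (1 / 3) + phi `^ (2 / 3)) * n.+1%:R < alpha k * n.+1%:R by rewrite ltr_pM2r.
  by move: far; lra.
have [pi bij cnt] := gap_clustering_recovers sep' phi_c3 phi0
  (fun j => andP (gn j)) (fun a b => let: ex_intro j h := existsP (forallP (ga a) b) in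
     ex_intro _ j (let: conj h1 h2 := andP h in conj (eqP h1) (eqP h2))) few large cl.
exists pi => //; apply: le_trans far; by rewrite ler_nat.
Qed.
End Recovery.

(** * From good events to the law of a run *)

Section RunProbability.
Context {R : realType} {K : nat}.
Variables (B : 'M[R]_K) (G : dcsbm R K).
Let n := nvert_pred G.
Let p : 'I_n.+1 -> 'I_n.+1 -> R := edge_prob B (G := G).
Hypothesis p01 : forall u v, 0 <= p u v <= 1.

Let wt0 := edge_wt_ge0 p01.
Let wt1 := @edge_wt1 R n p.

Lemma graph_lawE (g : graph (nvert G)) : graph_law B g = \prod_e edge_wt p e (g e).
Proof. by apply: eq_bigr => e _; rewrite /edge_wt; case: (g e). Qed.

Lemma run_PrE t (E : graph (nvert G) -> pair_sample (nvert G) t -> Prop) :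
  run_Pr B E = pE (edge_wt p) (fun g => pE (@unif_wt R n.+1 t) (fun w => (`[< E g w >])%:R)).
Proof.
apply: eq_bigr => g _; rewrite -graph_lawE /pE mulr_sumr big_mkcond/=.
apply: eq_bigr => w _.
have -> : \prod_(j < t) @unif_wt R n.+1 t j (w j) = (#|pair_sample (nvert G) t|%:R)^-1.
  rewrite prodr_const card_ord card_ffun card_prod !card_ord /unif_wt exprVn.
  by rewrite natrX natrM expr2.
by case: ifP => _; rewrite ?mulr1 ?mulr0.
Qed.

Lemma graph_Pr_gt0 (E : graph (nvert G) -> Prop) : 0 < graph_Pr B E -> exists g, E g.
Proof.
move=> h; apply: contrapT => hn; move: h; rewrite /graph_Pr big_pred0 ?ltxx// => g.
by apply/asboolP => Eg; apply: hn; exists g.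
Qed.

Lemma run_Pr_le1 t (E : graph (nvert G) -> pair_sample (nvert G) t -> Prop) : run_Pr B E <= 1.
Proof.
rewrite run_PrE -[leRHS](pE_cst wt1 1); apply: le_pE => // g.
rewrite -[leRHS](pE_cst (unif_wt1 (n := n.+1) (t := t) (R := R) isT) 1); apply: le_pE.
  by move=> j x; exact: unif_wt_ge0.
by move=> w; case: asbool.
Qed.

Lemma run_Pr_ge t (E : graph (nvert G) -> pair_sample (nvert G) t -> Prop)
    (good : pred (graph n.+1)) (goods : graph n.+1 -> pred (pair_sample n.+1 t)) d :
  0 <= d ->
  (forall g, good g -> pE (@unif_wt R n.+1 t) (fun w => (~~ goods g w)%:R) <= d) ->
  (forall g w, good g -> goods g w -> E g w) ->
  1 - pE (edge_wt p) (fun g => (~~ good g)%:R) - d <= run_Pr B E.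
Proof.
move=> d0 hs hE; rewrite run_PrE.
have u0 : forall j x, 0 <= @unif_wt R n.+1 t j x by move=> j x; exact: unif_wt_ge0.
have u1 : forall j, \sum_x @unif_wt R n.+1 t j x = 1 by apply: unif_wt1.
have key g : 1 - d <= (~~ good g)%:R + pE (@unif_wt R n.+1 t) (fun w => (`[< E g w >])%:R).
  have [gg|gg] := boolP (good g); rewrite -?[true%:R]/(1 : R) -?[false%:R]/(0 : R).
    rewrite add0r lerBlDr; apply: le_trans (lerD (lexx _) (hs g gg)).
    rewrite -pED -[leLHS](pE_cst u1 1); apply: le_pE => // w.
    have [gw|gw] := boolP (goods g w); last by rewrite lerDr.
    by have /asboolT-> := hE _ _ gg gw; rewrite lerDl.
  have : 0 <= pE (@unif_wt R n.+1 t) (fun w => (`[< E g w >])%:R) by apply: pE_ge0.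
  lra.
have := le_pE wt0 key; rewrite pE_cst// pED; lra.
Qed.
End RunProbability.

Section SampleBound.
Context {R : realType} {K : nat}.

(** The number t of pairs, close to f^(-1/3), is a compromise: t f^(2/3) must vanish so that no far
    vertex is drawn, and t must grow so that all pairs of communities are met. Both errors are
    O(f^(1/3)). *)
Lemma sample_error (alpha : 'I_K -> R) (y phi : R) t :
  0 < y -> (forall a b, y <= alpha a * alpha b) -> (forall a b, alpha a * alpha b <= 1) -> y <= 1 ->
  0 < phi -> phi <= 1 -> `|t%:R - 1 / phi `^ (1 / 3)| < 1 ->
  2 * t%:R * phi `^ (2 / 3) + \sum_a \sum_b (1 - alpha a * alpha b) ^+ t
  <= (4 + K%:R ^+ 2 / y) * phi `^ (1 / 3).
Proof.
move=> y0 hy h1 y1 phi0 phi1.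
set q := phi `^ (1 / 3).
have q0 : 0 < q by rewrite powR_gt0.
have q1 : q <= 1.
  have e : 1 = 1 `^ (1 / 3) :> R by rewrite powR1.
  by rewrite [leRHS]e ge0_ler_powR ?nnegrE ?(ltW phi0).
have q2 : phi `^ (2 / 3) = q ^+ 2.
  rewrite /q -powR_mulrn ?powR_ge0// -powRrM.
  by have -> : 1 / 3 * 2%:R = 2 / 3 :> R by field.
rewrite q2 ltr_distl => /andP[t1 t2].
have tq : t%:R * q <= 1 + q.
  have : t%:R * q <= (1 / q + 1) * q by rewrite ler_wpM2r// ltW.
  by rewrite mulrDl divfK ?gt_eqF// mul1r.
have tq' : 1 <= (1 + t%:R) * q.
  have : (1 / q) * q <= (1 + t%:R) * q by rewrite ler_wpM2r ?(ltW q0)//; move: t1; lra.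
  by rewrite divfK ?gt_eqF.
have b1 : 2 * t%:R * q ^+ 2 <= 4 * q.
  have : t%:R * q * q <= (1 + q) * q by rewrite ler_wpM2r// ltW.
  have : (1 + q) * q <= 2 * q by rewrite ler_wpM2r ?(ltW q0)//; move: q1; lra.
  rewrite expr2; lra.
have t0 : 0 <= t%:R :> R by [].
have yt : 0 < 1 + t%:R * y by rewrite ltr_wpDr// mulr_ge0// ltW.
have b2 : (1 + t%:R * y)^-1 <= q / y.
  rewrite -[leRHS]invrK invf_div lef_pV2 ?posrE ?divr_gt0//.
  rewrite ler_pdivrMr//.
  have : y * 1 <= y * ((1 + t%:R) * q) by rewrite ler_wpM2l// ltW.
  have : y * q <= 1 * q by rewrite ler_wpM2r// ltW.
  lra.
have b3 : \sum_a \sum_b (1 - alpha a * alpha b) ^+ t <= \sum_(a < K) \sum_(b < K) q / y.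
  apply: ler_sum => a _; apply: ler_sum => b _.
  have ab0 : 0 < alpha a * alpha b by apply: lt_le_trans (hy a b).
  apply: le_trans (@power_tail R t _ ab0 (h1 a b)) _; apply: le_trans b2.
  rewrite lef_pV2 ?posrE//; last by rewrite ltr_wpDr// mulr_ge0// ltW.
  by rewrite lerD2l ler_wpM2l.
have b4 : \sum_(a < K) \sum_(b < K) q / y = K%:R ^+ 2 / y * q.
  rewrite !sumr_const !card_ord -mulrnA -[LHS]mulr_natl natrM.
  by field; rewrite gt_eqF.
rewrite b4 in b3; rewrite [leRHS]mulrDl; exact: lerD b1 b3.
Qed.
End SampleBound.

Section Instance.
Context {R : realType} {K : nat}.
Variables (B : 'M[R]_K) (Mbar alpha : 'I_K -> R) (c1 c2 c3 : R).
Hypotheses (BT : B^T = B) (B0 : forall i j, 0 <= B i j) (a0 : forall i, 0 < alpha i).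
Hypothesis c20 : 0 < c2.
Hypothesis structure : block_structure B Mbar alpha c1 c2 c3.

Variables (G : dcsbm R K) (phi : R) (t : nat) (Mlo Mhi Bmax kappa delta y : R).
Let m i := block_weight B G i / total_weight G.
Let w0 := @weight R K G ord0.
Let l := logn_vert G.
Let eta := eta_const Mlo Bmax kappa delta / Num.sqrt l.
Hypothesis sizes : forall k,
  #|[pred u : vertex G | label u == k]|%:R = alpha k * (nvert G)%:R.
Hypotheses (wpos : forall u : vertex G, 0 < weight u)
  (wmono : forall u v : vertex G, (u <= v)%N -> weight u <= weight v).
Hypotheses (mclose : forall i, `|m i - Mbar i| <= c1 * Mbar i).
Hypotheses (Mlo0 : 0 < Mlo) (m_ge : forall i, Mlo <= m i) (m_le : forall i, m i <= Mhi).
Hypotheses (B_le : forall i j, B i j <= Bmax)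
  (p_le1 : forall u v : vertex G, edge_prob B u v <= 1).
Hypotheses (kappa0 : 0 <= kappa) (delta0 : 0 < delta) (l1 : 1 <= l).
Hypotheses (w0_log : 8 * l <= w0 * Mlo) (w0_sq : mean_weight G * l <= kappa * w0 ^+ 2).
Hypotheses (phi0 : 0 < phi) (phi1 : phi <= 1) (phi_c1 : phi / (Mlo / 4) <= c1).
Hypotheses (eta_phi : c2 * eta <= phi / (Mhi / delta)) (eta_phi2 : 2 * (c2 * eta) <= phi).
Hypotheses (phi_c3 : 20 * (phi `^ (2 / 3) / 2) <= c3).
Hypothesis phi_alpha : forall k, phi `^ (1 / 3) + phi `^ (2 / 3) < alpha k.
Hypotheses (y0 : 0 < y) (y_le : forall a b, y <= alpha a * alpha b)
  (a_le1 : forall a b, alpha a * alpha b <= 1) (y1 : y <= 1).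
Hypothesis ht : `|t%:R - 1 / phi `^ (1 / 3)| < 1.

Lemma run_bound :
  1 - ((expR (1 / 2) + 2 * noise_scale Mlo Bmax kappa) / (nvert G)%:R + 2 * delta)
    - (4 + K%:R ^+ 2 / y) * phi `^ (1 / 3)
  <= run_Pr B (fun (g : graph (nvert G)) (w : pair_sample (nvert G) t) =>
       forall out, algorithm_output phi g w out -> recovers (phi `^ (2 / 3)) out).
Proof.
pose n := nvert_pred G.
pose sigma : 'I_n.+1 -> 'I_K := @label R K G.
pose w : 'I_n.+1 -> R := @weight R K G.
have w_ge u : w0 <= w u by apply: wmono.
have w00 : 0 < w0 by exact: wpos.
have p01 (u v : 'I_n.+1) : 0 <= edge_prob B (G := G) u v <= 1.
  rewrite p_le1 andbT /edge_prob mulr_ge0// divr_ge0//.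
    by rewrite mulr_ge0// ltW.
  by rewrite mulr_ge0// divr_ge0// sumr_ge0// => v' _; rewrite ltW.
have [good [gprob gprop]] := @good_graph_prob R n K B sigma w BT B0 w0 Mlo Mhi Bmax kappa delta
  w00 w_ge Mlo0 m_ge m_le B_le p_le1 kappa0 delta0 l1 w0_log w0_sq.
have D0 : 0 < mean_weight G.
  rewrite divr_gt0 ?ltr0n// /total_weight (bigD1 ord0)//= ltr_wpDr// sumr_ge0// => u _.
  by rewrite ltW.
have l0 : 0 < l by exact: lt_le_trans l1.
have Bmax0 : 0 <= Bmax := le_trans (B0 (sigma ord0) (sigma ord0)) (B_le _ _).
have pc0 : 0 <= core_bound Mlo Bmax by rewrite divr_ge0// exprn_ge0// ltW.
have eta0 : 0 <= eta.
  apply: divr_ge0 (sqrtr_ge0 _); rewrite /eta_const -(mulrA 20).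
  set x1 := Num.sqrt _; set x2 := Num.sqrt _.
  have h1 : 0 <= x1 := sqrtr_ge0 _.
  have h2 := mulr_ge0 pc0 (sqrtr_ge0 (2 * delta)^-1).
  by move: pc0 h1 h2; rewrite -/x2; lra.
have Mhi0 : 0 < Mhi by apply: lt_le_trans (m_le (sigma ord0)); apply: lt_le_trans (m_ge _).
have near_ex (g : graph n.+1) : exists near : pred 'I_n.+1, good g ->
    #|[pred u | ~~ near u]|%:R <= phi `^ (2 / 3) * n.+1%:R
    /\ forall (s : pair_sample n.+1 t), good_sample sigma near s ->
       forall out, algorithm_output phi g s out -> recovers (G := G) (phi `^ (2 / 3)) out.
  have [gg|ng] := boolP (good g); last by exists predT.
  have [d1 d2 d3] := gprop g gg.
  have [near nfew nrec] : exists2 near : pred 'I_n.+1,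
      #|[pred u | ~~ near u]|%:R <= phi `^ (2 / 3) * n.+1%:R
    & forall t (w : pair_sample n.+1 t), good_sample sigma near w ->
      forall out, algorithm_output phi g w out ->
      exists2 pi : 'I_K -> 'I_(size out), bijective pi
      & #|[pred u | u \notin nth finset.set0 out (pi (sigma u))]|%:R
        <= phi `^ (2 / 3) * n.+1%:R.
    apply: (@recovery_on_good R n K alpha sigma g (mean_weight G) phi eta
      (Mlo / 4) (Mhi / delta) c1 c2 c3) => //.
    all: try exact: divr_gt0.
    move=> s L X S s0 sc es XX XH SL Xo.
    apply: (@structure _ sigma m _ eta s L X S _ sizes mclose eta0 s0 sc es _ XX XH SL Xo) => //.
    by move=> x; apply: d3 => u v; rewrite class_mx_coreE//; exact: sizes.
  exists near => _; split => // s gs out ao.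
  by have [pi bij cnt] := nrec t s gs out ao; exists pi.
have [nf hnf] := choice near_ex.
have q0 : 0 <= (4 + K%:R ^+ 2 / y) * phi `^ (1 / 3).
  by rewrite mulr_ge0 ?powR_ge0// addr_ge0// divr_ge0 ?sqr_ge0// ltW.
apply: le_trans (run_Pr_ge (G := G) p01 (good := good)
  (goods := fun g => good_sample sigma (nf g)) q0 _ _).
- by rewrite -!addrA lerD2l lerD2r lerN2.
- move=> g gg; have [few _] := hnf g gg.
  apply: le_trans (good_sample_prob (t := t) _ sizes few) _ => //.
  exact: sample_error.
- by move=> g s gg gs out ao; have [_ h] := hnf g gg; apply: h ao.
Qed.
End Instance.

(** * Passage to the limit *)

Import numFieldNormedType.Exports.
Local Open Scope classical_set_scope.
Local Open Scope ring_scope.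

Lemma cube_root_le {R : realType} (x e : R) : 0 < x -> 0 <= e -> x <= e ^+ 3 ->
  x `^ (1 / 3) <= e /\ x `^ (2 / 3) = (x `^ (1 / 3)) ^+ 2.
Proof.
move=> x0 e0 h; have x3 : (x `^ (1 / 3)) ^+ 3 = x.
  rewrite -powR_mulrn ?powR_ge0// -powRrM.
  have -> : 1 / 3 * 3%:R = 1 :> R by field.
  by rewrite powRr1// ltW.
split.
  by rewrite -(@ler_pXn2r _ 3) ?nnegrE ?powR_ge0// x3.
rewrite -[in RHS]powR_mulrn ?powR_ge0// -powRrM.
by have -> : 1 / 3 * 2%:R = 2 / 3 :> R by field.
Qed.

Lemma graph_Pr_cvg1 {R : realType} {K : nat} (B : 'M[R]_K) (G : nat -> dcsbm R K)
    (E : forall m, graph (nvert (G m)) -> Prop) :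
  (fun m => graph_Pr B (E m)) @ \oo --> (1 : R) ->
  \forall m \near \oo, exists g, E m g.
Proof.
move=> /cvgrPdist_le/(_ (1 / 2)) h.
have {}h := h (divr_gt0 ltr01 (ltr0n _ 2)).
near=> m.
have : `|1 - graph_Pr B (E m)| <= 1 / 2 by near: m.
rewrite ler_distlC => /andP[h1 _].
by apply: (@graph_Pr_gt0 _ _ B); lra.
Unshelve. all: by end_near. Qed.

(** The term 1/sqrt(log n) does not depend on the graph: once the event has positive probability, a
    single graph in it yields a deterministic inequality. *)
Lemma dominates_sqrt_log {R : realType} {K : nat} (B : 'M[R]_K) (G : nat -> dcsbm R K)
    (f : nat -> R) (rest : forall m, graph (nvert (G m)) -> R) (k : R) :
  (forall m g, 0 <= rest m g) -> 0 < k -> dominates_in_Pr B f rest ->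
  \forall m \near \oo, k / Num.sqrt (logn_vert (G m)) < f (nvert (G m)).
Proof.
move=> r0 k0 /(_ k)/graph_Pr_cvg1; apply: filterS => m [g [_]].
apply: le_lt_trans; rewrite -div1r mulrA mulr1 ler_wpM2l ?(ltW k0)//.
have := r0 m g; have : 0 <= 1 / (degree g ord0)%:R :> R by rewrite divr_ge0.
rewrite div1r; lra.
Qed.

Theorem theorem3p1 (R : realType) (K : nat) (B : 'M[R]_K)
    (Mbar : 'I_K -> R) (rate : nat -> R)
    (B_sym : B^T = B) (B_ge0 : forall i j, 0 <= B i j)
    (Mbar_gt0 : forall i, 0 < Mbar i)
    (rate_cvg0 : rate @ \oo --> (0 : R)) :
  exists C : R,
  forall (alpha d : 'I_K -> R) (G : nat -> dcsbm R K)
         (f : nat -> R) (tau : nat -> nat),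
  (* standing assumptions; the number of vertices runs through a strictly
     increasing sequence of values n for which all alpha_k n are integers *)
  (forall k, 0 < alpha k) -> \sum_k alpha k = 1 ->
  {homo (fun m => nvert (G m)) : m m' / (m < m')%N} ->
  (forall m k,
     #|[pred u : vertex (G m) | label u == k]|%:R
       = alpha k * (nvert (G m))%:R) ->
  (forall m (u : vertex (G m)), 0 < weight u) ->
  (forall m (u v : vertex (G m)), (u <= v)%N -> weight u <= weight v) ->
  (forall m i,
     `|block_weight B (G m) i / total_weight (G m) - Mbar i|
       <= rate (nvert (G m))) ->
  (* (i) *)
  (forall m (u v : vertex (G m)), edge_prob B u v <= 1) ->
  (* (ii) *)
  (forall i, d i != 0
     /\ (fun m => class_mean_weight alpha (G m) i / mean_weight (G m))
          @ \oo --> d i) ->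
  (* (iii) *)
  (forall i l, i != l -> exists j, B i j / Mbar i != B l j / Mbar l) ->
  (* (iv) *)
  (fun m => @weight R K (G m) ord0 ^+ 2 / mean_weight (G m))
    =Omega_\oo (fun m => logn_vert (G m)) ->
  (* (v), each regime with the corresponding choice of f *)
  ((fun m => @weight R K (G m) ord0 / logn_vert (G m)) @ \oo --> +oo
   /\ dominates_in_Pr B f
        (fun m (g : graph (nvert (G m))) =>
           Num.sqrt (logn_vert (G m) / (degree g ord0)%:R))
  \/
   [/\ (forall m, C * logn_vert (G m) <= @weight R K (G m) ord0),
       (exists2 c : R, c < 1 / 2 &
          (fun m => @weight R K (G m) ord_max ^+ 2 / (nvert (G m))%:R `^ c)
            @ \oo --> (0 : R))
     & dominates_in_Pr B f
        (fun m (g : graph (nvert (G m))) =>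
           1 / logn_vert (G m) `^ (1 / 3))]) ->
  f @ \oo --> (0 : R) ->
  (forall n, `|(tau n)%:R - 1 / f n `^ (1 / 3)| < 1) ->
  exists2 e : nat -> R, e @ \oo --> (0 : R)
    & (fun m => run_Pr B
         (fun (g : graph (nvert (G m)))
              (w : pair_sample (nvert (G m)) (tau (nvert (G m)))) =>
            forall out, algorithm_output (f (nvert (G m))) g w out ->
              recovers (e m) out)) @ \oo --> (1 : R).
Proof.
(* Half of the limits leaves room for m_i at finite n. With C = 8/Mlo every expected degree is then
   at least 8 log n. *)
have [Mlo Mlo0 hMlo] : exists2 c, 0 < c & forall i, c <= Mbar i / 2.
  by apply: pos_lower_bound => i; rewrite divr_gt0.
exists (8 / Mlo) => alpha d G f tau a0 a1 Gmono sizes wpos wmono hrate p_le1 _ ident hOm hv f0 htau.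
have a_le k : alpha k <= 1.
  by rewrite -a1 (bigD1 k)//= lerDl sumr_ge0// => j _; rewrite ltW.
have aa_le a b : alpha a * alpha b <= 1 by rewrite mulr_ile1// ltW.
have [y y0 hy] : exists2 c, 0 < c & forall x : 'I_K * 'I_K, c <= alpha x.1 * alpha x.2.
  by apply: pos_lower_bound => x; rewrite mulr_gt0.
have [amin amin0 hamin] := pos_lower_bound a0.
have k1 : 'I_K := @label R K (G 0%N) ord0.
have y1 : y <= 1 by apply: le_trans (hy (k1, k1)) (aa_le _ _).
have [c1 [c2 [c3 [c10 c20 c30 structure]]]] := embedding_structure B_sym B_ge0 Mbar_gt0 a0 ident.
pose Bmax := \sum_i \sum_j B i j.
have B_le i j : B i j <= Bmax.
  rewrite /Bmax (bigD1 i)//= (bigD1 j)//= -addrA lerDl addr_ge0//; first by rewrite sumr_ge0.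
  by apply: sumr_ge0 => ? _; rewrite sumr_ge0.
pose Mhi := \sum_i 2 * Mbar i.
have Mhi_ge i : 2 * Mbar i <= Mhi.
  by rewrite /Mhi (bigD1 i)//= lerDl sumr_ge0// => j _; rewrite mulr_ge0// ltW.
have Mhi0 : 0 < Mhi by apply: lt_le_trans (Mhi_ge k1); rewrite mulr_gt0.
have nge m : (m <= nvert (G m))%N.
  by elim: m => // m IH; apply: leq_ltn_trans IH (Gmono _ _ (ltnSn m)).
have evn (Q : nat -> Prop) : (\forall n \near \oo, Q n) -> \forall m \near \oo, Q (nvert (G m)).
  case=> N _ hN; exists N => // m /= Nm; apply: hN => /=; exact: leq_trans Nm (nge m).
have Nbig A : \forall m \near \oo, A <= (nvert (G m))%:R :> R.
  by apply: (evn (fun n => A <= n%:R)); exact: nbhs_infty_ger.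
have lbig A : \forall m \near \oo, A <= logn_vert (G m).
  near=> m; rewrite /logn_vert -[leLHS]expRK ler_ln ?posrE ?expR_gt0 ?ltr0n//.
  by near: m; exact: Nbig.
have V1 : \forall m \near \oo, 8 / Mlo * logn_vert (G m) <= @weight R K (G m) ord0.
  case: hv => [[/cvgryPge/(_ (8 / Mlo)) h _]|[h _ _]]; last by near=> m; exact: h.
  near=> m.
  have l0 : 0 < logn_vert (G m) by apply: lt_le_trans ltr01 _; near: m; exact: lbig.
  by rewrite -ler_pdivlMr//; near: m.
have V2 k : 0 < k -> \forall m \near \oo, k / Num.sqrt (logn_vert (G m)) < f (nvert (G m)).
  move=> k0; case: hv => [[_ h]|[_ _ h]]; apply: (dominates_sqrt_log _ k0 h) => m g.
    exact: sqrtr_ge0.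
  by rewrite divr_ge0// powR_ge0.
have [kappa kappa0 V3] : exists2 kappa, 0 < kappa & \forall m \near \oo,
    mean_weight (G m) * logn_vert (G m) <= kappa * @weight R K (G m) ord0 ^+ 2.
  move: hOm; rewrite eqOmegaE eqOmegaO => /eqO_exP[kappa kappa0 h].
  exists kappa => //; near=> m.
  have D0 : 0 < mean_weight (G m).
    rewrite divr_gt0 ?ltr0n// /total_weight (bigD1 ord0)//= ltr_wpDr// sumr_ge0// => u _.
    by rewrite ltW.
  have : `|logn_vert (G m)| <= kappa * `|@weight R K (G m) ord0 ^+ 2 / mean_weight (G m)|.
    by near: m.
  rewrite [`|_ / _|]ger0_norm; last by rewrite divr_ge0 ?sqr_ge0// ltW.
  move=> /(le_trans (ler_norm _)); rewrite mulrA ler_pdivlMr// mulrC; exact.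
have fsmall e : 0 < e -> \forall m \near \oo, f (nvert (G m)) <= e.
  move=> e0; apply: (evn (fun n => f n <= e)).
  move/cvgrPdist_le: f0 => /(_ e e0); apply: filterS => n.
  by rewrite sub0r normrN => /(le_trans (ler_norm _)).
have fpos : \forall m \near \oo, 0 < f (nvert (G m)).
  near=> m; apply: (@le_lt_trans _ _ (1 / Num.sqrt (logn_vert (G m)))).
    by rewrite divr_ge0// sqrtr_ge0.
  by near: m; apply: V2.
exists (fun m => f (nvert (G m)) `^ (2 / 3)).
  apply/cvgrPdist_le => e e0.
  pose e1 := Num.min 1 e; have e10 : 0 < e1 by rewrite lt_min ltr01.
  near=> m.
  rewrite sub0r normrN ger0_norm ?powR_ge0//.
  have fp : 0 < f (nvert (G m)) by near: m.
  have fe : f (nvert (G m)) <= e1 ^+ 3 by near: m; apply: fsmall; rewrite exprn_gt0.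
  have [q1 ->] := cube_root_le fp (ltW e10) fe.
  have e11 : e1 <= 1 by rewrite ge_min lexx.
  have e1e : e1 <= e by rewrite ge_min lexx orbT.
  have q0 : 0 <= f (nvert (G m)) `^ (1 / 3) := powR_ge0 _ _.
  rewrite expr2; apply: le_trans e1e; apply: le_trans q1.
  by rewrite ler_piMr// (le_trans _ e11)// (cube_root_le fp (ltW e10) fe).1.
apply/cvgrPdist_le => eps eps0.
(* The error budget is 2 delta for degrees, delta for the O(1/n) events, and delta for the
   sampling. *)
pose delta := eps / 4; have delta0 : 0 < delta by rewrite divr_gt0.
pose cc := Num.min c1 (1 / 2); have cc0 : 0 < cc by rewrite lt_min c10 divr_gt0.
have ccc1 : cc <= c1 by rewrite ge_min lexx.
have cch : cc <= 1 / 2 by rewrite ge_min lexx orbT.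
pose Q := 4 + K%:R ^+ 2 / y; have Q0 : 0 < Q.
  by rewrite ltr_pwDl// divr_ge0 ?sqr_ge0// ltW.
(* Upper bound for f^(1/3): it gives f <= 1, 10 f^(2/3) <= c3, f^(1/3) + f^(2/3) below every
   alpha_k, and a sampling error of at most delta. *)
pose e1 := Num.min (Num.min 1 (c3 / 10)) (Num.min (amin / 3) (delta / Q)).
have e10 : 0 < e1 by rewrite !lt_min ltr01 !divr_gt0.
pose E := eta_const Mlo Bmax kappa delta.
(* The first two summands provide the two lower bounds that f must satisfy against eta; the 1 keeps
   [kk] positive. *)
pose kk := c2 * `|E| * (Mhi / delta) + 2 * c2 * `|E| + 1.
have kk0 : 0 < kk.
  have [c2' M' d'] : [/\ 0 <= c2, 0 <= Mhi & 0 <= delta] by split; exact: ltW.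
  rewrite ltr_wpDl//; apply: addr_ge0.
    exact: mulr_ge0 (mulr_ge0 c2' (normr_ge0 _)) (divr_ge0 M' d').
  exact: mulr_ge0 (mulr_ge0 (ler0n _ _) c2') (normr_ge0 _).
near=> m.
have fp : 0 < f (nvert (G m)) by near: m.
have fe : f (nvert (G m)) <= e1 ^+ 3 by near: m; apply: fsmall; rewrite exprn_gt0.
have fc : f (nvert (G m)) <= c1 * (Mlo / 4).
  by near: m; apply: fsmall; rewrite mulr_gt0// divr_gt0.
have fk : kk / Num.sqrt (logn_vert (G m)) < f (nvert (G m)) by near: m; apply: V2.
have l1 : 1 <= logn_vert (G m) by near: m; exact: lbig.
have v1 : 8 / Mlo * logn_vert (G m) <= @weight R K (G m) ord0 by near: m.
have v3 : mean_weight (G m) * logn_vert (G m) <= kappa * @weight R K (G m) ord0 ^+ 2 by near: m.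
have rt : rate (nvert (G m)) <= cc * Mlo.
  near: m; apply: (evn (fun n => rate n <= cc * Mlo)).
  move/cvgrPdist_le: rate_cvg0 => /(_ _ (mulr_gt0 cc0 Mlo0)); apply: filterS => n.
  by rewrite sub0r normrN => /(le_trans (ler_norm _)).
have Nb : (expR (1 / 2) + 2 * noise_scale Mlo Bmax kappa) / delta <= (nvert (G m))%:R.
  by near: m; exact: Nbig.
have [q1 q2] := cube_root_le fp (ltW e10) fe.
set phi := f (nvert (G m)) in fp fe fc fk q1 q2 *.
have q0 : 0 <= phi `^ (1 / 3) := powR_ge0 _ _.
have e1a : e1 <= 1 by rewrite !ge_min lexx.
have e1b : e1 <= c3 / 10 by rewrite !ge_min lexx !orbT.
have e1c : e1 <= amin / 3 by rewrite !ge_min lexx !orbT.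
have e1d : e1 <= delta / Q by rewrite !ge_min lexx !orbT.
have qq : phi `^ (2 / 3) <= phi `^ (1 / 3).
  by rewrite q2 expr2 ler_piMr// (le_trans q1).
have mcl i : `|block_weight B (G m) i / total_weight (G m) - Mbar i| <= cc * Mbar i.
  apply: le_trans (hrate m i) _; apply: le_trans rt _; rewrite ler_wpM2l ?(ltW cc0)//.
  by apply: le_trans (hMlo i) _; have := Mbar_gt0 i; lra.
have mb i : Mlo <= block_weight B (G m) i / total_weight (G m) <= Mhi.
  have := mcl i; rewrite ler_distl => /andP[h1 h2].
  have : cc * Mbar i <= 1 / 2 * Mbar i by rewrite ler_wpM2r// ltW.
  have := hMlo i; have := Mhi_ge i; have := Mbar_gt0 i.
  by move=> *; apply/andP; split; lra.
have sl0 : 0 < Num.sqrt (logn_vert (G m)) by rewrite sqrtr_gt0 (lt_le_trans ltr01).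
have El : E / Num.sqrt (logn_vert (G m)) <= `|E| / Num.sqrt (logn_vert (G m)).
  by rewrite ler_wpM2r ?invr_ge0 ?(ltW sl0)// ler_norm.
set x := `|E| / Num.sqrt (logn_vert (G m)) in El.
have x0 : 0 <= x by rewrite divr_ge0// ltW.
have kx : c2 * x * (Mhi / delta) + 2 * (c2 * x) <= phi.
  apply: le_trans (ltW fk).
  have -> : kk / Num.sqrt (logn_vert (G m)) =
      c2 * x * (Mhi / delta) + 2 * (c2 * x) + 1 / Num.sqrt (logn_vert (G m)).
    by rewrite /kk /x; ring.
  by rewrite lerDl divr_ge0// ltW.
have cx : c2 * (E / Num.sqrt (logn_vert (G m))) <= c2 * x by rewrite ler_wpM2l// ltW.
have cx0 : 0 <= c2 * x by rewrite mulr_ge0// ltW.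
have cx1 : 0 <= c2 * x * (Mhi / delta) by rewrite mulr_ge0// divr_ge0// ltW.
have p01 (u v : vertex (G m)) : 0 <= edge_prob B u v <= 1.
  rewrite p_le1 andbT /edge_prob mulr_ge0// divr_ge0//.
    by rewrite mulr_ge0// ltW.
  by rewrite mulr_ge0// divr_ge0// sumr_ge0// => w _; rewrite ltW.
have main : 1 - ((expR (1 / 2) + 2 * noise_scale Mlo Bmax kappa) / (nvert (G m))%:R + 2 * delta) -
    Q * phi `^ (1 / 3) <= run_Pr B
      (fun (g : graph (nvert (G m))) (w : pair_sample (nvert (G m)) (tau (nvert (G m)))) =>
        forall out, algorithm_output phi g w out -> recovers (phi `^ (2 / 3)) out).
  apply: (@run_bound R K B Mbar alpha c1 c2 c3 B_sym B_ge0 a0 c20 structure (G m) phi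
    (tau (nvert (G m))) Mlo Mhi Bmax kappa delta y (sizes m) (wpos m) (wmono m)) => //.
  - by move=> i; apply: le_trans (mcl i) _; rewrite ler_wpM2r// ltW.
  - by move=> i; have /andP[] := mb i.
  - by move=> i; have /andP[] := mb i.
  - exact: ltW.
  - by rewrite -ler_pdivrMr// mulrAC.
  - by apply: le_trans fe _; rewrite exprn_ile1// ltW.
  - by rewrite ler_pdivrMr// divr_gt0.
  - by rewrite ler_pdivlMr ?divr_gt0//; apply: le_trans (_ : _ <= c2 * x * (Mhi / delta)) _;
      [rewrite ler_wpM2r// divr_ge0 ?ltW | lra].
  - rewrite -/E; lra.
  - rewrite mulrA; lra.
  - by move=> k; have := hamin k; lra.
  - by move=> a b; exact: (hy (a, b)).
have : run_Pr B
    (fun (g : graph (nvert (G m))) (w : pair_sample (nvert (G m)) (tau (nvert (G m)))) =>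
      forall out, algorithm_output phi g w out -> recovers (phi `^ (2 / 3)) out) <= 1.
  exact: run_Pr_le1.
have nb : (expR (1 / 2) + 2 * noise_scale Mlo Bmax kappa) / (nvert (G m))%:R <= delta.
  by move: Nb; rewrite !ler_pdivrMr ?ltr0n// [_ * delta]mulrC.
have qb : Q * phi `^ (1 / 3) <= delta.
  by rewrite mulrC -ler_pdivlMr// (le_trans q1).
have de : eps = delta * 4 by rewrite /delta; field.
move=> le1; rewrite ger0_norm ?subr_ge0// de; lra.
Unshelve. all: by end_near. Qed.
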